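(* Let $p\ge 3$ be a prime number, let $V=\{0,1,\dots,p-1\}$, and let $T(V)$ be a rooted tree on the vertex set $V$ with root $0$. Let $\varphi$ be a refinable function generated by $T(V)$. Then $\varphi$ generates an orthogonal MRA on the $p$-adic Vilenkin group $\mathfrak G$.
   Context: Let $p$ be a prime. The $p$-adic Vilenkin group $\mathfrak G$ is the set of two-sided sequences $x=(x_k)_{k\in\mathbb Z}$, $x_k\in\{0,\dots,p-1\}$, with only finitely many nonzero $x_k$ with $k<0$, under the operation $\dot+$ of coordinatewise addition modulo $p$ ($\dot-$ is the corresponding subtraction). Put $\mathfrak G_n=\{x: x_k=0 \text{ for } k<n\}$, $n\in\mathbb Z$; these subgroups are a base of neighbourhoods of zero, making $\mathfrak G$ a locally compact abelian group. $\mu$ is the Haar measure with $\mu(\mathfrak G_n)=p^{-n}$. Let $H_0=\{x\in\mathfrak G: x_k=0\text{ for all }k\ge 0\}$. $X$ is the group of (continuous unitary) characters of $\mathfrak G$, written multiplicatively; $(\chi,x)$ is the value of $\chi$ at $x$. $\mathfrak G_n^\bot=\{\chi\in X:(\chi,x)=1\ \forall x\in\mathfrak G_n\}$. The Rademacher characters are $(r_n,x)=\exp(2\pi i x_n/p)$, $n\in\mathbb Z$. The Haar measure $\nu$ on $X$ has $\nu(\mathfrak G_n^\bot)=p^n$. The Fourier transform is $\hat f(\chi)=\int_{\mathfrak G}f(x)\overline{(\chi,x)}\,d\mu(x)$, extended to an isometry of $L_2(\mathfrak G)$ onto $L_2(X)$. The dilation operator $\mathcal A:\mathfrak G\to\mathfrak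 G$ is $(\mathcal Ax)_n=x_{n+1}$; for $\chi\in X$, $n\in\mathbb Z$, $\chi\mathcal A^n$ is the character $(\chi\mathcal A^n,x)=(\chi,\mathcal A^nx)$ (so $r_k\mathcal A^n=r_{k+n}$). Functions generated by a tree. Let $T(V)$ be a tree on $V=\{0,1,\dots,p-1\}$ rooted at $0$, edges $(a,b)$ directed from parent $a$ to child $b$. Choose complex numbers $\lambda_{i+pj}$, $i,j\in\{0,\dots,p-1\}$, with $\lambda_0=1$, $|\lambda_{i+pj}|=1$ if $(j,i)$ is an edge of $T(V)$ ($j$ parent of $i$), and $\lambda_{i+pj}=0$ for all other $(j,i)\ne(0,0)$. A mask generated by $T(V)$ is the function $m_0:X\to\mathbb C$ equal to $\lambda_{i+pj}$ on the coset $\mathfrak G_{-1}^\bot r_{-1}^{i}r_0^{j}$ (these cosets partition $\mathfrak G_1^\bot$), extended to $X$ by periodicity: $m_0(\chi r_1^{\alpha_1}\cdots r_s^{\alpha_s})=m_0(\chi)$ for all $s\in\mathbb N$, $\alpha_j\in\{0,\dots,p-1\}$. The refinable function generated by $T(V)$ (for this choice of $\lambda$) is the $\varphi\in L_2(\mathfrak G)$ with $\hat\varphi(\chi)=\prod_{n=0}^\infty m_0(\chi\mathcal A^{-n})$. MRA. A family of closed subspaces $V_n\subset L_2(\mathfrak G)$, $n\in\mathbb Z$, is a multiresolution analysis (MRA) if: (A1) $V_n\subset V_{n+1}$; (A2) $\overline{\bigcup_nV_n}=L_2(\mathfrak G)$ and $\bigcap_nV_n=\{0\}$; (A3) $f(x)\in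 V_n\Leftrightarrow f(\mathcal Ax)\in V_{n+1}$; (A4) $f(x)\in V_0\Rightarrow f(x\dot-h)\in V_0$ for all $h\in H_0$; (A5) there is $\varphi\in L_2(\mathfrak G)$ such that $(\varphi(x\dot-h))_{h\in H_0}$ is an orthonormal basis of $V_0$. A function $\varphi$ generates an orthogonal MRA if $(\varphi(x\dot-h))_{h\in H_0}$ is an orthonormal system and the closed linear spans $V_n$ of $\{\varphi(\mathcal A^nx\dot-h):h\in H_0\}$, $n\in\mathbb Z$, form an MRA (with $\varphi$ as the function in (A5)). *)

(* Defs.v *)
From HB Require Import structures.
From mathcomp Require Import all_boot all_order all_algebra.
From mathcomp Require Import all_classical all_reals all_analysis.
From mathcomp Require Import complex.
Set Implicit Arguments.
Unset Strict Implicit.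
Unset Printing Implicit Defensive.
Import Order.TTheory GRing.Theory Num.Theory numFieldNormedType.Exports.
Local Open Scope classical_set_scope.
Local Open Scope ring_scope.

(* R[i] comes without a topology; it gets the one every numFieldType carries. *)
HB.instance Definition _ (R : realType) := NormedModule.copy R[i] R[i]^o.

Definition vilenkin_pred (p : nat) : {pred int -> 'F_p} :=
  fun x => `[< finite_set [set k : int | k < 0 /\ x k != 0] >].
Arguments vilenkin_pred p : clear implicits.

Lemma vilenkin_predP (p : nat) (x : int -> 'F_p) :
  (x \in vilenkin_pred p) <-> exists N : int, forall k, k < N -> x k = 0.
Proof.
rewrite unfold_in; split=> [/asboolP|[N xN]].
  move=> /finite_seqP[s sE]; exists (- (\sum_(k <- s) `|k|) - 1) => k kN.
  apply/eqP/negP => /negP xk0.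
  have sum_ge0 : 0 <= \sum_(k <- s) `|k| by apply: sumr_ge0.
  have k0 : k < 0.
    by apply: lt_le_trans kN _; rewrite -opprD oppr_le0 addr_ge0.
  have ks : k \in s by have : [set` s] k by rewrite -sE.
  have : `|k| <= \sum_(k <- s) `|k|.
    by rewrite (big_rem k ks)/= lerDl sumr_ge0.
  rewrite ltr0_norm// leNgt => /negP; apply.
  rewrite ltrNr; apply: lt_trans kN _.
  by rewrite ltrBlDr ltrDl.
apply/asboolP.
apply: (@sub_finite_set _ _ ((fun n : nat => - n%:Z) @` `I_(`|N|.+1)%N)).
  move=> k [k0 xk]; have Nk : N <= k.
    by rewrite leNgt; apply/negP => /xN xk0; rewrite xk0 eqxx in xk.
  exists `|k|%N; last by rewrite abszE ltr0_norm// opprK.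
  rewrite /= ltnS -lez_nat !abszE.
  by rewrite (ltr0_norm k0) (ltr0_norm (le_lt_trans Nk k0)) lerN2.
exact/finite_image/finite_II.
Qed.

Fact vilenkin_zmod_closed (p : nat) : zmod_closed (vilenkin_pred p).
Proof.
split; first by apply/vilenkin_predP; exists 0.
move=> x y /vilenkin_predP[M xM] /vilenkin_predP[N yN].
apply/vilenkin_predP; exists (Num.min M N) => k.
rewrite lt_min => /andP[kM kN].
by rewrite !fctE xM// yN// subr0.
Qed.

HB.instance Definition _ (p : nat) :=
  GRing.isZmodClosed.Build _ (vilenkin_pred p) (vilenkin_zmod_closed p).

(* For p prime, 'F_p is {0, ..., p-1} with addition mod p, so the additive
   group structure inherited from int -> 'F_p is coordinatewise addition
   mod p. *)
Record vilenkin (p : nat) := Vilenkin {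
  coord :> int -> 'F_p;
  _ : coord \in vilenkin_pred p }.

HB.instance Definition _ (p : nat) := [isSub for @coord p].
HB.instance Definition _ (p : nat) := [Choice of vilenkin p by <:].
HB.instance Definition _ (p : nat) :=
  [SubChoice_isSubZmodule of vilenkin p by <:].
HB.instance Definition _ (p : nat) := isPointed.Build (vilenkin p) 0.

Lemma coordD (p : nat) (x y : vilenkin p) k : (x + y) k = x k + y k.
Proof. by []. Qed.

Lemma coordB (p : nat) (x y : vilenkin p) k : (x - y) k = x k - y k.
Proof. by []. Qed.

Lemma vilenkinP (p : nat) (x y : vilenkin p) : x =1 y -> x = y.
Proof. by move=> xy; apply: val_inj; exact/funext. Qed.

Definition Gn (p : nat) (n : int) : set (vilenkin p) :=
  [set x | forall k, k < n -> x k = 0].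
Arguments Gn p n : clear implicits.

Definition H0 (p : nat) : set (vilenkin p) :=
  [set x | forall k, 0 <= k -> x k = 0].
Arguments H0 p : clear implicits.

Definition vilenkin_nbhs (p : nat) (x : vilenkin p) : set_system (vilenkin p) :=
  [set A | exists n : int, [set x + z | z in Gn p n] `<=` A].

HB.instance Definition _ (p : nat) :=
  hasNbhs.Build (vilenkin p) (@vilenkin_nbhs p).

Lemma vilenkin_nbhsP (p : nat) (x : vilenkin p) (A : set (vilenkin p)) :
  nbhs x A <-> exists n : int, forall y, Gn p n (y - x) -> A y.
Proof.
split=> -[n nA]; exists n.
  by move=> y yx; apply: nA; exists (y - x) => //; rewrite addrC subrK.
by move=> _ [z zn <-]; apply: nA; rewrite addrAC subrr add0r.
Qed.

Fact vilenkin_nbhs_filter (p : nat) (x : vilenkin p) : ProperFilter (nbhs x).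
Proof.
apply: Build_ProperFilter_ex.
  move=> A /vilenkin_nbhsP[n nA]; exists x; apply: nA => k _.
  by rewrite subrr.
split; first by apply/vilenkin_nbhsP; exists 0.
  move=> A B /vilenkin_nbhsP[m mA] /vilenkin_nbhsP[n nB].
  apply/vilenkin_nbhsP; exists (Num.max m n) => y yx.
  by split; [apply: mA|apply: nB] => k kn; apply: yx; rewrite lt_max kn ?orbT.
move=> A B AB /vilenkin_nbhsP[n nA]; apply/vilenkin_nbhsP.
by exists n => y /nA/AB.
Qed.

Fact vilenkin_nbhs_singleton (p : nat) (x : vilenkin p) (A : set (vilenkin p)) :
  nbhs x A -> A x.
Proof. by move=> /vilenkin_nbhsP[n]; apply => k _; rewrite subrr. Qed.

Fact vilenkin_nbhs_nbhs (p : nat) (x : vilenkin p) (A : set (vilenkin p)) :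
  nbhs x A -> nbhs x (nbhs^~ A).
Proof.
move=> /vilenkin_nbhsP[n nA]; apply/vilenkin_nbhsP; exists n => y yx.
apply/vilenkin_nbhsP; exists n => z zy; apply: nA => k kn.
by rewrite -(subrKA y) coordD yx// zy// addr0.
Qed.

HB.instance Definition _ (p : nat) :=
  Nbhs_isNbhsTopological.Build (vilenkin p) (@vilenkin_nbhs_filter p)
    (@vilenkin_nbhs_singleton p) (@vilenkin_nbhs_nbhs p).

HB.instance Definition _ (p : nat) :=
  Measurable.copy (vilenkin p) (g_sigma_algebraType (@open (vilenkin p))).

Fact dilation_subproof (p : nat) (n : int) (x : vilenkin p) :
  (fun k => x (k + n)) \in vilenkin_pred p.
Proof.
have /vilenkin_predP[N xN] := valP x; apply/vilenkin_predP; exists (N - n).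
by move=> k kN; apply: xN; rewrite -ltrBrDr.
Qed.

(* The n-th power of the dilation operator; see dilation0 and dilationD. *)
Definition dilation (p : nat) (n : int) (x : vilenkin p) : vilenkin p :=
  Vilenkin (dilation_subproof n x).

Lemma dilation0 (p : nat) (x : vilenkin p) : dilation 0 x = x.
Proof. by apply: vilenkinP => k /=; rewrite addr0. Qed.

Lemma dilationD (p : nat) m n (x : vilenkin p) :
  dilation (m + n) x = dilation m (dilation n x).
Proof. by apply: vilenkinP => k /=; rewrite addrA. Qed.

Lemma dilation_continuous (p : nat) (n : int) :
  continuous (@dilation p n : vilenkin p -> vilenkin p).
Proof.
move=> x A /vilenkin_nbhsP[m mA]; apply/vilenkin_nbhsP; exists (m + n).
by move=> y yx; apply: mA => k km; apply: (yx (k + n)); rewrite ltrD2r.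
Qed.

Definition is_character (R : realType) (p : nat) (chi : vilenkin p -> R[i]) :=
  [/\ continuous chi,
      forall x, `|chi x| = 1 &
      forall x y, chi (x + y) = chi x * chi y].

Record character (R : realType) (p : nat) := Character {
  char_fun :> vilenkin p -> R[i];
  _ : is_character char_fun }.

HB.instance Definition _ (R : realType) (p : nat) :=
  gen_eqMixin (character R p).
HB.instance Definition _ (R : realType) (p : nat) :=
  gen_choiceMixin (character R p).

Lemma charP (R : realType) (p : nat) (chi : character R p) : is_character chi.
Proof. by case: chi. Qed.

Lemma char_neq0 (R : realType) (p : nat) (chi : character R p) x : chi x != 0.
Proof. by have [_ c1 _] := charP chi; rewrite -normr_eq0 c1 oner_neq0. Qed.

Lemma characterP (R : realType) (p : nat) (chi psi : character R p) :
  chi =1 psi -> chi = psi.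
Proof.
case: chi psi => f fP [g gP] /= /funext fg; case: _ / fg gP => gP.
by rewrite (Prop_irrelevance fP gP).
Qed.

Fact char1_subproof (R : realType) (p : nat) :
  is_character (fun=> 1 : R[i]) (p := p).
Proof.
split=> [|x|x y]; [exact: cst_continuous|exact: normr1|by rewrite mulr1].
Qed.

Fact charM_subproof (R : realType) (p : nat) (chi psi : character R p) :
  is_character (fun x => chi x * psi x).
Proof.
have [cc c1 cD] := charP chi; have [dc d1 dD] := charP psi.
split=> [x|x|x y].
- exact: (@cvgM (R[i] : numFieldType) _ _ _ chi psi _ _ (cc x) (dc x)).
- by rewrite normrM c1 d1 mulr1.
- by rewrite cD dD mulrACA.
Qed.

Fact charV_subproof (R : realType) (p : nat) (chi : character R p) :
  is_character (fun x => (chi x)^-1).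
Proof.
have [cc c1 cD] := charP chi; split=> [x|x|x y].
- exact: (@cvgV (R[i] : numFieldType) _ _ (nbhs_filter x) chi (chi x)
           (char_neq0 chi x) (cc x)).
- by rewrite normfV c1 invr1.
- by rewrite cD invfM.
Qed.

Definition char1 (R : realType) (p : nat) := Character (char1_subproof R p).
Definition charM (R : realType) (p : nat) (chi psi : character R p) :=
  Character (charM_subproof chi psi).
Definition charV (R : realType) (p : nat) (chi : character R p) :=
  Character (charV_subproof chi).

Fact charMA (R : realType) (p : nat) : associative (@charM R p).
Proof. by move=> x y z; apply: characterP => t /=; rewrite mulrA. Qed.
Fact char1M (R : realType) (p : nat) : left_id (char1 R p) (@charM R p).
Proof. by move=> x; apply: characterP => t /=; rewrite mul1r. Qed.
Fact charM1 (R : realType) (p : nat) : right_id (char1 R p) (@charM R p).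
Proof. by move=> x; apply: characterP => t /=; rewrite mulr1. Qed.
Fact charVM (R : realType) (p : nat) :
  left_inverse (char1 R p) (@charV R p) (@charM R p).
Proof.
by move=> x; apply: characterP => t /=; rewrite mulVf ?char_neq0.
Qed.
Fact charMV (R : realType) (p : nat) :
  right_inverse (char1 R p) (@charV R p) (@charM R p).
Proof.
by move=> x; apply: characterP => t /=; rewrite mulfV ?char_neq0.
Qed.

HB.instance Definition _ (R : realType) (p : nat) :=
  isGroup.Build (character R p) (@charMA R p) (@char1M R p) (@charM1 R p)
    (@charVM R p) (@charMV R p).

HB.instance Definition _ (R : realType) (p : nat) :=
  isPointed.Build (character R p) (char1 R p).

(* The usual topology of the dual group: uniform convergence on compact sets. *)
HB.instance Definition _ (R : realType) (p : nat) :=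
  Topological.copy (character R p)
    (initial_topology
      (@char_fun R p : character R p -> {compact-open, vilenkin p -> R[i]})).

HB.instance Definition _ (R : realType) (p : nat) :=
  Measurable.copy (character R p)
    (g_sigma_algebraType (@open (character R p))).

Definition annihilator (R : realType) (p : nat) (n : int) :
  set (character R p) := [set chi | forall x, Gn p n x -> chi x = 1].
Arguments annihilator R p n : clear implicits.

Definition expi (R : realType) (t : R) : R[i] := (cos t +i* sin t)%C.

Lemma expiD (R : realType) (s t : R) : expi (s + t) = expi s * expi t.
Proof.
rewrite /expi cosD sinD; simpc; congr (_ +i* _)%C.
by rewrite [X in _ = X + _]mulrC addrC; congr (_ + _); rewrite mulrC.
Qed.

Lemma norm_expi (R : realType) (t : R) : `|expi t| = 1.
Proof. by rewrite normc_def /= cos2Dsin2 sqrtr1. Qed.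

Lemma expi_period (R : realType) (m q : nat) : (0 < q)%N ->
  expi (2 * pi * (m %% q)%:R / q%:R) = expi (2 * pi * m%:R / q%:R) :> R[i].
Proof.
move=> q0; have q0' : q%:R != 0 :> R by rewrite pnatr_eq0 -lt0n.
have divE (a : R) :
    a * m%:R / q%:R = a * (m %/ q)%:R + a * (m %% q)%:R / q%:R.
  by rewrite {1}(divn_eq m q) natrD natrM mulrDr mulrDl mulrA mulfK.
rewrite divE expiD.
suff -> : expi (2 * pi * (m %/ q)%:R) = 1 :> R[i] by rewrite mul1r.
elim: (m %/ q)%N => [|k IHk]; first by rewrite mulr0 /expi cos0 sin0.
rewrite -(natr1 k) (mulrDr (2 * pi)) expiD IHk mul1r mulr1 /expi.
by rewrite mulr_natl cos2pi sin2pi.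
Qed.

Fact rademacher_subproof (R : realType) (p : nat) (p_pr : prime p) (n : int) :
  is_character
    (fun x : vilenkin p => expi (2 * pi * (x n : nat)%:R / p%:R) : R[i]).
Proof.
split=> [x|x|x y]; last 2 first.
- exact: norm_expi.
- rewrite -expiD -mulrDl -mulrDr -natrD -[RHS]expi_period ?prime_gt0//.
  by congr (expi (_ * _%:R / _)); rewrite coordD /= [X in (_ %% X)%N]Fp_cast.
- apply: (@cvg_near_cst _ _ _ _ _ (nbhs_filter x)).
  apply/vilenkin_nbhsP; exists (n + 1) => y yx.
  suff -> : y n = x n by [].
  by apply/eqP; rewrite -subr_eq0 -coordB yx// ltrDl.
Qed.

(* Primality makes the order of 'F_p equal to p, so that this is a character. *)
Definition rademacher (R : realType) (p : nat) (p_pr : prime p) (n : int) :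
  character R p := Character (rademacher_subproof R p_pr n).
Arguments rademacher R {p} p_pr n.

Fact char_dilation_subproof (R : realType) (p : nat) (chi : character R p)
    (n : int) :
  is_character (fun x => chi (dilation n x)).
Proof.
have [cc c1 cD] := charP chi; split=> [x|x|x y].
- apply: continuous_comp; first exact: dilation_continuous.
  exact: cc.
- exact: c1.
- by rewrite -cD; congr (chi _); exact: vilenkinP.
Qed.

Definition char_dilation (R : realType) (p : nat) (chi : character R p)
  (n : int) : character R p := Character (char_dilation_subproof chi n).

Lemma rademacher_dilation (R : realType) (p : nat) (p_pr : prime p) k n :
  char_dilation (rademacher R p_pr k) n = rademacher R p_pr (k + n).
Proof. exact: characterP. Qed.

Definition is_haar_vilenkin (R : realType) (p : nat)
    (mu : {measure set (vilenkin p) -> \bar R}) :=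
  (forall (a : vilenkin p) (A : set (vilenkin p)),
     measurable A -> mu [set a + x | x in A] = mu A) /\
  (forall n : int, mu (Gn p n) = (p%:R ^ (- n))%:E).

Definition is_haar_character (R : realType) (p : nat)
    (nu : {measure set (character R p) -> \bar R}) :=
  (forall (chi : character R p) (A : set (character R p)),
     measurable A -> nu [set (chi * xi)%g | xi in A] = nu A) /\
  (forall n : int, nu (annihilator R p n) = (p%:R ^ n)%:E).

(* Elements of L2 are represented by functions; equality in L2 is equality
   almost everywhere, i.e. L2norm (f - g) = 0. *)
Section complex_L2.
Context {d : measure_display} {T : measurableType d} {R : realType}.
Variable mu : {measure set T -> \bar R}.
Implicit Types (f g : T -> R[i]) (A : set (T -> R[i])).

Definition cintegral f : R[i] :=
  (\int[mu]_x complex.Re (f x) +i* \int[mu]_x complex.Im (f x))%C.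

Definition L1 : set (T -> R[i]) := [set f |
  mu.-integrable setT (fun x => (complex.Re (f x))%:E) /\
  mu.-integrable setT (fun x => (complex.Im (f x))%:E)].

Definition L2norm f : \bar R :=
  'N[mu]_2%:E[(fun x => (Normc.normc (f x))%:E)]%E.

Definition L2 : set (T -> R[i]) := [set f |
  [/\ measurable_fun setT (fun x => complex.Re (f x)),
      measurable_fun setT (fun x => complex.Im (f x)) &
      (L2norm f < +oo)%E]].

Definition L2inner f g : R[i] := cintegral (fun x => f x * (g x)^*%C).

Definition L2cvg (u : nat -> T -> R[i]) f :=
  (fun n => L2norm (fun x => u n x - f x)) @ \oo --> 0%E.

Definition L2closure A : set (T -> R[i]) :=
  [set f | L2 f /\ forall e : R, 0 < e ->
    exists2 g, A g & (L2norm (fun x => (f x - g x)%R) < e%:E)%E].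

Definition linear_span A : set (T -> R[i]) :=
  [set f | exists (n : nat) (c : 'I_n -> R[i]) (u : 'I_n -> T -> R[i]),
    (forall i, A (u i)) /\ forall x, f x = \sum_(i < n) c i * u i x].

Definition closed_span A := L2closure (linear_span A).

Definition closed_subspace A :=
  [/\ A `<=` L2,
      A (fun=> 0),
      forall (a : R[i]) f g, A f -> A g -> A (fun x => a * f x + g x) &
      L2closure A `<=` A].

Definition orthonormal_system {I : eqType} (D : set I) (e : I -> T -> R[i]) :=
  (forall i, D i -> L2 (e i)) /\
  (forall i j, D i -> D j -> L2inner (e i) (e j) = (i == j)%:R).

Definition orthonormal_basis {I : eqType} (D : set I) (e : I -> T -> R[i]) A :=
  orthonormal_system D e /\ closed_span [set e i | i in D] = A.

End complex_L2.

Section fourier.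
Context {R : realType} {p : nat}.
Variable mu : {measure set (vilenkin p) -> \bar R}.
Variable nu : {measure set (character R p) -> \bar R}.

Definition fourier_L1 (f : vilenkin p -> R[i]) : character R p -> R[i] :=
  fun chi => cintegral mu (fun x => f x * (chi x)^*%C).

(* g represents the Fourier transform of f in L2: the transform on L2 is the
   extension by continuity of the integral formula from L1 `&` L2. *)
Definition is_fourier (f : vilenkin p -> R[i]) (g : character R p -> R[i]) :=
  [/\ L2 mu f, L2 nu g &
      exists u : nat -> vilenkin p -> R[i],
        [/\ forall n, (L1 mu `&` L2 mu) (u n),
            L2cvg mu u f &
            L2cvg nu (fun n => fourier_L1 (u n)) g]].

End fourier.

Definition is_tree (V : finType) (T : rel V) :=
  [/\ symmetric T,
      irreflexive T,
      forall x y, connect T x y &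
      forall c : seq V, (2 < size c)%N -> ~~ ucycleb T c].

(* A tree is an undirected graph; the root orients its edges, from parent to
   child. In the tree T rooted at r, the vertex a is the parent of b if it comes just
   before b on the simple path from r to b. *)
Definition parent (V : finType) (T : rel V) (r a b : V) :=
  exists s : seq V,
    [/\ path T r (rcons s b), uniq (r :: rcons s b) & last r s = a].

Section generated.
Context {R : realType} {p : nat}.

Definition tree_coefficients (T : rel 'F_p) (lam : nat -> R[i]) :=
  [/\ lam 0%N = 1,
      forall i j : 'F_p, parent T 0 j i -> `|lam (i + p * j)%N| = 1 &
      forall i j : 'F_p, ~ parent T 0 j i -> (j, i) != (0, 0) ->
        lam (i + p * j)%N = 0].

Definition is_mask (p_pr : prime p) (lam : nat -> R[i])
    (m0 : character R p -> R[i]) :=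
  (forall (i j : 'F_p) zeta, annihilator R p (-1) zeta ->
     m0 (zeta * rademacher R p_pr (-1) ^+ i * rademacher R p_pr 0 ^+ j)%g =
     lam (i + p * j)%N) /\
  (forall (s : nat) (alpha : nat -> 'F_p) chi,
     m0 (chi * \big[*%g/1%g]_(1 <= k < s.+1)
                 (rademacher R p_pr k%:Z ^+ alpha k))%g = m0 chi).

Definition infinite_product (m0 : character R p -> R[i]) :
    character R p -> R[i] :=
  fun chi => lim ((fun N : nat =>
    \prod_(n < N) m0 (char_dilation chi (- n%:Z))) @ \oo).

Definition refinable_generated_by (p_pr : prime p)
    (mu : {measure set (vilenkin p) -> \bar R})
    (nu : {measure set (character R p) -> \bar R})
    (T : rel 'F_p) (phi : vilenkin p -> R[i]) :=
  exists (lam : nat -> R[i]) (m0 : character R p -> R[i]),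
    [/\ tree_coefficients T lam, is_mask p_pr lam m0 &
        is_fourier mu nu phi (infinite_product m0)].

End generated.

Section mra.
Context {R : realType} {p : nat}.
Variable mu : {measure set (vilenkin p) -> \bar R}.

Definition translation (f : vilenkin p -> R[i]) (h : vilenkin p) :
  vilenkin p -> R[i] := fun x => f (x - h).

Definition is_MRA_with (V : int -> set (vilenkin p -> R[i]))
    (phi : vilenkin p -> R[i]) :=
  (forall n, closed_subspace mu (V n)) /\
  [/\ forall n, V n `<=` V (n + 1),
      L2closure mu (\bigcup_n V n) = L2 mu /\
      \bigcap_n V n = [set f | L2 mu f /\ {ae mu, forall x, f x = 0}],
      forall n f, V n f <-> V (n + 1) (fun x => f (dilation 1 x)),
      forall f h, V 0 f -> H0 p h -> V 0 (translation f h) &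
      orthonormal_basis mu (H0 p) (translation phi) (V 0)].

Definition is_MRA (V : int -> set (vilenkin p -> R[i])) :=
  exists phi, is_MRA_with V phi.

Definition mra_space (phi : vilenkin p -> R[i]) (n : int) :
    set (vilenkin p -> R[i]) :=
  closed_span mu [set (fun x => phi (dilation n x - h)) | h in H0 p].

Definition generates_orthogonal_MRA (phi : vilenkin p -> R[i]) :=
  orthonormal_system mu (H0 p) (translation phi) /\
  is_MRA_with (mra_space phi) phi.

End mra.

(* Main.v *)
Require Import Defs.
From mathcomp Require Import all_boot all_order all_algebra.
From mathcomp Require Import all_classical all_reals all_analysis.
From mathcomp Require Import complex measurable_realfun.
From mathcomp Require Import ring lra zify.
Set Implicit Arguments.
Unset Strict Implicit.
Unset Printing Implicit Defensive.
Import Order.TTheory GRing.Theory Num.Theory numFieldNormedType.Exports.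
Local Open Scope classical_set_scope.
Local Open Scope ring_scope.

(** The idea of the proof.  Let q send a vertex to its parent and the root 0 to
itself.  The mask coefficient with indices i and j is nonzero exactly when
j = q i, and it then has modulus 1.  So the infinite product vanishes at a
character unless its digits i, q i, q (q i), ... from position -1 on form the
path from some vertex i to the root, and at those characters its value c_i has
modulus 1 and depends on i only ([infinite_product_digits]).  It follows that
phi is almost everywhere the explicit function
  [tree_fun] = p^-1 1_B (c_0 chi_0 + ... + c_(p-1) chi_(p-1)),   B = G_(-1),
where [tree_char] i = chi_i is the character with the digits of that path
([infinite_product_tree]).

To conclude that phi is [tree_fun] from the equality of transforms, one needs
that the Fourier transform is injective on L2 ([fourier_unique]).  The integral
of w over a ball is a finite average of values of the transform of w truncated
to some G_L ([fourier_inversion]); the truncated transform is constant on the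
cosets of the annihilator of G_L and uniformly close to the transform of w
([fourier_trunc]).  This bounds the ball integral by the L2 norm of the
transform, and the indicators of balls are total in L2 ([balls_total]).  Only
characters with finitely many prescribed digits on G_L enter, and these are the
characters at which the definition of a mask determines it.

The rest concerns [tree_fun].  Its translates by H_0 are orthonormal because the
chi_i are distinct characters of B and the c_i have modulus 1
([tree_fun_orthonormal]).  Inverting a discrete Fourier transform in the
coordinate at position -1, these translates span the same space as the wave
packets 1_(g + B) chi_i ([span_tree_fun_translates]), so V_n is the closed span
of the dilated packets.  Dropping the first digit of a path gives the path of
the parent; hence a packet is a linear combination of p packets of the next finer
scale, and V_n is contained in V_(n+1) ([packet_spaceS]).  The union of the V_n is
dense because chi_0 = 1, so that it contains the indicators of all balls.  Their
intersection is trivial because paths have bounded length: elements of V_n are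
limits of functions constant on the cosets of G_(n+D) for a fixed D
([packet_intersection_trivial]). *)

(** * The squared modulus *)

Section complex_numbers.
Context {R : realType}.
Implicit Types z w : R[i].

(** The norm of R[i] takes its values in R[i]; integrals need a real number. *)
Definition sqmod z : R := complex.Re z ^+ 2 + complex.Im z ^+ 2.

Lemma sqmod_ge0 z : 0 <= sqmod z.
Proof. by rewrite addr_ge0 ?sqr_ge0. Qed.

Lemma sqmod0 : sqmod 0 = 0.
Proof. by rewrite /sqmod /= expr0n addr0. Qed.

Lemma sqmod_eq0 z : sqmod z = 0 -> z = 0.
Proof.
case: z => a b; rewrite /sqmod /= => /eqP.
rewrite paddr_eq0 ?sqr_ge0// !sqrf_eq0 => /andP[/eqP-> /eqP->]; reflexivity.
Qed.

Lemma sqmodM z w : sqmod (z * w) = sqmod z * sqmod w.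
Proof. by case: z w => a b [c d]; rewrite /sqmod /=; ring. Qed.

Lemma sqmodN z : sqmod (- z) = sqmod z.
Proof. by case: z => a b; rewrite /sqmod /= !sqrrN. Qed.

Lemma sqmodD_le z w : sqmod (z + w) <= 2 * (sqmod z + sqmod w).
Proof. 
case: z w => a b [c d]; rewrite /sqmod /= -subr_ge0.
rewrite (_ : _ - _ = (a - c) ^+ 2 + (b - d) ^+ 2); last by ring.
by rewrite addr_ge0 ?sqr_ge0.
Qed.

Lemma sqmod_real (r : R) : sqmod r%:C%C = r ^+ 2.
Proof. by rewrite /sqmod /= expr0n addr0. Qed.

Lemma normc_sqmod z : Normc.normc z = Num.sqrt (sqmod z).
Proof. by case: z. Qed.

Lemma sqmod_norm1 z : `|z| = 1 -> sqmod z = 1.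
Proof.
move=> z1; apply: complexI; rewrite /sqmod.
by rewrite add_Re2_Im2 z1 expr1n.
Qed.

Lemma mulJ_sqmod z : z * z^*%C = (sqmod z)%:C%C.
Proof. by case: z => a b; rewrite /sqmod /=; simpc; congr (_ +i* _)%C; ring. Qed.

Lemma sqmodJ z : sqmod z^*%C = sqmod z.
Proof. by case: z => a b; rewrite /sqmod /= sqrrN. Qed.

Lemma cReD z w : complex.Re (z + w) = complex.Re z + complex.Re w.
Proof. by case: z w => ? ? [? ?]. Qed.
Lemma cImD z w : complex.Im (z + w) = complex.Im z + complex.Im w.
Proof. by case: z w => ? ? [? ?]. Qed.
Lemma cReM z w : complex.Re (z * w) =
  complex.Re z * complex.Re w - complex.Im z * complex.Im w.
Proof. by case: z w => ? ? [? ?]. Qed.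
Lemma cImM z w : complex.Im (z * w) =
  complex.Re z * complex.Im w + complex.Im z * complex.Re w.
Proof. by case: z w => ? ? [? ?] /=. Qed.

End complex_numbers.

(** * Square-integrable complex functions *)

Section L2_theory.
Context {d : measure_display} {T : measurableType d} {R : realType}.
Variable mu : {measure set T -> \bar R}.
Implicit Types (f g : T -> R[i]) (A : set (T -> R[i])).

Definition cmeas f := measurable_fun setT (fun x => complex.Re (f x)) /\
  measurable_fun setT (fun x => complex.Im (f x)).

(** The square of the L2 norm, with which estimates avoid square roots. *)
Definition sqL2 f : \bar R := (\int[mu]_x (sqmod (f x))%:E)%E.

Definition sqdist f g : \bar R := sqL2 (fun x => f x - g x).

Import HBNNSimple.

(** The integral of a nonnegative function is the supremum of the integrals of
the simple functions below it, hence monotone even on non-measurable functions;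
Fourier transforms are bounded from below in this way. *)
Lemma le_integral_pos (f g : T -> \bar R) : (forall x, 0 <= f x)%E ->
  (forall x, f x <= g x)%E -> (\int[mu]_x f x <= \int[mu]_x g x)%E.
Proof.
move=> f0 fg; rewrite !ge0_integralTE//; last first.
  by move=> x; exact: le_trans (f0 x) (fg x).
apply: ereal_sup_le => _ [h hf <-] /=.
exists h => // x; exact: le_trans (hf x) (fg x).
Qed.

Lemma sqL2_ge0 f : (0 <= sqL2 f)%E.
Proof. by apply: integral_ge0 => x _; rewrite lee_fin sqmod_ge0. Qed.

Lemma le_sqL2 f g : (forall x, sqmod (f x) <= sqmod (g x)) -> (sqL2 f <= sqL2 g)%E.
Proof.
by move=> fg; apply: le_integral_pos => x; rewrite lee_fin ?fg// sqmod_ge0.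
Qed.

Lemma eq_sqL2 f g : (forall x, sqmod (f x) = sqmod (g x)) -> sqL2 f = sqL2 g.
Proof. by move=> fg; apply: eq_integral => x _; rewrite fg. Qed.

Lemma L2normE f : (L2norm mu f `^ 2 = sqL2 f)%E.
Proof.
rewrite /L2norm powR_Lnorm//; apply: eq_integral => x _.
rewrite normc_sqmod /= ger0_norm ?sqrtr_ge0// powR_mulrn ?sqrtr_ge0//.
by rewrite sqr_sqrtr ?sqmod_ge0.
Qed.

Lemma L2norm_lt f (e : R) : 0 < e ->
  (L2norm mu f < e%:E)%E = (sqL2 f < (e ^+ 2)%:E)%E.
Proof.
move=> e0; rewrite -L2normE; have : (0 <= L2norm mu f)%E by exact: Lnorm_ge0.
case: (L2norm mu f) => [r| |]//.
- rewrite poweR_EFin !lte_fin lee_fin => r0.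
  by rewrite powR_mulrn// ltr_pXn2r// nnegrE ltW.
- by rewrite poweRyr.
Qed.

Lemma L2norm_fin f : (L2norm mu f < +oo)%E = (sqL2 f < +oo)%E.
Proof.
rewrite -L2normE; have : (0 <= L2norm mu f)%E by exact: Lnorm_ge0.
case: (L2norm mu f) => [r| |]//.
- by rewrite poweR_EFin !ltry.
- by rewrite poweRyr.
Qed.

Lemma L2P f : L2 mu f <-> cmeas f /\ (sqL2 f < +oo)%E.
Proof. by rewrite /L2/= L2norm_fin; split=> [[]|[[]]]. Qed.

Lemma L2cvg_near (u : nat -> T -> R[i]) f (e : R) : 0 < e -> L2cvg mu u f ->
  \forall n \near \oo, (sqdist (u n) f < e%:E)%E.
Proof.
move=> e0 uf.
have se0 : 0 < Num.sqrt e by rewrite sqrtr_gt0.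
have : nbhs (0%E : \bar R) [set y : \bar R | (y < (Num.sqrt e)%:E)%E].
  exists (Num.sqrt e) => //= y /=; rewrite sub0r normrN => ye.
  by rewrite lte_fin (le_lt_trans (ler_norm y)).
move=> /uf H; have {}H : \forall n \near \oo,
    (L2norm mu (fun x => (u n x - f x)%R) < (Num.sqrt e)%:E)%E by [].
apply: filterS H => n.
by rewrite L2norm_lt// sqr_sqrtr// ltW.
Qed.

Lemma cmeas_cst (c : R[i]) : cmeas (fun=> c).
Proof. by split; exact: measurable_cst. Qed.

Lemma cmeasD f g : cmeas f -> cmeas g -> cmeas (fun x => f x + g x).
Proof.
move=> [f1 f2] [g1 g2]; split.
- by under eq_fun do rewrite cReD; exact: measurable_funD.
- by under eq_fun do rewrite cImD; exact: measurable_funD.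
Qed.

Lemma cmeasM f g : cmeas f -> cmeas g -> cmeas (fun x => f x * g x).
Proof.
move=> [f1 f2] [g1 g2]; split.
- under eq_fun do rewrite cReM.
  by apply: measurable_funB; exact: measurable_funM.
- under eq_fun do rewrite cImM.
  by apply: measurable_funD; exact: measurable_funM.
Qed.

Lemma cmeasZ (c : R[i]) f : cmeas f -> cmeas (fun x => c * f x).
Proof. exact/cmeasM/cmeas_cst. Qed.

Lemma cmeasJ f : cmeas f -> cmeas (fun x => (f x)^*%C).
Proof.
move=> [f1 f2]; split.
- suff -> : (fun x => complex.Re (f x)^*%C) = (fun x => complex.Re (f x)) by [].
  by apply/funext => x; case: (f x).
- suff -> : (fun x => complex.Im (f x)^*%C) = (fun x => - complex.Im (f x)).
    exact: measurable_funN.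
  by apply/funext => x; case: (f x).
Qed.

Lemma measurable_sqmod f : cmeas f -> measurable_fun setT (fun x => sqmod (f x)).
Proof. by move=> [f1 f2]; apply: measurable_funD; exact: measurable_funX. Qed.

Lemma cmeas_real (h : T -> R) : measurable_fun setT h ->
  cmeas (fun x => (h x)%:C%C).
Proof. by move=> mh; split => //=; exact: measurable_cst. Qed.

Definition cind (A : set T) : T -> R[i] := fun x => (\1_A x : R)%:C%C.

Lemma cmeas_ind (A : set T) : measurable A -> cmeas (cind A).
Proof. by move=> mA; exact/cmeas_real/measurable_indic. Qed.

Lemma sqmod_ind (A : set T) x : sqmod (cind A x) = \1_A x.
Proof. by rewrite sqmod_real indicE; case: (_ \in _); rewrite /= ?expr1n ?expr0n. Qed.

Lemma sqL2_ind (A : set T) : measurable A -> sqL2 (cind A) = mu A.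
Proof.
move=> mA; rewrite /sqL2; under eq_integral do rewrite sqmod_ind.
by rewrite integral_indic// setIT.
Qed.

(** The integrated form of [sqmodD_le]; its factor 2 is harmless wherever the
right-hand side is made arbitrarily small. *)
Lemma sqL2D_le f g : cmeas f -> cmeas g ->
  (sqL2 (fun x => (f x + g x)%R) <= 2%:E * (sqL2 f + sqL2 g))%E.
Proof.
move=> mf mg.
have pos h x : (0%R <= (sqmod (h x : R[i]))%:E)%E by rewrite lee_fin sqmod_ge0.
rewrite /sqL2 -ge0_integralD//; last 2 first.
- exact/measurable_EFinP/measurable_sqmod.
- exact/measurable_EFinP/measurable_sqmod.
rewrite -ge0_integralZl//.
- apply: le_integral_pos => x; first exact: pos.
  by rewrite -EFinD -EFinM lee_fin sqmodD_le.
- by apply: emeasurable_funD; exact/measurable_EFinP/measurable_sqmod.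
- by move=> x _; rewrite adde_ge0.
Qed.

Lemma sqL2Z (c : R[i]) f : cmeas f ->
  sqL2 (fun x => c * f x) = ((sqmod c)%:E * sqL2 f)%E.
Proof.
move=> mf; rewrite /sqL2; under eq_integral do rewrite sqmodM EFinM.
rewrite ge0_integralZl//.
- exact/measurable_EFinP/measurable_sqmod.
- by move=> x _; rewrite lee_fin sqmod_ge0.
- by rewrite lee_fin sqmod_ge0.
Qed.

Lemma L2_lin (a : R[i]) f g : L2 mu f -> L2 mu g ->
  L2 mu (fun x => a * f x + g x).
Proof.
move=> /L2P[mf ff] /L2P[mg gg]; apply/L2P; split.
  by apply: cmeasD => //; exact: cmeasZ.
apply: le_lt_trans (sqL2D_le (cmeasZ a mf) mg) _.
rewrite sqL2Z// lte_mul_pinfty ?lee_fin//.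
by rewrite lte_add_pinfty// lte_mul_pinfty ?lee_fin ?sqmod_ge0.
Qed.

Lemma L2_0 : L2 mu (fun=> 0).
Proof.
apply/L2P; split; first exact: cmeas_cst.
by rewrite /sqL2; under eq_integral do rewrite sqmod0; rewrite integral0.
Qed.

Lemma L2B f g : L2 mu f -> L2 mu g -> L2 mu (fun x => f x - g x).
Proof.
move=> Lf Lg; have := L2_lin (-1) Lg Lf; congr (L2 mu _).
by apply/funext => x; rewrite mulN1r addrC.
Qed.

Definition linear_set A := A (fun=> 0) /\
  forall (a : R[i]) f g, A f -> A g -> A (fun x => a * f x + g x).

Lemma linear_set_sum A (I : Type) (s : seq I) (c : I -> R[i]) (u : I -> T -> R[i]) :
  linear_set A -> (forall i, A (u i)) -> A (fun x => \sum_(i <- s) c i * u i x).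
Proof.
move=> [A0 AD] Au; elim: s => [|i s IHs].
  by under eq_fun do rewrite big_nil.
by under eq_fun do rewrite big_cons; exact: AD.
Qed.

Lemma linear_span_min A B : linear_set B -> A `<=` B -> linear_span A `<=` B.
Proof.
move=> lB AB f [n [c [u [Au fE]]]].
rewrite (_ : f = fun x => \sum_(i < n) c i * u i x); last exact/funext.
by apply: linear_set_sum => // i; exact: AB.
Qed.

Lemma linear_span_linear A : linear_set (linear_span A).
Proof.
split.
  by exists 0%N, (fun=> 0), (fun _ _ => 0); split=> [[]|x] //; rewrite big_ord0.
move=> a f g [m [c [u [Au fE]]]] [n [b [v [Av gE]]]].
exists (m + n)%N,
  (fun i => match fintype.split i with inl j => a * c j | inr j => b j end),
  (fun i => match fintype.split i with inl j => u j | inr j => v j end).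
split; first by move=> i; case: (fintype.split i).
move=> x; rewrite big_split_ord/= fE gE mulr_sumr; congr (_ + _); apply: eq_bigr => i _.
  by rewrite -[lshift _ _]/(unsplit (inl i)) unsplitK mulrA.
by rewrite -[rshift _ _]/(unsplit (inr i)) unsplitK.
Qed.

Lemma sub_linear_span A : A `<=` linear_span A.
Proof.
move=> f Af; exists 1%N, (fun=> 1), (fun=> f); split=> // x.
by rewrite big_ord1 mul1r.
Qed.

Lemma L2closureP A f : L2closure mu A f <-> L2 mu f /\ forall e : R, 0 < e ->
  exists2 g, A g & (sqdist f g < e%:E)%E.
Proof.
split=> -[Lf Af]; split => // e e0.
  have se0 : 0 < Num.sqrt e by rewrite sqrtr_gt0.
  have [g Ag] := Af _ se0; rewrite L2norm_lt// sqr_sqrtr ?ltW// => fg.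
  by exists g.
have [g Ag fg] := Af (e ^+ 2) (exprn_gt0 _ e0).
by exists g => //; rewrite L2norm_lt.
Qed.

Lemma sub_L2closure A : A `<=` L2 mu -> A `<=` L2closure mu A.
Proof.
move=> AL f Af; apply/L2closureP; split; first exact: AL.
move=> e e0; exists f => //.
rewrite (_ : sqdist _ _ = 0%E) ?lte_fin//.
under [sqdist _ _]eq_integral do rewrite subrr sqmod0.
exact: integral0.
Qed.

Lemma L2closure_subset A B : A `<=` B -> L2closure mu A `<=` L2closure mu B.
Proof.
move=> AB f [Lf Af]; split => // e /Af[g Ag fg]; exists g => //; exact: AB.
Qed.

(** Approximations within e / 4 compensate for the factor 2 of [sqL2D_le]. *)
Lemma closed_subspace_closure A : A `<=` L2 mu -> linear_set A ->
  closed_subspace mu (L2closure mu A).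
Proof.
move=> AL [A0 AD]; split.
- by move=> f [].
- exact: sub_L2closure.
- move=> a f g /L2closureP[Lf Af] /L2closureP[Lg Ag]; apply/L2closureP.
  split; first exact: L2_lin.
  move=> e e0; pose b := e / 4 / (sqmod a + 1).
  have a1 : 0 < sqmod a + 1 by rewrite ltr_wpDl// sqmod_ge0.
  have b0 : 0 < b by rewrite !divr_gt0.
  have e4 : 0 < e / 4 by rewrite divr_gt0.
  have [f' Af' ff'] := Af _ b0; have [g' Ag' gg'] := Ag _ e4.
  exists (fun x => a * f' x + g' x); first exact: AD.
  rewrite /sqdist (_ : (fun x => _) =
    (fun x => a * (f x - f' x) + (g x - g' x))); last first.
    by apply/funext => x; rewrite mulrBr opprD addrACA.
  have mf : cmeas (fun x => f x - f' x).
    by have /L2P[] := L2B Lf (AL _ Af').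
  have mg : cmeas (fun x => g x - g' x).
    by have /L2P[] := L2B Lg (AL _ Ag').
  apply: le_lt_trans (sqL2D_le (cmeasZ a mf) mg) _; rewrite sqL2Z//.
  move: ff' gg'; rewrite /sqdist; have := sqL2_ge0 (fun x => f x - f' x).
  have := sqL2_ge0 (fun x => g x - g' x).
  case: (sqL2 _) => [r| |]//; case: (sqL2 _) => [s| |]//.
  rewrite !lee_fin !lte_fin => r0 s0 sb rb.
  have : sqmod a * s <= e / 4.
    rewrite (le_trans (ler_wpM2l (sqmod_ge0 a) (ltW sb)))// /b mulrC.
    rewrite mulrAC ler_pdivrMr// ler_pM2l ?divr_gt0// lerDl ler01//.
  by move: rb; lra.
- move=> f /L2closureP[Lf Af]; apply/L2closureP; split => // e e0.
  have e4 : 0 < e / 4 by rewrite divr_gt0.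
  have [g /L2closureP[Lg Ag] fg] := Af _ e4; have [h Ah gh] := Ag _ e4.
  exists h => //; rewrite /sqdist (_ : (fun x => _) =
    (fun x => (f x - g x) + (g x - h x))); last first.
    by apply/funext => x; rewrite addrA subrK.
  have mf : cmeas (fun x => f x - g x) by have /L2P[] := L2B Lf Lg.
  have mg : cmeas (fun x => g x - h x) by have /L2P[] := L2B Lg (AL _ Ah).
  apply: le_lt_trans (sqL2D_le mf mg) _.
  move: fg gh; rewrite /sqdist; have := sqL2_ge0 (fun x => f x - g x).
  have := sqL2_ge0 (fun x => g x - h x).
  case: (sqL2 _) => [r| |]//; case: (sqL2 _) => [s| |]//.
  rewrite !lte_fin; lra.
Qed.

End L2_theory.

(** * Total families in L2 *)

Section total.
Context {d : measure_display} {T : measurableType d} {R : realType}.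
Variable mu : {measure set T -> \bar R}.
Implicit Types (f g : T -> R[i]).

Import HBNNSimple.

Variable V : set (T -> R[i]).
Hypothesis closedV : closed_subspace mu V.

Lemma closed_subspace_linear : linear_set V.
Proof. by have [_ V0 Vl _] := closedV. Qed.

Lemma closed_subspaceZ (a : R[i]) f : V f -> V (fun x => a * f x).
Proof.
have [V0 Vl] := closed_subspace_linear => Vf.
rewrite (_ : (fun _ => _) = (fun x => a * f x + 0)); first exact: Vl Vf V0.
by apply/funext => x; rewrite addr0.
Qed.

Lemma closed_subspaceD f g : V f -> V g -> V (fun x => f x + g x).
Proof.
have [V0 Vl] := closed_subspace_linear => Vf Vg.
rewrite (_ : (fun _ => _) = (fun x => 1 * f x + g x)); first exact: Vl.
by apply/funext => x; rewrite mul1r.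
Qed.

Lemma closed_subspaceB f g : V f -> V g -> V (fun x => f x - g x).
Proof.
move=> Vf Vg; rewrite (_ : (fun _ => _) = (fun x => f x + (-1) * g x)).
  exact/closed_subspaceD/closed_subspaceZ.
by apply/funext => x; rewrite mulN1r.
Qed.

Lemma closed_subspace_lim f (u : nat -> T -> R[i]) : L2 mu f ->
  (forall n, V (u n)) -> (sqdist mu f (u n) @[n --> \oo] --> 0%E) -> V f.
Proof.
move=> Lf Vu uf; have [_ _ _ Vc] := closedV; apply: Vc; apply/L2closureP.
split => // e e0.
have : nbhs (0%E : \bar R) [set y : \bar R | (y < e%:E)%E].
  exists e => //= y /=; rewrite sub0r normrN => ye.
  by rewrite lte_fin (le_lt_trans (ler_norm y)).
move=> /uf[n _ /(_ n (leqnn _)) un]; by exists (u n).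
Qed.

Lemma indB (A B : set T) x : B `<=` A ->
  cind A x - cind B x = cind (A `\` B) x :> R[i].
Proof.
move=> BA; rewrite /cind -rmorphB/=; congr (_%:C)%C.
by rewrite setDE indicI indicC /= !indicE;
  case: (boolP (x \in B)) => xB; case: (boolP (x \in A)) => xA /=;
  rewrite ?subrr ?mulr0 ?subr0 ?mulr1//;
  rewrite inE in xB; move: xA; rewrite notin_setE => /(_ (BA _ xB)).
Qed.

Lemma ind_setU (A B : set T) x : A `&` B = set0 ->
  cind (A `|` B) x = cind A x + cind B x :> R[i].
Proof.
move=> AB; rewrite /cind -rmorphD/=; congr (_%:C)%C.
rewrite !indicE in_setU.
case: (boolP (x \in A)) => xA; case: (boolP (x \in B)) => xB /=;
  rewrite ?addr0 ?add0r//.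
by rewrite !inE in xA xB; have : (A `&` B) x by []; rewrite AB.
Qed.

(** The squared distance between the indicators of the union and of F n is the
measure of their difference, which tends to 0 as the union has finite measure. *)
Lemma closed_subspace_bigcup (F : nat -> set T) : (forall n, measurable (F n)) ->
  nondecreasing_seq F -> (mu (\bigcup_n F n) < +oo)%E ->
  (forall n, V (cind (F n))) -> V (cind (\bigcup_n F n)).
Proof.
move=> mF ndF Foo VF; set B := \bigcup_n F n.
have mB : measurable B by exact: bigcupT_measurable.
have FB n : F n `<=` B by exact: bigcup_sup.
apply: (@closed_subspace_lim _ (fun n => cind (F n))) => //.
  by apply/L2P; split; [exact: cmeas_ind|rewrite sqL2_ind].
have dE n : sqdist mu (cind B) (cind (F n)) = (mu B - mu (F n))%E.
  rewrite -[X in (_ - mu X)%E](_ : B `&` F n = F n); last exact/setIidPr.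
  rewrite -measureD//; transitivity (sqL2 mu (cind (B `\` F n))); last first.
    by apply: sqL2_ind; exact: measurableD.
  by apply: eq_sqL2 => x; rewrite indB.
under eq_fun do rewrite dE.
have Bfin : mu B \is a fin_num by rewrite ge0_fin_numE.
rewrite -(subee Bfin); apply: cvgeB => //; first by rewrite fin_num_adde_defr.
  exact: cvg_cst.
exact: nondecreasing_cvg_mu.
Qed.

Section generating.
Variables (G : set (set T)) (D : nat -> set T).
Hypotheses (GE : @measurable _ T = <<s G >>) (GI : setI_closed G).
Hypotheses (GD : forall n, G (D n)) (ndD : nondecreasing_seq D).
Hypotheses (Dcover : \bigcup_n D n = setT) (Doo : forall n, (mu (D n) < +oo)%E).
Hypothesis VG : forall A, G A -> V (cind A).

Let mG A : G A -> measurable A.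
Proof. by move=> GA; rewrite GE; exact: sub_sigma_algebra. Qed.

(** Dynkin's pi-lambda theorem: as D n has finite measure, the sets E for which
the indicator of their intersection with D n is in V are stable under complements
and disjoint countable unions. *)
Lemma total_indicator n E : measurable E -> V (cind (E `&` D n)).
Proof.
rewrite GE; move: E; apply: dynkin_induction => //.
- by rewrite setTI; exact: VG.
- by move=> A GA; apply/VG/GI.
- move=> A mA VA; rewrite setIC -setDE.
  rewrite (_ : cind _ = fun x => cind (D n) x - cind (A `&` D n) x).
    by apply: closed_subspaceB => //; exact: VG.
  apply/funext => x; rewrite indB; last exact: subIsetr.
  by congr (cind _ x); rewrite setDIr setDv setU0.
- move=> F mF tF VF; rewrite setI_bigcupl -bigcup_bigsetU_bigcup.
  have mFD k : measurable (F k `&` D n) by apply: measurableI => //; exact: mG.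
  apply: closed_subspace_bigcup.
  + by move=> k; exact: bigsetU_measurable.
  + move=> i j ij; apply/subsetPset; exact: (@subset_bigsetU _ (fun k => F k `&` D n)).
  + apply: le_lt_trans (Doo n); apply: le_measure; rewrite ?inE.
    * by apply: bigcupT_measurable => k; exact: bigsetU_measurable.
    * exact/mG.
    * by rewrite (bigcup_bigsetU_bigcup (fun k => F k `&` D n)) -setI_bigcupl; exact: subIsetr.
  + elim=> [|k IHk]; first by rewrite big_ord_recr big_ord0/= set0U.
    rewrite big_ord_recr/=.
    rewrite (_ : cind _ = fun x =>
      cind (\big[setU/set0]_(i < k.+1) (F i `&` D n)) x +
      cind (F k.+1 `&` D n) x).
      exact: closed_subspaceD.
    apply/funext => x; apply: ind_setU.
    apply: (@trivIset_bigsetUI _ predT (fun k => F k `&` D n)) => //.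
    by apply: trivIset_setIr => i j _ _; exact: tF.
Qed.


Lemma total_simple n (h : {nnsfun T >-> R}) :
  V (fun x => (h x * \1_(D n) x)%:C%C).
Proof.
rewrite (_ : (fun _ => _) = (fun x => \sum_(y <- finmap.enum_fset (fset_set (range h)))
     y%:C%C * cind (h @^-1` [set y] `&` D n) x)).
  apply: linear_set_sum; first exact: closed_subspace_linear.
  by move=> i; exact: total_indicator.
apply/funext => x; rewrite fimfunE fsbig_finite//= mulr_suml rmorph_sum; apply: eq_bigr => i _.
by rewrite /cind indicI /= -mulrA rmorphM.
Qed.

(** Simple functions increasing to h and cut off outside D n are dominated by h;
dominated convergence applies to the squared differences. *)
Lemma total_ge0 (h : T -> R) : measurable_fun setT h -> (forall x, 0 <= h x) ->
  (sqL2 mu (fun x => (h x)%:C%C) < +oo)%E -> V (fun x => (h x)%:C%C).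
Proof.
move=> mh h0 hoo; have mEh : measurable_fun setT (EFin \o h) by exact/measurable_EFinP.
pose s := nnsfun_approx measurableT mEh.
have mD n : measurable (D n) by exact/mG.
have sh n x : 0 <= s n x <= h x.
  rewrite fun_ge0/= -lee_fin /s nnsfun_approxE.
  apply: (@le_approx _ _ _ setT (EFin \o h)) => // y _ /=; rewrite lee_fin.
  exact: h0.
have s_cvg x : s n x @[n --> \oo] --> h x.
  have H := @cvg_nnsfun_approx _ _ _ setT measurableT (EFin \o h) mEh.
  apply: (@fine_cvg _ _ _ _ (EFin \o s^~ x)).
  by apply: H => // y _; rewrite lee_fin.
apply: (@closed_subspace_lim _ (fun n x => (s n x * \1_(D n) x)%:C%C)).
- by apply/L2P; split => //; exact: cmeas_real.
- by move=> n; exact: total_simple.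
rewrite /sqdist /sqL2.
have E n x : sqmod ((h x)%:C%C - (s n x * \1_(D n) x)%:C%C) = (h x - s n x * \1_(D n) x) ^+ 2.
  by rewrite -rmorphB sqmod_real.
under eq_fun do under eq_integral do rewrite E.
have [] := @dominated_convergence _ _ _ mu setT measurableT
  (fun n x => ((h x - s n x * \1_(D n) x) ^+ 2)%:E) (fun=> 0%E) (fun x => (h x ^+ 2)%:E).
- move=> n; apply/measurable_EFinP/measurable_funX/measurable_funB => //.
  by apply: measurable_funM => //; exact: measurable_indic.
- exact: measurable_cst.
- apply: aeW => x _.
  have [m _ Dm] : (\bigcup_n D n) x by rewrite Dcover.
  have : (h x - s n x) ^+ 2 @[n --> \oo] --> (0 : R).
    suff : (h x - s n x) ^+ 2 @[n --> \oo] --> (h x - h x) ^+ 2 by rewrite subrr expr0n.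
    have hs : h x - s n x @[n --> \oo] --> h x - h x by apply: cvgB => //; exact: cvg_cst.
    by rewrite expr2; under eq_fun do rewrite expr2; exact: cvgM.
  move=> H; apply/cvg_EFin; first exact: nearW.
  apply: cvg_trans H; apply: near_eq_cvg; near=> n => /=.
  have mn : (m <= n)%N by near: n; exact: nbhs_infty_ge.
  rewrite indicE mem_set ?mulr1//.
  by have /subsetPset := @ndD _ _ mn; apply.
- apply/integrableP; split; first exact/measurable_EFinP/measurable_funX.
  rewrite (eq_integral (fun x => (sqmod (h x)%:C%C)%:E))//.
  by move=> x _; rewrite sqmod_real gee0_abs// lee_fin sqr_ge0.
- apply: aeW => x n _ /=; rewrite lee_fin ger0_norm ?sqr_ge0//.
  have /andP[s0 sle] := sh n x.
  have : 0 <= s n x * \1_(D n) x <= h x.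
    by rewrite indicE; case: (_ \in _); rewrite ?mulr1 ?mulr0 ?lexx ?s0 ?h0.
  move=> /andP[? ?]; rewrite ler_sqr ?nnegrE ?subr_ge0//.
  by rewrite lerBlDr lerDl.
move=> _ _; rewrite integral0; exact.
Unshelve. all: by end_near. Qed.

(** The positive and negative parts of the real and imaginary parts of a function
of L2 are all nonnegative functions of L2. *)
Lemma closed_subspace_total : L2 mu `<=` V.
Proof.
have main (h : T -> R) : measurable_fun setT h ->
    (sqL2 mu (fun x => (h x)%:C%C) < +oo)%E -> V (fun x => (h x)%:C%C).
  move=> mh hoo.
  have mpos (k : T -> R) : measurable_fun setT k -> measurable_fun setT (fun x => Num.max (k x) 0).
    by move=> mk; apply: measurable_maxr => //; exact: measurable_cst.
  have half (k : T -> R) : measurable_fun setT k ->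
      (forall x, k x ^+ 2 = h x ^+ 2) -> V (fun x => (Num.max (k x) 0)%:C%C).
    move=> mk kh; apply: total_ge0; first exact: mpos.
      by move=> x; rewrite le_max lexx orbT.
    apply: le_lt_trans hoo; apply: le_sqL2 => x; rewrite !sqmod_real -kh.
    by rewrite /Num.max; case: ifP => // _; rewrite expr0n sqr_ge0.
  rewrite (_ : (fun x => _) = fun x => (Num.max (h x) 0)%:C%C - (Num.max (- h x) 0)%:C%C).
    apply: closed_subspaceB; apply: half => //; first exact: measurable_funN.
    by move=> x; rewrite sqrrN.
  apply/funext => x; rewrite -rmorphB; congr (_%:C)%C.
  by rewrite /Num.max oppr_lt0; case: (ltgtP (h x) 0) => h0;
    rewrite ?opprK ?add0r ?subr0 ?h0 ?addr0.
move=> f /L2P[[mr mi] foo].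
rewrite (_ : f = fun x => (complex.Re (f x))%:C%C + 'i%C * (complex.Im (f x))%:C%C); last first.
  by apply/funext => x; exact: complexE.
apply: closed_subspaceD; last apply: closed_subspaceZ; apply: main => //;
  apply: le_lt_trans foo; apply: le_sqL2 => x; rewrite sqmod_real.
- by rewrite /sqmod lerDl sqr_ge0.
- by rewrite /sqmod lerDr sqr_ge0.
Qed.

End generating.
End total.

(** * Integrable complex functions *)

Section abs1.
Context {R : realType}.
Implicit Types z w : R[i].

(** Equivalent to the modulus, and split into real and imaginary parts as the
integral is. *)
Definition abs1 z : R := `|complex.Re z| + `|complex.Im z|.

Lemma abs1_ge0 z : 0 <= abs1 z.
Proof. exact: addr_ge0. Qed.

Lemma abs1D z w : abs1 (z + w) <= abs1 z + abs1 w.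
Proof. by rewrite /abs1 cReD cImD addrACA lerD// ler_normD. Qed.

Lemma abs1N z : abs1 (- z) = abs1 z.
Proof. by case: z => a b; rewrite /abs1 /= !normrN. Qed.

Lemma abs1M z w : abs1 (z * w) <= abs1 z * abs1 w.
Proof.
rewrite /abs1 cReM cImM.
apply: le_trans (lerD (ler_normB _ _) (ler_normD _ _)) _; rewrite !normrM.
by rewrite le_eqVlt; apply/orP; left; apply/eqP; ring.
Qed.

Lemma abs1_sqmod z : abs1 z ^+ 2 <= 2 * sqmod z.
Proof.
rewrite -subr_ge0 /abs1 /sqmod -[complex.Re z ^+ 2]real_normK ?num_real//.
rewrite -[complex.Im z ^+ 2]real_normK ?num_real//.
rewrite (_ : _ - _ = (`|complex.Re z| - `|complex.Im z|) ^+ 2) ?sqr_ge0//.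
by ring.
Qed.

Lemma sqmod_abs1 z : sqmod z <= abs1 z ^+ 2.
Proof.
rewrite /abs1 /sqmod -[complex.Re z ^+ 2]real_normK ?num_real//.
rewrite -[complex.Im z ^+ 2]real_normK ?num_real// sqrrD -addrA lerD2l lerDr.
by rewrite mulrn_wge0// mulr_ge0.
Qed.

Lemma abs1J z : abs1 z^*%C = abs1 z.
Proof. by case: z => a b; rewrite /abs1 /= normrN. Qed.

End abs1.

Section L1_theory.
Context {d : measure_display} {T : measurableType d} {R : realType}.
Variable mu : {measure set T -> \bar R}.
Implicit Types (f g : T -> R[i]).

Lemma L1_cmeas f : L1 mu f -> cmeas f.
Proof.
by move=> [/integrableP[mr _] /integrableP[mi _]]; split; exact/measurable_EFinP.
Qed.

Lemma L1_dom f (h : T -> R) : cmeas f ->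
  mu.-integrable setT (EFin \o h) -> (forall x, abs1 (f x) <= h x) -> L1 mu f.
Proof.
move=> [mr mi] ih fh; split; apply: le_integrable ih => //.
- exact/measurable_EFinP.
- move=> x _ /=; rewrite lee_fin; apply: le_trans (ler_norm _).
  by apply: le_trans (fh x); rewrite lerDl.
- exact/measurable_EFinP.
- move=> x _ /=; rewrite lee_fin; apply: le_trans (ler_norm _).
  by apply: le_trans (fh x); rewrite lerDr.
Qed.

Lemma L1_abs1 f : L1 mu f -> mu.-integrable setT (EFin \o (abs1 \o f)).
Proof.
move=> [ir ii].
rewrite (_ : EFin \o _ = (fun x => `|(complex.Re (f x))%:E|%E) \+
  (fun x => `|(complex.Im (f x))%:E|%E))%E//.
by apply: integrableD => //; exact: integrable_abse.
Qed.

Lemma L1Z (a : R[i]) f : L1 mu f -> L1 mu (fun x => a * f x).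
Proof.
move=> Lf; apply: (@L1_dom _ (fun x => abs1 a * abs1 (f x))).
- exact/cmeasZ/L1_cmeas.
- under [EFin \o _]eq_fun do rewrite /= EFinM.
  by apply: integrableZl => //; exact: L1_abs1.
- by move=> x; exact: abs1M.
Qed.

Lemma L1D f g : L1 mu f -> L1 mu g -> L1 mu (fun x => f x + g x).
Proof.
move=> Lf Lg; apply: (@L1_dom _ (fun x => abs1 (f x) + abs1 (g x))).
- by apply: cmeasD; exact: L1_cmeas.
- under [EFin \o _]eq_fun do rewrite /= EFinD.
  by apply: integrableD => //; exact: L1_abs1.
- by move=> x; exact: abs1D.
Qed.

Lemma L1M f g : L1 mu f -> cmeas g -> (forall x, sqmod (g x) <= 1) ->
  L1 mu (fun x => f x * g x).
Proof.
move=> Lf mg g1; apply: (@L1_dom _ (fun x => 2 * abs1 (f x))).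
- by apply: cmeasM => //; exact: L1_cmeas.
- under [EFin \o _]eq_fun do rewrite /= EFinM.
  by apply: integrableZl => //; exact: L1_abs1.
- move=> x; apply: le_trans (abs1M _ _) _; rewrite mulrC ler_wpM2r ?abs1_ge0//.
  rewrite -ler_sqr ?nnegrE ?abs1_ge0// (le_trans (abs1_sqmod _))//.
  by move: (g1 x); lra.
Qed.

Lemma L1_sum (I : Type) (s : seq I) (h : I -> T -> R[i]) :
  (forall i, L1 mu (h i)) -> L1 mu (fun x => \sum_(i <- s) h i x).
Proof.
move=> Lh; elim: s => [|i s IHs].
  under eq_fun do rewrite big_nil.
  by split; exact: integrable0.
by under eq_fun do rewrite big_cons; exact: L1D.
Qed.

Lemma L1_ind (A : set T) : measurable A -> (mu A < +oo)%E -> L1 mu (cind A).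
Proof.
move=> mA Aoo; split; last exact: integrable0.
apply/integrableP; split; first exact/measurable_EFinP/measurable_indic.
rewrite (eq_integral (fun x => (\1_A x)%:E)) ?integral_indic ?setIT//.
by move=> x _; rewrite gee0_abs// lee_fin.
Qed.

Lemma cintegralD f g : L1 mu f -> L1 mu g ->
  cintegral mu (fun x => f x + g x) = cintegral mu f + cintegral mu g.
Proof.
move=> [fr fi] [gr gi]; rewrite /cintegral.
under eq_Rintegral do rewrite cReD.
under [X in (_ +i* X)%C]eq_Rintegral do rewrite cImD.
by rewrite !RintegralD.
Qed.

Lemma cintegralZ (a : R[i]) f : L1 mu f ->
  cintegral mu (fun x => a * f x) = a * cintegral mu f.
Proof.
move=> [fr fi]; rewrite /cintegral.
under eq_Rintegral do rewrite cReM.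
under [X in (_ +i* X)%C]eq_Rintegral do rewrite cImM.
have iZ (h : T -> R) (k : R) : mu.-integrable setT (fun x => (h x)%:E) ->
    mu.-integrable setT (EFin \o (fun x => k * h x)).
  by move=> ih; under [EFin \o _]eq_fun do rewrite /= EFinM; exact: integrableZl.
rewrite RintegralB ?RintegralD//; try exact: iZ.
by rewrite !RintegralZl//; case: a.
Qed.

Lemma cintegral_sum (I : Type) (s : seq I) (h : I -> T -> R[i]) :
  (forall i, L1 mu (h i)) ->
  cintegral mu (fun x => \sum_(i <- s) h i x) = \sum_(i <- s) cintegral mu (h i).
Proof.
move=> Lh; elim: s => [|i s IHs].
  under eq_fun do rewrite big_nil.
  by rewrite big_nil /cintegral !Rintegral_cst// !mul0r.
under eq_fun do rewrite big_cons.
by rewrite big_cons cintegralD ?IHs//; exact: L1_sum.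
Qed.

Lemma eq_cintegral f g : (forall x, f x = g x) -> cintegral mu f = cintegral mu g.
Proof. by move=> fg; congr (cintegral mu _); exact/funext. Qed.

Lemma cintegral_ind (A : set T) : measurable A ->
  cintegral mu (cind A) = (fine (mu A))%:C%C.
Proof.
move=> mA; rewrite /cintegral /= Rintegral_cst// mul0r.
by rewrite /Rintegral integral_indic// setIT.
Qed.

Lemma cintegralJ f : L1 mu f -> cintegral mu (fun x => (f x)^*%C) = (cintegral mu f)^*%C.
Proof.
move=> [fr fi]; rewrite /cintegral /=.
have -> : (fun x => complex.Re (f x)^*%C) = (fun x => complex.Re (f x)).
  by apply/funext => x; case: (f x).
have -> : (fun x => complex.Im (f x)^*%C) = (fun x => (-1) * complex.Im (f x)).
  by apply/funext => x; rewrite mulN1r; case: (f x).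
by rewrite RintegralZl// mulN1r.
Qed.

Lemma abs1_cintegral f : L1 mu f ->
  abs1 (cintegral mu f) <= \int[mu]_x abs1 (f x).
Proof.
move=> Lf; have [fr fi] := Lf; rewrite /abs1 /cintegral /= RintegralD//.
- by apply: lerD; exact: le_normr_Rintegral.
- exact: (integrable_abse fr).
- exact: (integrable_abse fi).
Qed.

End L1_theory.

(** * The inner product of L2 *)

Section inner.
Context {d : measure_display} {T : measurableType d} {R : realType}.
Variable mu : {measure set T -> \bar R}.
Implicit Types (f g : T -> R[i]).

Lemma integrable_sqmod f : L2 mu f -> mu.-integrable setT (EFin \o (fun x => sqmod (f x))).
Proof.
move=> /L2P[mf foo]; apply/integrableP; split.
  exact/measurable_EFinP/measurable_sqmod.
rewrite (eq_integral (fun x => (sqmod (f x))%:E))//.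
by move=> x _ /=; rewrite ger0_norm// sqmod_ge0.
Qed.

Lemma L2_fin f : L2 mu f -> sqL2 mu f \is a fin_num.
Proof. by move=> /L2P[_ ?]; rewrite ge0_fin_numE// sqL2_ge0. Qed.

Lemma L2_mul f g : L2 mu f -> L2 mu g -> L1 mu (fun x => f x * (g x)^*%C).
Proof.
move=> Lf Lg; apply: (@L1_dom _ _ _ _ _ (fun x => sqmod (f x) + sqmod (g x))).
- have /L2P[mf _] := Lf; have /L2P[mg _] := Lg.
  exact/cmeasM/cmeasJ.
- under [EFin \o _]eq_fun do rewrite /= EFinD.
  by apply: integrableD => //; exact: integrable_sqmod.
- move=> x; apply: le_trans (abs1M _ _) _; rewrite abs1J.
  have := abs1_sqmod (f x); have := abs1_sqmod (g x).
  by have := sqr_ge0 (abs1 (f x) - abs1 (g x)); rewrite sqrrB; lra.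
Qed.

Lemma L2inner_linl (a : R[i]) f g h : L2 mu f -> L2 mu g -> L2 mu h ->
  L2inner mu (fun x => a * f x + g x) h = a * L2inner mu f h + L2inner mu g h.
Proof.
move=> Lf Lg Lh; rewrite /L2inner -cintegralZ; last exact: L2_mul.
transitivity (cintegral mu (fun x => a * (f x * (h x)^*%C) + g x * (h x)^*%C)).
  by apply: eq_cintegral => x; rewrite mulrDl mulrA.
by apply: cintegralD; [exact/L1Z/L2_mul|exact: L2_mul].
Qed.

Lemma L2innerC f g : L2 mu f -> L2 mu g -> L2inner mu g f = (L2inner mu f g)^*%C.
Proof.
move=> Lf Lg; rewrite /L2inner -cintegralJ; last exact: L2_mul.
by apply: eq_cintegral => x; rewrite rmorphM/= conjcK mulrC.
Qed.

Lemma L2inner_self f : L2 mu f -> L2inner mu f f = (fine (sqL2 mu f))%:C%C.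
Proof.
move=> Lf; rewrite /L2inner (eq_cintegral _ (fun x => mulJ_sqmod (f x))).
by rewrite /cintegral /= Rintegral_cst// mul0r.
Qed.

Lemma L2inner_0 f : L2inner mu (fun=> 0) f = 0.
Proof.
rewrite /L2inner; under eq_fun do rewrite mul0r.
by rewrite /cintegral !Rintegral_cst// !mul0r.
Qed.

Lemma cauchy_schwarz f g : L2 mu f -> L2 mu g ->
  sqmod (L2inner mu f g) <= fine (sqL2 mu f) * fine (sqL2 mu g).
Proof.
move=> Lf Lg; set c := L2inner mu f g.
(* this is the squared norm of f - t c g *)
have key (t : R) : 0 <= fine (sqL2 mu f) - 2 * t * sqmod c + t ^+ 2 * sqmod c * fine (sqL2 mu g).
  pose a : R[i] := - t%:C%C * c.
  pose h x := a * g x + f x.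
  have Lh : L2 mu h by exact: L2_lin.
  have : 0 <= fine (sqL2 mu h) by rewrite fine_ge0// sqL2_ge0.
  have -> : fine (sqL2 mu h) = complex.Re (L2inner mu h h) by rewrite L2inner_self.
  rewrite {1}/h L2inner_linl// (L2innerC Lh Lg) (L2innerC Lh Lf) /h {h Lh}.
  rewrite !L2inner_linl// !L2inner_self// (L2innerC Lf Lg) -/c.
  move: (fine _) (fine _) => F G; rewrite /a; case: (c) => u v.
  rewrite /sqmod /= => H; apply: le_trans H _.
  by rewrite le_eqVlt; apply/orP; left; apply/eqP; ring.
have [g0|g0] := eqVneq (fine (sqL2 mu g)) 0.
  rewrite g0 mulr0; rewrite leNgt; apply/negP => c0.
  have := key ((fine (sqL2 mu f) + 1) / sqmod c); rewrite g0 mulr0 addr0.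
  rewrite mulrA mulfVK ?gt_eqF//.
  have : 0 <= fine (sqL2 mu f) by rewrite fine_ge0// sqL2_ge0.
  lra.
have gp : 0 < fine (sqL2 mu g) by rewrite lt_neqAle eq_sym g0 fine_ge0// sqL2_ge0.
have := key (fine (sqL2 mu g))^-1.
rewrite (_ : _ + _ = fine (sqL2 mu f) - sqmod c / fine (sqL2 mu g)).
  by rewrite subr_ge0 ler_pdivrMr.
by field.
Qed.

(** By the Cauchy-Schwarz inequality the inner product with f is continuous. *)
Lemma closed_subspace_orthogonal f : L2 mu f ->
  closed_subspace mu [set g | L2 mu g /\ L2inner mu g f = 0].
Proof.
move=> Lf; split.
- by move=> g [].
- by split; [exact: L2_0|exact: L2inner_0].
- move=> a g h [Lg gf] [Lh hf]; split; first exact: L2_lin.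
  by rewrite L2inner_linl// gf hf mulr0 addr0.
- move=> g /L2closureP[Lg gA]; split => //; apply: sqmod_eq0; apply/eqP.
  rewrite eq_le sqmod_ge0 andbT; apply/ler_addgt0Pr => e e0; rewrite add0r.
  have F0 : 0 <= fine (sqL2 mu f) by rewrite fine_ge0// sqL2_ge0.
  have e1 : 0 < e / (fine (sqL2 mu f) + 1) by rewrite divr_gt0// ltr_wpDl.
  have [h [Lh hf] gh] := gA _ e1.
  have -> : L2inner mu g f = L2inner mu (fun x => g x - h x) f.
    rewrite (_ : (fun x => g x - h x) = (fun x => (-1) * h x + g x)).
      by rewrite L2inner_linl// hf mulr0 add0r.
    by apply/funext => x; rewrite mulN1r addrC.
  have Lgh := L2B Lg Lh.
  apply: le_trans (cauchy_schwarz Lgh Lf) _.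
  have : fine (sqdist mu g h) <= e / (fine (sqL2 mu f) + 1).
    by rewrite -lee_fin fineK ?ltW// L2_fin.
  move=> /(ler_wpM2r F0)/le_trans; apply.
  by rewrite mulrAC ler_pdivrMr ?ltr_wpDl// ler_pM2l// lerDl.
Qed.

Lemma sqL2_eq0 f : cmeas f -> sqL2 mu f = 0%E <-> {ae mu, forall x, f x = 0}.
Proof.
move=> mf; have mn : measurable_fun setT (fun x => (sqmod (f x))%:E).
  exact/measurable_EFinP/measurable_sqmod.
have E : sqL2 mu f = (\int[mu]_x `|(sqmod (f x))%:E|)%E.
  by apply: eq_integral => x _; rewrite gee0_abs// lee_fin sqmod_ge0.
rewrite E; split=> [/(ae_eq_integral_abs mu measurableT mn)|f0].
  by apply: filterS => x /(_ I)[] /sqmod_eq0.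
apply/(ae_eq_integral_abs mu measurableT mn).
by apply: filterS f0 => x + _ => ->; rewrite sqmod0.
Qed.

End inner.

(** * Balls of the Vilenkin group *)

Section balls.
Context {p : nat}.
Implicit Types (x y g h : vilenkin p) (m n : int).

Lemma Gn0 n : Gn p n 0.
Proof. by move=> k _. Qed.

Lemma GnD n x y : Gn p n x -> Gn p n y -> Gn p n (x + y).
Proof. by move=> nx ny k kn; rewrite coordD nx// ny// addr0. Qed.

Lemma GnN n x : Gn p n x -> Gn p n (- x).
Proof. by move=> nx k kn; rewrite -sub0r coordB nx// subr0. Qed.

Lemma GnB n x y : Gn p n x -> Gn p n y -> Gn p n (x - y).
Proof. by move=> nx ny; exact/GnD/GnN. Qed.

Lemma Gn_le m n x : m <= n -> Gn p n x -> Gn p m x.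
Proof. by move=> mn nx k km; apply: nx; exact: lt_le_trans km mn. Qed.

(** The cosets of the subgroups G_n are the balls of the topology. *)
Definition cball n g : set (vilenkin p) := [set x | Gn p n (x - g)].

Lemma cball_eq n g h : Gn p n (g - h) -> cball n g = cball n h.
Proof.
move=> gh; apply/seteqP; rewrite /cball; split=> x /= xg.
- by rewrite -(subrKA g); exact: GnD.
- by rewrite -(subrKA h); apply: GnD => //; rewrite -opprB; exact: GnN.
Qed.

Lemma cball0 n : cball n 0 = Gn p n.
Proof. by apply/seteqP; split=> x; rewrite /cball/= subr0. Qed.

Lemma cball_shift n g : cball n g = [set g + x | x in Gn p n].
Proof.
apply/seteqP; split=> [x xg|_ [x xn <-]].
  by exists (x - g) => //; rewrite addrC subrK.
by rewrite /cball/= addrAC subrr add0r.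
Qed.

Lemma cball_le m n g : m <= n -> cball n g `<=` cball m g.
Proof. by move=> mn x; exact: Gn_le. Qed.

Definition coset_constant m (U : Type) (f : vilenkin p -> U) :=
  forall x y, Gn p m (x - y) -> f x = f y.

Lemma coset_constant_open m U (f : vilenkin p -> U) (B : set U) :
  coset_constant m f -> open (f @^-1` B).
Proof.
move=> mf; rewrite openE => x Bx; apply/vilenkin_nbhsP; exists m => y yx.
by rewrite /preimage/= (mf y x yx).
Qed.

Lemma coset_constant_measurable m d (U : measurableType d) (f : vilenkin p -> U) :
  coset_constant m f -> measurable_fun setT f.
Proof.
move=> mf _ B _; rewrite setTI; apply: sub_sigma_algebra.
exact: coset_constant_open mf.
Qed.

Lemma coset_constant_comp m U W (F : U -> W) (f : vilenkin p -> U) :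
  coset_constant m f -> coset_constant m (fun x => F (f x)).
Proof. by move=> mf x y xy; rewrite (mf x y xy). Qed.

Lemma coset_constant_cmeas (R : realType) m (f : vilenkin p -> R[i]) :
  coset_constant m f -> cmeas f.
Proof. by move=> mf; split; apply: (@coset_constant_measurable m); exact: coset_constant_comp. Qed.

Lemma coset_constant_cball m n g : m <= n -> coset_constant n (fun x => x \in cball m g).
Proof.
move=> mn x y xy; apply/idP/idP; rewrite !inE /cball/= => H.
- rewrite -(subrKA x); apply: GnD => //; rewrite -opprB; apply: GnN; exact: Gn_le xy.
- rewrite -(subrKA y); apply: GnD => //; exact: Gn_le xy.
Qed.

Lemma cball_measurable n g : measurable (cball n g).
Proof.
rewrite (_ : cball n g = (fun x => x \in cball n g) @^-1` [set true]).
  by apply: sub_sigma_algebra; apply: (@coset_constant_open n); exact: coset_constant_cball.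
by apply/seteqP; split=> x; [exact: mem_set|exact: set_mem].
Qed.

Lemma Gn_measurable n : measurable (Gn p n).
Proof. by rewrite -cball0; exact: cball_measurable. Qed.

Definition balls : set (set (vilenkin p)) :=
  [set A | A = set0 \/ exists n g, A = cball n g].

Lemma balls_measurable A : balls A -> measurable A.
Proof. by move=> [->|[n [g ->]]]; [exact: measurable0|exact: cball_measurable]. Qed.

Lemma balls_setI : setI_closed balls.
Proof.
have aux m n g h : m <= n -> balls (cball m g `&` cball n h).
  move=> mn; have [gh|gh] := pselect (Gn p m (h - g)).
    right; exists n, h; apply/setIidPr; rewrite -(cball_eq gh).
    exact: cball_le.
  left; rewrite -subset0 => x [xg xh]; apply: gh; rewrite -(subrKA x).
  apply: GnD => //; rewrite -opprB; apply: GnN; exact: Gn_le xh.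
move=> A B [->|[m [g ->]]] [->|[n [h ->]]]; rewrite ?set0I ?setI0; try by left.
have [mn|/ltW nm] := leP m n; first exact: aux.
by rewrite setIC; exact: aux.
Qed.

(** The elements with finitely many nonzero coordinates s, the first one at
position -a, form a countable dense set. *)
Fact finite_word_subproof (a : nat) (s : seq 'F_p) :
  (fun k : int => if - a%:Z <= k then nth 0 s (absz (k + a%:Z)) else 0)
    \in vilenkin_pred p.
Proof. by apply/vilenkin_predP; exists (- a%:Z) => k; rewrite ltNge => /negbTE ->. Qed.

Definition finite_word a s := Vilenkin (finite_word_subproof a s).

Lemma finite_word_dense n x : exists a s, Gn p n (x - finite_word a s).
Proof.
have /vilenkin_predP[N xN] := valP x.
exists (absz N), (mkseq (fun j : nat => x (j%:Z - (absz N)%:Z)) (absz n + absz N)%N) => k kn.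
rewrite coordB /=; case: ifP => Nk; last first.
  rewrite subr0; apply: xN; move/negbT: Nk; rewrite -ltNge => /lt_le_trans; apply.
  by rewrite lerNl; lia.
by rewrite nth_mkseq; [rewrite (_ : _ - _ = k) ?subrr//; lia|lia].
Qed.

(** The balls centered at finite words form a countable base of the topology, so
that every open set is a countable union of balls. *)
Lemma balls_generate : @measurable _ (vilenkin p) = <<s balls >>.
Proof.
apply/seteqP; split; last first.
  apply: smallest_sub; first exact: sigma_algebra_measurable.
  exact: balls_measurable.
apply: smallest_sub; first exact: smallest_sigma_algebra.
move=> U oU.
pose F k := if @unpickle (int * nat * seq 'F_p)%type k is Some (n, a, s) then
  if `[< cball n (finite_word a s) `<=` U >] then cball n (finite_word a s) else set0 else set0.
rewrite (_ : U = \bigcup_k F k); last first.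
  apply/seteqP; split=> [x Ux|x [k _]]; last first.
    rewrite /F; case: unpickle => [[[n a] s]|//].
    by case: asboolP => // + xF; apply.
  have /vilenkin_nbhsP[n nU] : nbhs x U by move: oU; rewrite openE; apply.
  have [a [s xs]] := finite_word_dense n x.
  exists (pickle (n, a, s)); [exact: I|]; rewrite /F pickleK; case: asboolP => [_//|]; case.
  by move=> y; rewrite -(cball_eq xs) => /nU.
apply: sigma_algebra_bigcup => k; rewrite /F.
case: unpickle => [[[n a] s]|]; last exact: sigma_algebra0.
case: asboolP => _; last exact: sigma_algebra0.
by apply: sub_sigma_algebra; right; exists n, (finite_word a s).
Qed.

Lemma bigcup_Gn : \bigcup_(n : nat) Gn p (- n%:Z) = setT.
Proof.
rewrite -subTset => x _; have /vilenkin_predP[N xN] := valP x.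
exists (absz N) => // k kN; apply: xN; lia.
Qed.

Lemma nondecreasing_Gn : nondecreasing_seq (fun n : nat => Gn p (- n%:Z)).
Proof. by move=> m n mn; apply/subsetPset => x; apply: Gn_le; lia. Qed.

Lemma cball_dilation m n g :
  dilation n @^-1` cball m g = cball (m + n) (dilation (- n) g).
Proof.
apply/seteqP; split=> x /= H k kmn.
- have := H (k - n); rewrite !coordB/= subrK; apply; lia.
- have := H (k + n); rewrite !coordB/= addrK; apply; lia.
Qed.

Lemma dilationB n x y : dilation n (x - y) = dilation n x - dilation n y.
Proof. exact: vilenkinP. Qed.

Lemma Gn_dilation n m x : Gn p m (dilation n x) <-> Gn p (m + n) x.
Proof.
split=> H k kmn.
- by have := H (k - n); rewrite /= subrK; apply; lia.
- by apply: H; lia.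
Qed.

Lemma measurable_dilation n : measurable_fun setT (@dilation p n).
Proof.
apply: (@measurability _ _ _ _ _ _ (@balls)); first exact: balls_generate.
move=> _ [A [->|[m [g ->]]] <-]; rewrite setTI ?preimage_set0//.
by rewrite cball_dilation; exact: cball_measurable.
Qed.

Lemma cball_subr m g h : (fun x => x - h) @^-1` cball m g = cball m (g + h).
Proof.
have E x : x - h - g = x - (g + h) by rewrite opprD addrA addrAC.
by rewrite /cball /preimage; apply/funext => x /=; rewrite E.
Qed.

Lemma measurable_subr h : measurable_fun setT (fun x => x - h).
Proof.
apply: (@measurability _ _ _ _ _ _ (@balls)); first exact: balls_generate.
move=> _ [A [->|[m [g ->]]] <-]; rewrite setTI ?preimage_set0//.
by rewrite cball_subr; exact: cball_measurable.
Qed.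

End balls.

(** * Haar measure, translations and dilations *)

Section haar.
Context {R : realType} {p : nat}.
Hypothesis p_pr : prime p.
Variable mu : {measure set (vilenkin p) -> \bar R}.
Hypothesis mu_haar : is_haar_vilenkin mu.
Implicit Types (f : vilenkin p -> R[i]).

Lemma pR_gt0 : 0 < p%:R :> R.
Proof. by rewrite ltr0n prime_gt0. Qed.

Lemma pR_neq0 : p%:R != 0 :> R.
Proof. by rewrite gt_eqF// pR_gt0. Qed.

Lemma mu_cball n g : mu (cball n g) = (p%:R ^ (- n))%:E.
Proof.
have [tr <-] := mu_haar; rewrite cball_shift tr//.
exact: Gn_measurable.
Qed.

Lemma mu_cball_fin n g : (mu (cball n g) < +oo)%E.
Proof. by rewrite mu_cball ltry. Qed.

Lemma mu_Gn_fin n : (mu (Gn p n) < +oo)%E.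
Proof. by rewrite -cball0 mu_cball_fin. Qed.

(** Both sides are measures in A, and they agree on the pi-system of balls. *)
Lemma mu_dilation n (A : set (vilenkin p)) : measurable A ->
  mu (dilation n @^-1` A) = ((p%:R ^ (- n))%:E * mu A)%E.
Proof.
have r0 : 0 <= p%:R ^ (- n) :> R by rewrite exprz_ge0// ltW// pR_gt0.
pose m1 := measure_function_pushforward__canonical__measure_function_Measure
  mu (@measurable_dilation p n).
pose m2 := [the measure _ _ of mscale (NngNum r0) mu].
have H B : measurable B -> m1 B = m2 B.
  apply: (@measure_unique _ _ _ balls (fun n : nat => Gn p (- n%:Z))).
  - exact: balls_generate.
  - exact: balls_setI.
  - by move=> k; right; exists (- k%:Z), 0; rewrite cball0.
  - exact: bigcup_Gn.
  - move=> C [->|[m [g ->]]]; first by rewrite !measure0.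
    rewrite /m1 /m2 /= /pushforward /mscale/= cball_dilation !mu_cball -EFinM.
    by rewrite -expfzDr ?pR_neq0// opprD addrC.
  - move=> k; rewrite /m1 /= /pushforward -cball0 cball_dilation.
    exact: mu_cball_fin.
exact: H.
Qed.

Lemma cmeas_comp (s : vilenkin p -> vilenkin p) f : measurable_fun setT s ->
  cmeas f -> cmeas (fun x => f (s x)).
Proof.
by move=> ms [f1 f2]; split;
  [exact: (measurableT_comp f1)|exact: (measurableT_comp f2)].
Qed.

Lemma sqL2_dilation n f : cmeas f ->
  sqL2 mu (fun x => f (dilation n x)) = ((p%:R ^ (- n))%:E * sqL2 mu f)%E.
Proof.
move=> mf; have r0 : 0 <= p%:R ^ (- n) :> R by rewrite exprz_ge0// ltW// pR_gt0.
have mn : measurable_fun setT (fun x => (sqmod (f x))%:E).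
  exact/measurable_EFinP/measurable_sqmod.
rewrite /sqL2 -[LHS](@ge0_integral_pushforward _ _ _ _ _ _
  (@measurable_dilation p n) mu setT (fun x => (sqmod (f x))%:E))//; last first.
  by move=> x _; rewrite lee_fin sqmod_ge0.
rewrite -(@ge0_integral_mscale _ _ _ mu setT measurableT (NngNum r0) _)//; last first.
  by move=> x _; rewrite lee_fin sqmod_ge0.
apply: eq_measure_integral => [|ms A mA _]; first exact: measurable_dilation.
exact: mu_dilation.
Qed.

Lemma mu_subr (h : vilenkin p) (A : set (vilenkin p)) : measurable A ->
  mu ((fun x => x - h) @^-1` A) = mu A.
Proof.
move=> mA; have [tr _] := mu_haar; rewrite -(tr h A mA); congr (mu _).

apply/seteqP; split=> [x Ax|_ [x Ax <-]].
- by exists (x - h) => //; rewrite addrC subrK.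
- by rewrite /preimage/= addrAC subrr add0r.
Qed.

Lemma sqL2_translation h f : cmeas f ->
  sqL2 mu (fun x => f (x - h)) = sqL2 mu f.
Proof.
move=> mf; have mn : measurable_fun setT (fun x => (sqmod (f x))%:E).
  exact/measurable_EFinP/measurable_sqmod.
rewrite /sqL2 -[LHS](@ge0_integral_pushforward _ _ _ _ _ _
  (@measurable_subr p h) mu setT (fun x => (sqmod (f x))%:E))//; last first.
  by move=> x _; rewrite lee_fin sqmod_ge0.
apply: eq_measure_integral => [|ms A mA _]; first exact: measurable_subr.
  exact: mu_subr.
Qed.

Lemma integrable_translation h (f : vilenkin p -> R) :
  mu.-integrable setT (fun x => (f x)%:E) ->
  mu.-integrable setT (fun x => (f (x - h))%:E).
Proof.
move=> /integrableP[mf foo]; apply/integrableP; split.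
  by apply: measurableT_comp mf _; exact: measurable_subr.
rewrite -(@ge0_integral_pushforward _ _ _ _ _ _
  (@measurable_subr p h) mu setT (fun x => `|(f x)%:E|)%E)//; last first.
  exact: measurableT_comp.
apply: le_lt_trans foo; rewrite le_eqVlt; apply/orP; left; apply/eqP.
apply: eq_measure_integral => [|ms A mA _]; first exact: measurable_subr.
exact: mu_subr.
Qed.

Lemma cintegral_translation h f : L1 mu f ->
  cintegral mu (fun x => f (x - h)) = cintegral mu f.
Proof.
have main (k : vilenkin p -> R) : mu.-integrable setT (fun x => (k x)%:E) ->
    \int[mu]_x k (x - h) = \int[mu]_x k x.
  move=> ik; have /integrableP[mk _] := ik.
  rewrite /Rintegral -(@integral_pushforward _ _ _ _ _ _
    (@measurable_subr p h) mu setT (fun x => (k x)%:E))//; last first.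
    exact: integrable_translation.
  congr fine; apply: eq_measure_integral => [|ms A mA _]; first exact: measurable_subr.
  exact: mu_subr.
move=> [f1 f2]; rewrite /cintegral.
by rewrite (main (fun x => complex.Re (f x)))// (main (fun x => complex.Im (f x))).
Qed.

Lemma L2_dilation n f : L2 mu f -> L2 mu (fun x => f (dilation n x)).
Proof.
move=> /L2P[mf foo]; apply/L2P; split.
  by apply: cmeas_comp => //; exact: measurable_dilation.
by rewrite sqL2_dilation// lte_mul_pinfty ?lee_fin// exprz_ge0// ltW// pR_gt0.
Qed.

Lemma L2_translation h f : L2 mu f -> L2 mu (fun x => f (x - h)).
Proof.
move=> /L2P[mf foo]; apply/L2P; split; last by rewrite sqL2_translation.
by apply: cmeas_comp => //; exact: measurable_subr.
Qed.

Lemma L2_ind_cball n g : L2 mu (cind (cball n g)).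
Proof.
have mb := @cball_measurable p n g.
by apply/L2P; split; [exact: cmeas_ind|rewrite sqL2_ind// mu_cball_fin].
Qed.

Lemma balls_total V : closed_subspace mu V ->
  (forall n g, V (cind (cball n g))) -> L2 mu `<=` V.
Proof.
move=> cV Vb; apply: (@closed_subspace_total _ _ _ mu V cV balls (fun n : nat => Gn p (- n%:Z))).
- exact: balls_generate.
- exact: balls_setI.
- by move=> k; right; exists (- k%:Z), 0; rewrite cball0.
- exact: nondecreasing_Gn.
- exact: bigcup_Gn.
- by move=> k; exact: mu_Gn_fin.
- move=> A [->|[n [g ->]]]; last exact: Vb.
  have [V0 _] := closed_subspace_linear cV.
  by rewrite (_ : cind set0 = (fun=> 0))//; apply/funext => x; rewrite /cind indic0.
Qed.

(** Functions orthogonal to f form a closed subspace; containing the indicators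
of all balls, it contains f itself. *)
Lemma L2_orthogonal_balls f : L2 mu f ->
  (forall n g, L2inner mu (cind (cball n g)) f = 0) -> sqL2 mu f = 0%E.
Proof.
move=> Lf fb.
have [_] : [set g | L2 mu g /\ L2inner mu g f = 0] f.
  apply: (balls_total _ _ Lf); first exact: closed_subspace_orthogonal.
  by move=> n g; split; [exact: L2_ind_cball|exact: fb].
rewrite L2inner_self// => /complexI f0.
by rewrite -[LHS]fineK ?f0// L2_fin.
Qed.

End haar.

(** * Characters and their digits *)

Section additive_character.
Context {R : realType} {p : nat}.
Hypothesis p_pr : prime p.

(** The additive character t |-> exp (2 i pi t / p) of the field with p elements. *)
Definition expFp (t : 'F_p) : R[i] := expi (2 * pi * (t : nat)%:R / p%:R).

Lemma expFpD s t : expFp (s + t) = expFp s * expFp t.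
Proof.
rewrite -expiD -mulrDl -mulrDr -natrD -[RHS]expi_period ?prime_gt0//.
by congr (expi (_ * _%:R / _)); rewrite /= [X in (_ %% X)%N]Fp_cast.
Qed.

Lemma expFp0 : expFp 0 = 1.
Proof. by rewrite /expFp mulr0 mul0r /expi cos0 sin0. Qed.

Lemma norm_expFp t : `|expFp t| = 1.
Proof. exact: norm_expi. Qed.

Lemma sqmod_expFp t : sqmod (expFp t) = 1.
Proof. exact/sqmod_norm1/norm_expFp. Qed.

Lemma expFp_neq0 t : expFp t != 0.
Proof. by rewrite -normr_eq0 norm_expFp oner_neq0. Qed.

Lemma mul_expFpJ t : expFp t * (expFp t)^*%C = 1.
Proof. by rewrite mulJ_sqmod sqmod_expFp. Qed.

Lemma expFpN t : expFp (- t) = (expFp t)^*%C.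
Proof.
apply: (mulfI (expFp_neq0 t)); rewrite mul_expFpJ -expFpD subrr; exact: expFp0.
Qed.

Lemma expFpX t (n : nat) : expFp t ^+ n = expFp (t *+ n).
Proof. by elim: n => [|n IHn]; rewrite ?mulr0n ?expFp0// exprS mulrS expFpD IHn. Qed.

Lemma expFp_sum (I : Type) (s : seq I) (F : I -> 'F_p) :
  expFp (\sum_(i <- s) F i) = \prod_(i <- s) expFp (F i).
Proof. by elim: s => [|i s IHs]; rewrite ?big_nil ?expFp0// !big_cons expFpD IHs. Qed.

(** The cosine is strictly decreasing on [0, pi], and 2 pi / p lies in it. *)
Lemma expFp1_neq1 : expFp 1 != 1.
Proof.
have p1 := prime_gt1 p_pr; have p2 : 2 <= p%:R :> R by rewrite ler_nat.
rewrite /expFp; have -> : nat_of_ord (1 : 'F_p) = 1%N by [].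
rewrite mulr1; apply/eqP => /(congr1 (@complex.Re R))/= /eqP.
apply/negP; rewrite lt_eqF// -[X in _ < X]cos0 ltr_cos ?in_itv/= ?lexx ?pi_ge0//.
- by rewrite divr_gt0// ?mulr_gt0 ?pi_gt0// (lt_le_trans _ p2).
- rewrite divr_ge0 ?mulr_ge0 ?pi_ge0//= ler_pdivrMr ?(lt_le_trans _ p2)// mulrC.
  by rewrite ler_wpM2l// pi_ge0.
Qed.

Lemma expFp_eq1 t : expFp t = 1 -> t = 0.
Proof.
move=> t1; apply/eqP; apply: contraTT expFp1_neq1 => t0; rewrite negbK; apply/eqP.
have <- : t *+ (t^-1 : 'F_p) = 1 by rewrite -mulr_natr natr_Zp mulfV.
by rewrite -expFpX t1 expr1n.
Qed.

(** Replacing t by t + 1 multiplies the sum by expFp s. *)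
Lemma sum_expFp s : \sum_(t : 'F_p) expFp (t * s) = if s == 0 then p%:R else 0.
Proof.
have [->|s0] := eqVneq s 0.
  under eq_bigr do rewrite mulr0 expFp0.
  by rewrite sumr_const card_Fp.
pose S := \sum_(t : 'F_p) expFp (t * s).
have : S = expFp s * S.
  rewrite {1}/S (reindex (fun t => t + 1))/=; last first.
    by exists (fun t => t - 1) => t _; rewrite ?addrK ?subrK.
  by rewrite mulr_sumr; apply: eq_bigr => t _; rewrite mulrDl mul1r expFpD mulrC.
move/eqP; rewrite -subr_eq0 -{1}[S]mul1r -mulrBl mulf_eq0 => /orP[|/eqP//].
by rewrite subr_eq0 eq_sym => /eqP/expFp_eq1 s0'; rewrite s0' eqxx in s0.
Qed.

End additive_character.

Section characters.
Context {R : realType} {p : nat}.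
Hypothesis p_pr : prime p.
Local Notation X := (character R p).
Implicit Types (chi xi : X) (x y : vilenkin p) (L m n : int) (a b : int -> 'F_p).

Lemma charD chi x y : chi (x + y) = chi x * chi y.
Proof. by have [] := charP chi. Qed.

Lemma norm_char chi x : `|chi x| = 1.
Proof. by have [] := charP chi. Qed.

Lemma sqmod_char chi x : sqmod (chi x) = 1.
Proof. exact/sqmod_norm1/norm_char. Qed.

Lemma char_0 chi : chi 0 = 1.
Proof. by apply: (mulfI (char_neq0 chi 0)); rewrite -charD addr0 mulr1. Qed.

Lemma mul_charJ chi x : chi x * (chi x)^*%C = 1.
Proof. by rewrite mulJ_sqmod sqmod_char. Qed.

Lemma charN chi x : chi (- x) = (chi x)^*%C.
Proof. by apply: (mulfI (char_neq0 chi x)); rewrite mul_charJ -charD subrr char_0. Qed.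

Lemma charMn chi x (n : nat) : chi (x *+ n) = chi x ^+ n.
Proof. by elim: n => [|n IHn]; rewrite ?mulr0n ?char_0// mulrS charD IHn exprS. Qed.

Lemma char_mulE chi xi x : (chi * xi)%g x = chi x * xi x.
Proof. by []. Qed.

Lemma char_expE chi (n : nat) x : (chi ^+ n)%g x = chi x ^+ n.
Proof. by elim: n => [|n IHn]; rewrite ?expg0// expgS char_mulE IHn exprS. Qed.

Lemma char_invE chi x : (chi^-1)%g x = (chi x)^-1.
Proof. by []. Qed.

Lemma char_prodE (I : Type) (s : seq I) (F : I -> X) x :
  (\big[*%g/1%g]_(i <- s) F i)%g x = \prod_(i <- s) F i x.
Proof. by elim: s => [|i s IHs]; rewrite ?big_nil// !big_cons char_mulE IHs. Qed.

Lemma rademacherE n x : rademacher R p_pr n x = expFp (x n).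
Proof. by []. Qed.

Lemma Fp_nat (t : 'F_p) : (t : nat)%:R = t.
Proof. exact: natr_Zp. Qed.

Lemma rademacherXE n (t : 'F_p) x : (rademacher R p_pr n ^+ t)%g x = expFp (t * x n).
Proof.
by rewrite char_expE rademacherE (expFpX p_pr) -mulr_natl Fp_nat.
Qed.

Lemma vilenkin_mulp x : x *+ p = 0.
Proof.
apply: vilenkinP => k.
have E (n : nat) : (x *+ n) k = x k *+ n.
  by elim: n => [|n IHn]; rewrite ?mulr0n// !mulrS coordD IHn.
by rewrite E -mulr_natr pchar_Fp_0// mulr0.
Qed.

(** There are no small subgroups near 1: if chi is close to 1 on G_n, then the
powers of chi z, z in G_n, have positive real parts.  As z has order p, they are
p-th roots of unity and would add up to 0 if chi z were not 1. *)
Lemma char_coset_constant chi : exists n, coset_constant n chi.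
Proof.
have [cc _ _] := charP chi.
have /cvgrPdist_lt/(_ 1 ltr01) := cc 0; rewrite /= char_0.
move=> /vilenkin_nbhsP[n nchi]; exists n => x y xy.
suff : chi (x - y) = 1.
  rewrite charD charN => xy1.
  by rewrite -[RHS]mul1r -xy1 -mulrA [_^*%C * _]mulrC mul_charJ mulr1.
move: (x - y) xy => {x y} z zn.
apply/eqP; apply: contraT => z1.
have zk (k : nat) : 0 < complex.Re (chi z ^+ k).
  have : Gn p n (z *+ k - 0).
    by rewrite subr0; elim: k => [|k IHk]; [exact: Gn0|rewrite mulrS; exact: GnD].
  move=> /nchi; rewrite charMn; case: (chi z ^+ k) => u v.
  rewrite normc_def /= -[X in _ < X]/((1 : R)%:C%C) ltcR => uv.
  have : (1 - u) ^+ 2 < 1.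
    have H : 0 <= (1 - u) ^+ 2 + (0 - v) ^+ 2 by rewrite addr_ge0 ?sqr_ge0.
    have : Num.sqrt ((1 - u) ^+ 2 + (0 - v) ^+ 2) ^+ 2 < 1.
      by rewrite expr_lt1// sqrtr_ge0.
    by rewrite sqr_sqrtr//; apply: le_lt_trans; rewrite lerDl sqr_ge0.
  by move=> {}uv; nra.
have : (chi z - 1) * \sum_(k < p) chi z ^+ k = 0.
  by rewrite -subrX1 -charMn vilenkin_mulp char_0 subrr.
move/eqP; rewrite mulf_eq0 subr_eq0 (negbTE z1)/= => /eqP S0.
have : complex.Re (\sum_(k < p) chi z ^+ k) = \sum_(k < p) complex.Re (chi z ^+ k).
  by elim/big_ind2 : _ => // ? ? ? ? <- <-; rewrite cReD.
rewrite S0 /= => /esym/eqP; rewrite psumr_eq0; last by move=> k _; exact/ltW.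
move=> /allP/(_ (Ordinal (prime_gt0 p_pr))); rewrite mem_index_enum => /(_ isT).
by rewrite gt_eqF.
Qed.

Lemma cmeas_char chi : cmeas (chi : vilenkin p -> R[i]).
Proof. by have [n /coset_constant_cmeas] := char_coset_constant chi. Qed.

(** The product of the Rademacher characters r_k to the power a k, for k from L
to L + N - 1, is expFp of this sum. *)
Definition digit_dot L (N : nat) a x : 'F_p := \sum_(k < N) a (L + k%:Z) * x (L + k%:Z).

Lemma digit_dotD L N a x y : digit_dot L N a (x + y) = digit_dot L N a x + digit_dot L N a y.
Proof. by rewrite -big_split/=; apply: eq_bigr => k _; rewrite coordD mulrDr. Qed.

Lemma digit_dot_coset_constant L N a : coset_constant (L + N%:Z) (digit_dot L N a).
Proof.
move=> x y xy; apply: eq_bigr => k _; congr (_ * _); apply/eqP.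
by rewrite -subr_eq0 -coordB xy// ltrD2l ltz_nat.
Qed.

Lemma coset_constant_continuous m (f : vilenkin p -> R[i]) : coset_constant m f -> continuous f.
Proof.
move=> mf x; apply: (@cvg_near_cst _ _ _ _ _ (nbhs_filter x)).
by apply/vilenkin_nbhsP; exists m => y /mf.
Qed.

Fact digit_char_subproof L N a : is_character (fun x => expFp (digit_dot L N a x) : R[i]).
Proof.
split=> [|x|x y].
- apply: (@coset_constant_continuous (L + N%:Z)).
  exact: (coset_constant_comp _ (@digit_dot_coset_constant L N a)).
- exact: norm_expFp.
- by rewrite digit_dotD (expFpD p_pr).
Qed.

Definition digit_char L N a : X := Character (digit_char_subproof L N a).


End characters.
Arguments digit_char R {p} p_pr L N a.

(** * Fourier inversion on balls *)

Section fourier_inversion.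
Context {R : realType} {p : nat}.
Hypothesis p_pr : prime p.
Variable mu : {measure set (vilenkin p) -> \bar R}.
Hypothesis mu_haar : is_haar_vilenkin mu.
Local Notation X := (character R p).
Implicit Types (chi xi : X) (L m n : int) (b : int -> 'F_p) (f w : vilenkin p -> R[i]).

Lemma ind_id d (T : measurableType d) (A : set T) x : A x -> (cind A x : R[i]) = 1.
Proof. by move=> Ax; rewrite /cind indicE mem_set. Qed.

Lemma ind_out d (T : measurableType d) (A : set T) x : ~ A x -> (cind A x : R[i]) = 0.
Proof. by move=> Ax; rewrite /cind indicE memNset. Qed.

Lemma sqmod_ind_le1 d (T : measurableType d) (A : set T) x : sqmod (cind A x : R[i]) <= 1.
Proof. by rewrite /cind sqmod_real indicE; case: (_ \in _); rewrite /= ?expr1n ?expr0n. Qed.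

Lemma L1_ind_char n g chi : L1 mu (fun x => cind (cball n g) x * chi x).
Proof.
apply: L1M.
- apply: L1_ind; [exact: cball_measurable|exact: mu_cball_fin].
- exact: cmeas_char.
- by move=> x; rewrite sqmod_char.
Qed.

(** When chi h != 1 with h in G_n, translating by h shows that the integral equals
itself times a number other than 1. *)
Lemma cintegral_char n chi :
  cintegral mu (fun x => cind (Gn p n) x * chi x) =
  if `[< annihilator R p n chi >] then (p%:R ^ (- n))%:C%C else 0.
Proof.
case: asboolP => [chi1|/existsNP[h /not_implyP[hn h1]]].
  rewrite (@eq_cintegral _ _ _ _ _ (cind (Gn p n))).
    rewrite cintegral_ind; last exact: Gn_measurable.
    by rewrite -cball0 mu_cball.
  move=> x; have [xn|xn] := pselect (Gn p n x); last by rewrite ind_out// mul0r.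
  by rewrite chi1// mulr1.
set I := cintegral _ _.
have LI : L1 mu (fun x => cind (Gn p n) x * chi x).
  by rewrite -cball0; exact: L1_ind_char.
have E : I = chi (- h) * I.
  rewrite -cintegralZ// /I -(cintegral_translation mu_haar h LI).
  apply: eq_cintegral => x; rewrite charD.
  have [xn|xn] := pselect (Gn p n x).
    by rewrite !ind_id//; [ring|exact: GnB].
  by rewrite !ind_out ?mul0r ?mulr0// => xh; apply: xn; rewrite -(subrK h x); exact: GnD.
move/eqP : E; rewrite -subr_eq0 -{1}[I]mul1r -mulrBl mulf_eq0 => /orP[|/eqP//].
rewrite subr_eq0 charN => /eqP h2; exfalso; apply: h1.
by rewrite -[LHS]mulr1 h2 mul_charJ.
Qed.

(** The sum has at most one term; it places the word a at positions L, L + 1, ...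
and is 0 elsewhere. *)
Definition word_ext L (N : nat) (a : {ffun 'I_N -> 'F_p}) : int -> 'F_p :=
  fun j => \sum_(k < N | j == L + k%:Z) a k.

Lemma word_extE L N a (k : 'I_N) : word_ext L a (L + k%:Z) = a k.
Proof.
rewrite /word_ext (bigD1 k)//= big1 ?addr0// => i /andP[/eqP/addrI[] ik].
by move/eqP; case; exact: val_inj.
Qed.

Lemma digit_dot_word L N (a : {ffun 'I_N -> 'F_p}) x :
  digit_dot L N (word_ext L a) x = \sum_(k < N) a k * x (L + k%:Z).
Proof. by apply: eq_bigr => k _; rewrite word_extE. Qed.

(** The sum is a product over the N positions, each factor being [sum_expFp]. *)
Lemma sum_digit_char L N x : Gn p L x ->
  \sum_(a : {ffun 'I_N -> 'F_p}) expFp (digit_dot L N (word_ext L a) x) =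
  (p%:R ^+ N : R[i]) * cind (Gn p (L + N%:Z)) x.
Proof.
move=> xL.
transitivity (\prod_(k < N) \sum_(t : 'F_p) expFp (t * x (L + k%:Z)) : R[i]).
  rewrite bigA_distr_bigA; apply: eq_bigr => a _.
  by rewrite digit_dot_word (expFp_sum p_pr).
under eq_bigr do rewrite (sum_expFp p_pr).
have [xN|xN] := pselect (Gn p (L + N%:Z) x).
  rewrite ind_id// mulr1 (eq_bigr (fun=> p%:R)); first by rewrite prodr_const card_ord.
  by move=> k _; rewrite xN ?eqxx// ltrD2l ltz_nat.
rewrite ind_out// mulr0.
have /existsNP[j /not_implyP[jN /eqP xj]] := xN.
have Lj : L <= j by rewrite leNgt; apply: contra_notN (negP xj) => /xL/eqP.
have kN : (absz (j - L) < N)%N by lia.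
rewrite (bigD1 (Ordinal kN))//= (_ : L + _ = j) ?(negbTE xj) ?mul0r//; lia.
Qed.

Definition tail_mass L w : R := \int[mu]_x abs1 (w x * cind (~` Gn p L) x).

Lemma cmeas_indC L : cmeas (cind (~` Gn p L) : vilenkin p -> R[i]).
Proof. by apply: cmeas_ind; apply: measurableC; exact: Gn_measurable. Qed.

Lemma L1_tail L w : L1 mu w -> L1 mu (fun x => w x * cind (~` Gn p L) x).
Proof. by move=> Lw; apply: L1M => //; [exact: cmeas_indC|move=> x; exact: sqmod_ind_le1]. Qed.

Lemma L1_head L w : L1 mu w -> L1 mu (fun x => w x * cind (Gn p L) x).
Proof.
move=> Lw; apply: L1M => //; [|move=> x; exact: sqmod_ind_le1].
by apply: cmeas_ind; exact: Gn_measurable.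
Qed.

Lemma L1_mulchar chi w : L1 mu w -> L1 mu (fun x => w x * (chi x)^*%C).
Proof.
move=> Lw; apply: L1M => //; first exact/cmeasJ/cmeas_char.
by move=> x; rewrite sqmodJ sqmod_char.
Qed.

Lemma abs1_unit (z : R[i]) : sqmod z = 1 -> abs1 z <= 2.
Proof.
move=> z1; rewrite -ler_sqr ?nnegrE ?abs1_ge0//.
by have := abs1_sqmod z; rewrite z1; lra.
Qed.

(** The transform of the truncation depends only on the restriction of the
character to G_L; the part of w outside G_L contributes the error, where 2 bounds
abs1 on the unit circle. *)
Lemma fourier_trunc L w chi xi : L1 mu w -> (forall x, Gn p L x -> chi x = xi x) ->
  abs1 (fourier_L1 mu (fun x => w x * cind (Gn p L) x) chi) <=
  abs1 (fourier_L1 mu w xi) + 2 * tail_mass L w.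
Proof.
move=> Lw E.
have -> : fourier_L1 mu (fun x => w x * cind (Gn p L) x) chi =
    fourier_L1 mu w xi + (-1) * fourier_L1 mu (fun x => w x * cind (~` Gn p L) x) xi.
  rewrite /fourier_L1 -cintegralZ; last by apply: L1_mulchar; exact: L1_tail.
  etransitivity; last first.
    apply: cintegralD; first exact: L1_mulchar.
    by apply: L1Z; apply: L1_mulchar; exact: L1_tail.
  apply: eq_cintegral => x.
  have [xL|xL] := pselect (Gn p L x).
    rewrite ind_id// ind_out; last by [].
    by rewrite mulr0 mul0r mulr0 addr0 mulr1 E.
  by rewrite ind_out// ind_id// !mulr0 mul0r mulr1 mulN1r subrr.
apply: le_trans (abs1D _ _) _; rewrite lerD2l mulN1r abs1N.
apply: le_trans (abs1_cintegral _) _; first by apply: L1_mulchar; exact: L1_tail.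
rewrite /tail_mass -RintegralZl//; last by apply: L1_abs1; exact: L1_tail.
apply: le_Rintegral => //.
- by apply: L1_abs1; apply: L1_mulchar; exact: L1_tail.
- under [EFin \o _]eq_fun do rewrite /= EFinM.
  by apply: integrableZl => //; apply: L1_abs1; exact: L1_tail.
- move=> x _; apply: le_trans (abs1M _ _) _; rewrite mulrC ler_wpM2r ?abs1_ge0//.
  by rewrite abs1J abs1_unit// sqmod_char.
Qed.

Lemma L1_tail_small w (e : R) : L1 mu w -> 0 < e ->
  exists M : int, forall L, L <= M -> tail_mass L w < e.
Proof.
move=> Lw e0.
pose F (n : nat) x := (abs1 (w x * cind (~` Gn p (- n%:Z)) x))%:E.
have [] := @dominated_convergence _ _ _ mu setT measurableT F (fun=> 0%E)
  (fun x => (abs1 (w x))%:E).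
- by move=> n; have /integrableP[] := L1_abs1 (L1_tail (- n%:Z) Lw).
- exact: measurable_cst.
- apply: aeW => x _.
  have [m _ xm] : (\bigcup_(n : nat) Gn p (- n%:Z)) x by rewrite bigcup_Gn.
  apply: cvg_near_cst; near=> n; rewrite /F ind_out ?mulr0.
    by rewrite /abs1 /= normr0 addr0.
  have mn : (m <= n)%N by near: n; exact: nbhs_infty_ge.
  by apply; apply: Gn_le xm; lia.
- exact: L1_abs1.
- apply: aeW => x n _; rewrite /F /= lee_fin ger0_norm ?abs1_ge0//.
  have [xn|xn] := pselect (Gn p (- n%:Z) x); last by rewrite ind_id// mulr1.
  by rewrite ind_out ?mulr0; [rewrite /abs1 /= normr0 addr0 -/(abs1 _) abs1_ge0|].
move=> _ _; rewrite integral0 => H.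
have : nbhs (0%E : \bar R) [set y : \bar R | (y < e%:E)%E].
  exists e => //= y /=; rewrite sub0r normrN => ye.
  by rewrite lte_fin (le_lt_trans (ler_norm y)).
move=> /H[n _ /(_ n (leqnn _))/= Fn]; exists (- n%:Z) => L Ln.
apply: (@le_lt_trans _ _ (tail_mass (- n%:Z) w)).
  apply: le_Rintegral => //.
  - exact/L1_abs1/L1_tail.
  - exact/L1_abs1/L1_tail.
  - move=> x _; have [xL|xL] := pselect (Gn p L x).
      by rewrite ind_out ?mulr0; [rewrite {1}/abs1 /= normr0 addr0 abs1_ge0|].
    rewrite ind_id// ind_id// => xn; apply: xL; exact: Gn_le xn.
have Ffin := integrable_fin_num measurableT (L1_abs1 (L1_tail (- n%:Z) Lw)).
by rewrite -lte_fin /tail_mass /Rintegral fineK.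
Unshelve. all: by end_near. Qed.

(** On G_L the indicator of G_(L + N) is the average of the p^N characters with
digits between positions L and L + N. *)
Lemma fourier_inversion L (N : nat) w h : L1 mu w -> Gn p L h ->
  (p%:R ^+ N) * cintegral mu (fun x => w x * cind (cball (L + N%:Z) h) x) =
  \sum_(a : {ffun 'I_N -> 'F_p}) digit_char R p_pr L N (word_ext L a) h *
    fourier_L1 mu (fun x => w x * cind (Gn p L) x) (digit_char R p_pr L N (word_ext L a)).
Proof.
move=> Lw hL.
pose c (a : {ffun 'I_N -> 'F_p}) := digit_char R p_pr L N (word_ext L a).
have LH a : L1 mu (fun x => c a h * (w x * cind (Gn p L) x * (c a x)^*%C)).
  by apply: L1Z; apply: L1_mulchar; exact: L1_head.
rewrite -cintegralZ; last first.
  apply: L1M => //; last by move=> x; exact: sqmod_ind_le1.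
  by apply: cmeas_ind; exact: cball_measurable.
transitivity (\sum_a cintegral mu
  (fun x => c a h * (w x * cind (Gn p L) x * (c a x)^*%C))); last first.
  by apply: eq_bigr => a _; rewrite cintegralZ//; apply: L1_mulchar; exact: L1_head.
rewrite -cintegral_sum//; apply: eq_cintegral => x.
have [xL|xL] := pselect (Gn p L x); last first.
  rewrite [in LHS]ind_out ?mulr0 ?big1//.
    by move=> a _; rewrite ind_out// mulr0 mul0r mulr0.
  move=> xh; apply: xL; rewrite -(subrK h x); apply: GnD => //.
  by apply: Gn_le xh; lia.
rewrite (ind_id xL) -[cind (cball _ _) x](_ : cind (Gn p (L + N%:Z)) (h - x) = _); last first.
  rewrite /cind !indicE; congr ((_ : bool)%:R%:C)%C.
  by apply/idP/idP; rewrite !inE /cball/= -opprB => /GnN; rewrite opprK.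
rewrite mulrCA -sum_digit_char; last exact: GnB.
rewrite mulr_sumr; apply: eq_bigr => a _; rewrite mulr1.
rewrite -[expFp _]/(c a (h - x)) charD charN; ring.
Qed.

End fourier_inversion.

(** * Cosets of annihilators in the dual group *)

Section dual.
Context {R : realType} {p : nat}.
Hypothesis p_pr : prime p.
Local Notation X := (character R p).
Variable nu : {measure set X -> \bar R}.
Hypothesis nu_haar : is_haar_character nu.
Implicit Types (chi xi : X) (L m n : int).

Lemma eval_open (x : vilenkin p) (O : set R[i]) : open O ->
  open [set chi : X | O (chi x)].
Proof.
move=> oO; exists [set f : {compact-open, vilenkin p -> R[i]} | f @` [set x] `<=` O].
  by apply: compact_open_open; [exact: compact_set1|exact: oO].
by apply/seteqP; split=> chi /=; [apply; exists x|move=> H _ [_ -> <-]].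
Qed.

Definition char_coset L chi : set X := [set xi | forall x, Gn p L x -> xi x = chi x].

(** It is closed, being defined by one closed condition for each x in G_L. *)
Lemma char_coset_measurable L chi : measurable (char_coset L chi).
Proof.
rewrite -[char_coset _ _]setCK; apply: measurableC; apply: sub_sigma_algebra.
rewrite (_ : ~` _ = \bigcup_(x in Gn p L) [set xi : X | (~` [set chi x]) (xi x)]).
  apply: bigcup_open => x _; apply: eval_open; apply: closed_openC.
  exact/accessible_closed_set1/hausdorff_accessible/norm_hausdorff.
apply/seteqP; split=> xi /=.
  by move=> /existsNP[x /not_implyP[xL h]]; exists x.
by move=> [x xL h] H; apply: h; exact: H.
Qed.

Lemma nu_char_coset L chi : nu (char_coset L chi) = (p%:R ^ L)%:E.
Proof.
have -> : char_coset L chi = [set (chi * xi)%g | xi in annihilator R p L].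
  apply/seteqP; split=> [xi xiE|_ [xi xi1 <-]] /=.
    exists (chi^-1 * xi)%g; last first.
      by apply: characterP => x; rewrite !char_mulE char_invE mulrA mulfV ?mul1r ?char_neq0.
    by move=> x xL; rewrite char_mulE char_invE xiE// mulVf// char_neq0.
  by move=> x xL; rewrite char_mulE xi1// mulr1.
have [tr <-] := nu_haar; apply: tr.
exact: char_coset_measurable L (char1 R p).
Qed.

(** The step function with value c i on the coset of chi i lies below the squared
modulus of k, since the cosets are disjoint. *)
Lemma sqL2_coset_bound (I : finType) L (chi : I -> X) (c : I -> R) (k : X -> R[i]) :
  (forall i j, i != j -> exists2 x, Gn p L x & chi i x != chi j x) ->
  (forall i, 0 <= c i) ->
  (forall i xi, char_coset L (chi i) xi -> c i <= sqmod (k xi)) ->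
  ((p%:R ^ L * \sum_i c i)%:E <= sqL2 nu k)%E.
Proof.
move=> dis c0 ck.
have mC i := char_coset_measurable L (chi i).
have mI i : measurable_fun setT (fun xi => (c i * \1_(char_coset L (chi i)) xi)%:E).
  apply/measurable_EFinP/measurable_funM; first exact: measurable_cst.
  exact: measurable_indic.
have pos i xi : (0 <= (c i * \1_(char_coset L (chi i)) xi)%:E)%E.
  by rewrite lee_fin mulr_ge0.
rewrite mulr_sumr -sumEFin.
have -> : (\sum_i (p%:R ^ L * c i)%:E =
   \int[nu]_xi \sum_i (c i * \1_(char_coset L (chi i)) xi)%:E)%E.
  rewrite ge0_integral_sum//; apply: eq_bigr => i _.
  under eq_integral do rewrite EFinM.
  rewrite ge0_integralZl//; last 2 first.
  - by apply/measurable_EFinP; exact: measurable_indic.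
  - by rewrite lee_fin.
  by rewrite integral_indic// setIT nu_char_coset -EFinM mulrC.
apply: le_integral_pos => xi; first by apply: sume_ge0.
rewrite sumEFin lee_fin.
have [[i xiC]|none] := pselect (exists i, char_coset L (chi i) xi).
  rewrite (bigD1 i)//= indicE mem_set// mulr1 big1 ?addr0; first exact: ck.
  move=> j ji; rewrite indicE memNset ?mulr0// => xjC.
  have [x xL /negP] := dis _ _ ji; apply; apply/eqP.
  by rewrite -xjC// -xiC.
rewrite big1 ?sqmod_ge0// => i _; rewrite indicE memNset ?mulr0// => H.
by apply: none; exists i.
Qed.

Fact unit_vilenkin_subproof (j : int) (t : 'F_p) :
  (fun k : int => if k == j then t else 0) \in vilenkin_pred p.
Proof. by apply/vilenkin_predP; exists j => k kj; rewrite lt_eqF. Qed.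

Definition unit_vector j t : vilenkin p := Vilenkin (unit_vilenkin_subproof j t).

Lemma unit_vectorE j t k : unit_vector j t k = if k == j then t else 0.
Proof. by []. Qed.

Lemma Gn_unit_vector L j t : L <= j -> Gn p L (unit_vector j t).
Proof. by move=> Lj k kL; rewrite unit_vectorE lt_eqF//; exact: lt_le_trans kL Lj. Qed.

Lemma digit_char_word_neq L N (a b : {ffun 'I_N -> 'F_p}) : a != b ->
  exists2 x, Gn p L x &
    digit_char R p_pr L N (word_ext L a) x != digit_char R p_pr L N (word_ext L b) x.
Proof.
move=> ab; have [k akb] : exists k, a k != b k.
  apply/existsP; apply: contraNT ab; rewrite negb_exists => /forallP H.
  by apply/eqP/ffunP => k; apply/eqP; move: (H k); rewrite negbK.
exists (unit_vector (L + k%:Z) 1); first by apply: Gn_unit_vector; rewrite lerDl.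
have E (c : {ffun 'I_N -> 'F_p}) :
    digit_dot L N (word_ext L c) (unit_vector (L + k%:Z) 1) = c k.
  rewrite digit_dot_word (bigD1 k)//= eqxx mulr1 big1 ?addr0// => i ik.
  rewrite (_ : _ == _ = false) ?mulr0//; apply/eqP => /addrI[] /val_inj ki.
  by rewrite ki eqxx in ik.
rewrite /= !E; apply: contra akb => /eqP H; rewrite -subr_eq0; apply/eqP.
by apply: (@expFp_eq1 R p p_pr); rewrite (expFpD p_pr) (expFpN p_pr) H mul_expFpJ.
Qed.

End dual.

(** * Injectivity of the Fourier transform on L2 *)

Section uniqueness.
Context {R : realType} {p : nat}.
Hypothesis p_pr : prime p.
Variable mu : {measure set (vilenkin p) -> \bar R}.
Hypothesis mu_haar : is_haar_vilenkin mu.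
Local Notation X := (character R p).
Variable nu : {measure set X -> \bar R}.
Hypothesis nu_haar : is_haar_character nu.
Implicit Types (chi xi : X) (L m n : int) (f w : vilenkin p -> R[i]) (k : X -> R[i]).

(** The bound L <= -1 makes the digits from position -1 on part of the data: these
are the characters at which a mask generated by a tree is determined. *)
Definition finite_digits : set X := [set xi | exists L N (b : int -> 'F_p),
  L <= -1 /\ forall x, Gn p L x -> xi x = expFp (digit_dot L N b x)].

Lemma abs1_nat (n : nat) (z : R[i]) : abs1 (n%:R * z) = n%:R * abs1 z.
Proof.
rewrite (_ : n%:R = (n%:R : R)%:C%C); last by rewrite rmorph_nat.
by rewrite /abs1 !(cReM, cImM)/= !mul0r subr0 addr0 !normrM (ger0_norm (ler0n R n)) mulrDr.
Qed.

(** By inversion, the integral over the ball is at most twice the mean over words a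
of the size t a of the transform of the truncation at the character of a.  On the
coset of that character the transform k of w differs from that value by at most
the error 2 e of [fourier_trunc]; so the mean of the squares of t a - 2 e is
bounded, up to a constant, by the integral of the squared modulus of k. *)
Lemma truncated_ball_bound w k L (N : nat) h (d : R) : L1 mu w -> L <= -1 -> Gn p L h ->
  (forall xi, finite_digits xi -> k xi = fourier_L1 mu w xi) ->
  let A := abs1 (cintegral mu (fun x => w x * cind (cball (L + N%:Z) h) x)) in
  0 <= d -> d <= A / 2 - 2 * tail_mass mu L w ->
  ((p%:R ^ (L + N%:Z) * d ^+ 2 / 2)%:E <= sqL2 nu k)%E.
Proof.
move=> Lw L0 hL kF A d0 dA.
pose c (a : {ffun 'I_N -> 'F_p}) := digit_char R p_pr L N (word_ext L a).
pose t a := abs1 (fourier_L1 mu (fun x => w x * cind (Gn p L) x) (c a)).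
pose e := tail_mass mu L w.
pose s a := Num.max (t a - 2 * e) 0.
have AE : p%:R ^+ N * A <= \sum_a 2 * t a.
  rewrite -natrX /A -abs1_nat natrX fourier_inversion//.
  have abs1_sum (F : {ffun 'I_N -> 'F_p} -> R[i]) : abs1 (\sum_a F a) <= \sum_a abs1 (F a).
    elim/big_ind2 : _ => //; first by rewrite /abs1 /= normr0 addr0.
    by move=> x1 y1 x2 y2 h1 h2; apply: le_trans (abs1D _ _) _; exact: lerD.
  apply: le_trans (abs1_sum _) _; apply: ler_sum => a _.
  apply: le_trans (abs1M _ _) _; rewrite ler_wpM2r ?abs1_ge0// abs1_unit//.
  exact: sqmod_char.
have B := @sqL2_coset_bound _ _ nu nu_haar _ L c (fun a => s a ^+ 2 / 2) k.
apply: le_trans (B _ _ _); last 3 first.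
- by move=> a b ab; exact: digit_char_word_neq.
- by move=> a; rewrite divr_ge0// sqr_ge0.
- move=> a xi xia; rewrite ler_pdivrMr// mulrC.
  apply: le_trans (abs1_sqmod _).
  rewrite ler_sqr ?nnegrE ?abs1_ge0 ?le_max ?lexx ?orbT//.
  rewrite ge_max abs1_ge0 andbT lerBlDr kF.
    by apply: fourier_trunc => // x xL; rewrite -xia.
  by exists L, N, (word_ext L a); split => // x xL; rewrite xia.
rewrite lee_fin expfzDr ?pR_neq0// -mulrA -mulrA ler_wpM2l ?exprz_ge0 ?ler0n//.
rewrite -mulr_suml mulrA ler_pM2r ?invr_gt0//.
(* (s a - d)^2 >= 0 bounds the mean of the squares by the mean *)
have sd a : 2 * d * (t a - 2 * e) - d ^+ 2 <= s a ^+ 2.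
  have st : t a - 2 * e <= s a by rewrite le_max lexx.
  have := sqr_ge0 (s a - d); rewrite sqrrB => H.
  have : 2 * d * (t a - 2 * e) <= 2 * d * s a by rewrite ler_wpM2l// mulr_ge0.
  lra.
apply: le_trans (ler_sum _ (fun a _ => sd a)).
rewrite sumrB -mulr_sumr sumrB !sumr_const card_ffun card_Fp// card_ord.
rewrite -mulr_sumr in AE.
rewrite -(mulr_natr (2 * e)) -(mulr_natr (d ^+ 2)) natrX -exprnP.
have P0 : 0 <= p%:R ^+ N :> R by rewrite exprn_ge0.
move: (\sum_i t i) (p%:R ^+ N) P0 AE dA => S P P0 AE dA.
have H1 : P * (A / 2 - 2 * e) <= S - 2 * e * P by lra.
have H2 : P * d <= P * (A / 2 - 2 * e) by rewrite ler_wpM2l.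
have H3 : 2 * d * (P * d) <= 2 * d * (S - 2 * e * P).
  by rewrite ler_wpM2l ?mulr_ge0//; lra.
rewrite expr2 in H3 *; lra.
Qed.

(** The mass of w outside G_L tends to 0 as L tends to -oo. *)
Lemma ball_integral_bound w k m h (K : R) : L1 mu w ->
  (forall xi, finite_digits xi -> k xi = fourier_L1 mu w xi) ->
  (sqL2 nu k <= K%:E)%E ->
  abs1 (cintegral mu (fun x => w x * cind (cball m h) x)) / 2 <=
    Num.sqrt (2 * K / p%:R ^ m).
Proof.
move=> Lw kF kK; set A := abs1 _; apply/ler_addgt0Pr => e e0.
have e2 : 0 < e / 2 by rewrite divr_gt0.
have [M FM] := L1_tail_small p_pr Lw e2.
have /vilenkin_predP[M' hM'] := valP h.
pose L := Num.min M (Num.min M' (Num.min m (-1))).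
have Lm : L <= m by rewrite /L !ge_min lexx !orbT.
have L0 : L <= -1 by rewrite /L !ge_min lexx !orbT.
have hL : Gn p L h.
  move=> j jL; apply: hM'; apply: lt_le_trans jL _.
  by rewrite /L !ge_min lexx orbT.
have Fe : tail_mass mu L w < e / 2 by apply: FM; rewrite /L ge_min lexx.
pose N := absz (m - L).
have LN : L + N%:Z = m by rewrite /N; lia.
have [d0|/ltW d0] := leP 0 (A / 2 - 2 * tail_mass mu L w); last first.
  by apply: (@le_trans _ _ e); [lra|rewrite lerDr sqrtr_ge0].
have := @truncated_ball_bound w k L N h _ Lw L0 hL kF d0; rewrite LN -/A => /(_ (lexx _)) H.
have {}H := le_trans H kK; rewrite lee_fin in H.
have pm : 0 < p%:R ^ m :> R by rewrite exprz_gt0// pR_gt0.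
suff : A / 2 - 2 * tail_mass mu L w <= Num.sqrt (2 * K / p%:R ^ m) by lra.
rewrite -[leLHS]ger0_norm// -sqrtr_sqr ler_sqrt; last first.
  rewrite divr_ge0 ?(ltW pm)// mulr_ge0//.
  apply: le_trans H; rewrite divr_ge0// mulr_ge0 ?sqr_ge0// ltW//.
by rewrite ler_pdivlMr//; lra.
Qed.

(** The approximations u n of f, minus psi, have transforms that tend to 0 in L2
on the relevant characters; hence their integrals over any fixed ball tend to 0,
and f - psi is orthogonal to the indicators of balls. *)
Theorem fourier_unique (f psi : vilenkin p -> R[i]) (g : X -> R[i]) :
  is_fourier mu nu f g -> (L1 mu `&` L2 mu) psi ->
  (forall xi, finite_digits xi -> g xi = fourier_L1 mu psi xi) ->
  sqdist mu f psi = 0%E.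
Proof.
move=> [Lf Lg [u [Lu uf Fug]]] [psi1 psi2] gF.
have Lfp : L2 mu (fun x => f x - psi x) by exact: L2B.
apply: L2_orthogonal_balls Lfp _ => // m h.
have Lb : L2 mu (cind (cball m h)) by exact: L2_ind_cball.
have Lfp : L2 mu (fun x => f x - psi x) by exact: L2B.
rewrite L2innerC// (_ : L2inner _ _ _ = 0) ?conjc0//.
apply: sqmod_eq0; apply/eqP; rewrite eq_le sqmod_ge0 andbT.
apply/ler_addgt0Pr => e e0; rewrite add0r.
have pm : 0 < p%:R ^ m :> R by rewrite exprz_gt0// pR_gt0.
(* with these choices the two terms C1 and C2 are at most e / 4 *)
pose e1 := e / 4 * p%:R ^ m; pose e2 := e / 32 * p%:R ^ m.
have e10 : 0 < e1 by rewrite mulr_gt0// divr_gt0.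
have e20 : 0 < e2 by rewrite mulr_gt0// divr_gt0.
have [n _ /(_ n (leqnn _))[/= un Fun]] := filterI (L2cvg_near e10 uf) (L2cvg_near e20 Fug).
have [un1 un2] := Lu n.
pose w x := u n x + (-1) * psi x.
have Lw : L1 mu w by apply: L1D => //; exact: L1Z.
have wE x : w x = u n x - psi x by rewrite /w mulN1r.
have kF xi : finite_digits xi -> fourier_L1 mu (u n) xi - g xi = fourier_L1 mu w xi.
  move=> /gF ->; rewrite /fourier_L1 -mulN1r -cintegralZ; last exact: L1_mulchar.
  symmetry; etransitivity; last first.
    by apply: cintegralD; [exact: L1_mulchar|apply: L1Z; exact: L1_mulchar].
  by apply: eq_cintegral => x; rewrite /w mulrDl mulrA.
have H := @ball_integral_bound w _ m h e2 Lw kF (ltW Fun).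
have -> : L2inner mu (fun x => f x - psi x) (cind (cball m h)) =
  L2inner mu (fun x => f x - u n x) (cind (cball m h)) +
  cintegral mu (fun x => w x * cind (cball m h) x).
  rewrite [X in _ + X](_ : _ = L2inner mu w (cind (cball m h))); last first.
    apply: eq_cintegral => x; congr (_ * _).
    by rewrite /cind conjc_real.
  have Lfu : L2 mu (fun x => f x - u n x) by exact: L2B.
  have Lw2 : L2 mu w.
    by rewrite (_ : w = fun x => u n x - psi x); [exact: L2B|exact/funext].
  have := @L2inner_linl _ _ _ mu 1 _ _ _ Lfu Lw2 Lb; rewrite mul1r => <-.
  by congr (L2inner mu _ _); apply/funext => x; rewrite mul1r wE addrA subrK.
apply: le_trans (sqmodD_le _ _) _.
have C1 : sqmod (L2inner mu (fun x => f x - u n x) (cind (cball m h))) <= e / 4.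
  have Lfu : L2 mu (fun x => f x - u n x) by exact: L2B.
  apply: le_trans (cauchy_schwarz Lfu Lb) _.
  rewrite sqL2_ind; last exact: cball_measurable.
  rewrite (mu_cball mu_haar) /= -invr_expz.
  rewrite ler_pdivrMr//.
  rewrite -lee_fin fineK; last exact: L2_fin.
  apply/ltW; rewrite -/e1; apply: le_lt_trans un.
  by apply: le_sqL2 => x; rewrite -sqmodN opprB.
have C2 : sqmod (cintegral mu (fun x => w x * cind (cball m h) x)) <= e / 4.
  apply: le_trans (sqmod_abs1 _) _.
  move: H; set A := abs1 _ => H.
  have : (A / 2) ^+ 2 <= 2 * e2 / p%:R ^ m.
    have e3 : 0 <= 2 * e2 / p%:R ^ m by rewrite divr_ge0 ?mulr_ge0// ltW.
    rewrite -(sqr_sqrtr e3) ler_sqr// nnegrE ?sqrtr_ge0//.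
    by rewrite divr_ge0// abs1_ge0.
  rewrite /e2 mulrA mulfK ?gt_eqF// expr_div_n; lra.
lra.
Qed.

End uniqueness.

(** * The parent map of a rooted tree *)

Section tree.
Context {V : finType} (T : rel V) (r : V).
Hypothesis T_tree : is_tree T.

Lemma parent_exists b : b != r -> exists a, parent T r a b.
Proof.
move=> br; have [_ _ Tc _] := T_tree.
have /connectP[s0 s0P bE] := Tc r b.
case/shortenP: s0P bE => s sP su _ bE.
case/lastP: s sP su bE => [|s c] sP su bE; first by move: br; rewrite bE eqxx.
have cb : c = b by rewrite bE last_rcons.
exists (last r s); exists s; rewrite -cb; split => //.
Qed.

Lemma parent_neq_root a b : parent T r a b -> b != r.
Proof.
move=> [s [_ su _]]; move: su; rewrite cons_uniq mem_rcons in_cons negb_or.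
by move=> /andP[/andP[rb _] _]; rewrite eq_sym.
Qed.

(** If two simple paths from r to b ended with different vertices a and a' before
b, then a and a' would be joined by a path avoiding b, and b would close it to a
cycle of length at least 3. *)
Lemma parent_unique a a' b : parent T r a b -> parent T r a' b -> a = a'.
Proof.
have [Ts Ti _ Tcyc] := T_tree.
pose T' x y := [&& T x y, x != b & y != b].
have T's : symmetric T' by move=> x y; rewrite /T' Ts [X in _ && X]andbC.
have conn c : parent T r c b -> [/\ T c b, connect T' r c & c != b].
  move=> cb; have br := parent_neq_root cb.
  case: cb => s []; rewrite rcons_path => /andP[sP cb] /= /andP[_].
  rewrite rcons_uniq => /andP[bs _] sc; rewrite sc in cb.
  have inb x : x \in r :: s -> x != b.
    rewrite in_cons => /predU1P[->|xs]; first by rewrite eq_sym.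
    by apply: contraNneq bs => <-.
  split => //; last by apply: inb; rewrite -sc mem_last.
  apply/connectP; exists s => //.
  apply: (sub_in_path (P := [in r :: s]) (e := T)) => //.
  by move=> x y xs ys Txy; rewrite /T' Txy !inb.
move=> /conn[ab ca anb] /conn[a'b ca' _]; apply/eqP; apply: contraT => aa'.
have : connect T' a a'.
  by apply: connect_trans ca'; rewrite (sym_connect_sym T's).
move=> /connectP[s0 s0P a'E]; case/shortenP: s0P a'E => s sP su _ a'E.
have sb x : x \in a :: s -> x != b.
  case: s sP {su a'E} => [|y s] /=; first by rewrite inE => _ /eqP ->.
  move=> /andP[/and3P[_ _ yb] ys]; rewrite !inE => /or3P[/eqP->//|/eqP->//|].
  elim: s y ys {yb} => // z s IHs y /= /andP[/and3P[_ _ zb] zs].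
  by rewrite in_cons => /predU1P[->//|]; exact: IHs zs.
have : ucycleb T (b :: a :: s).
  rewrite /ucycleb /= Ts ab /= rcons_path -a'E a'b andbT -/(uniq (a :: s)).
  apply/andP; split; last first.
    rewrite su andbT; apply/negP => /sb; by rewrite eqxx.
  by apply: sub_path sP => x y /and3P[].
apply: contraTT => _; apply: Tcyc.
by case: s {sP su sb} a'E => //= a'E; rewrite a'E eqxx in aa'.
Qed.

(** Iterating q from b follows the simple path from r to b backwards, and then
stays at r; so the number of vertices is enough for D. *)
Lemma tree_parent_fun : exists (q : V -> V) (D : nat), [/\ q r = r,
  forall a b, parent T r a b <-> b != r /\ a = q b &
  forall b, iter D q b = r].
Proof.
have /choice[q qP] : forall b, exists a, (b = r -> a = r) /\ (b != r -> parent T r a b).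
  move=> b; have [->|br] := eqVneq b r; first by exists r.
  by have [a ab] := parent_exists br; exists a; split=> // /eqP; rewrite (negbTE br).
have qr : q r = r by have [-> //] := qP r.
have par a b : parent T r a b <-> b != r /\ a = q b.
  split=> [ab|[br ->]]; last by have [_ H] := qP b; exact: H.
  have br := parent_neq_root ab; split=> //.
  by apply: parent_unique ab _; have [_ H] := qP b; exact: H.
have it n : iter n q r = r by elim: n => //= n ->.
exists q, #|V|; split=> // b.
have [->|br] := eqVneq b r; first exact: it.
have [a [s [sP su _]]] := parent_exists br.
have sz : (size s < #|V|)%N.
  have := card_uniqP su; rewrite /= size_rcons => sz.
  by have := max_card (mem (r :: rcons s b)); rewrite sz => /ltnW.
rewrite -(subnK sz) iterD; suff -> : iter (size s).+1 q b = r by exact: it.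
elim/last_ind: s b {br a sz} sP su => [|s c IHs] b sP su.
  by have /par[_ /esym] : parent T r r b by exists [::].
have /par[_ cq] : parent T r c b by exists (rcons s c); rewrite last_rcons.
rewrite size_rcons iterSr -cq; apply: IHs.
- by move: sP; rewrite rcons_path => /andP[].
- by move: su; rewrite -rcons_cons rcons_uniq => /andP[].
Qed.

End tree.

(** * The refinable function in closed form *)

Section generated_function.
Context {R : realType} {p : nat}.
Hypothesis p_pr : prime p.
Variable mu : {measure set (vilenkin p) -> \bar R}.
Hypothesis mu_haar : is_haar_vilenkin mu.
Local Notation X := (character R p).
Variables (q : 'F_p -> 'F_p) (D : nat) (lam : nat -> R[i]).
Hypotheses (q0 : q 0 = 0) (qD : forall i, iter D q i = 0).
Hypothesis lam0 : lam 0%N = 1.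
Hypothesis lamN : forall i j : 'F_p, j != q i -> lam (i + p * j)%N = 0.
Implicit Types (chi xi : X) (x : vilenkin p) (d : nat -> 'F_p).

(** Positions start at -1, the first one where elements of G_(-1) may be nonzero. *)
Definition digit_sum (M : nat) d x : 'F_p := \sum_(0 <= j < M) d j * x (-1 + j%:Z).

Lemma digit_sum_stable M M' d x : (M <= M')%N -> (forall j, (M <= j)%N -> d j = 0) ->
  digit_sum M' d x = digit_sum M d x.
Proof.
move=> MM d0; rewrite /digit_sum (big_cat_nat (n := M))//=.
rewrite -[RHS]addr0; congr (_ + _); rewrite big_nat_cond big1// => j /andP[/andP[Mj _] _].
by rewrite d0// mul0r.
Qed.

Lemma digit_sum_unit M d j : (j < M)%N -> digit_sum M d (unit_vector (-1 + j%:Z) 1) = d j.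
Proof.
move=> jM; rewrite /digit_sum big_mkord (bigD1 (Ordinal jM))//= eqxx mulr1 big1 ?addr0//.
move=> i ij; rewrite (_ : _ == _ = false) ?mulr0//; apply/eqP => /addrI[] ji.
by move/eqP: ij; case; exact: val_inj.
Qed.

(** The digits are those of the path from i to the root.  Locking keeps
simplification from unfolding the character to sines and cosines. *)
Definition tree_char (i : 'F_p) : X :=
  locked (digit_char R p_pr (-1) D (fun j => iter (absz (j + 1)) q i)).

Lemma tree_charE i x : tree_char i x = expFp (digit_sum D (fun j => iter j q i) x).
Proof.
rewrite /tree_char -lock /= /digit_dot /digit_sum big_mkord; congr expFp.
by apply: eq_bigr => k _; congr (iter _ q i * _); lia.
Qed.

Lemma iter_q0 n : iter n q 0 = 0.
Proof. by elim: n => //= n ->. Qed.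

Lemma iter_q_ge n i : (D <= n)%N -> iter n q i = 0.
Proof. by move=> Dn; rewrite -(subnK Dn) iterD qD iter_q0. Qed.

Definition tree_coef (i : 'F_p) : R[i] :=
  \prod_(0 <= n < D) lam (iter n q i + p * iter n.+1 q i)%N.

Definition tree_fun x : R[i] :=
  cind (Gn p (-1)) x * (p%:R^-1 * \sum_i tree_coef i * tree_char i x).

Lemma L2_ind_char n g chi : L2 mu (fun x => cind (cball n g) x * chi x).
Proof.
apply/L2P; split.
  by apply: cmeasM; [apply: cmeas_ind; exact: cball_measurable|exact: cmeas_char].
rewrite (_ : sqL2 _ _ = sqL2 mu (cind (cball n g))); last first.
  by apply: eq_sqL2 => x; rewrite sqmodM sqmod_char mulr1.
by have /L2P[] : L2 mu (cind (cball n g)) by exact: L2_ind_cball.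
Qed.

Lemma tree_funE x : tree_fun x = \sum_i (p%:R^-1 * tree_coef i) *
  (cind (Gn p (-1)) x * tree_char i x).
Proof.
rewrite /tree_fun mulrA mulr_sumr; apply: eq_bigr => i _; ring.
Qed.

Lemma tree_fun_L2 : L2 mu tree_fun.
Proof.
rewrite (_ : tree_fun = fun x => \sum_i (p%:R^-1 * tree_coef i) *
  (cind (Gn p (-1)) x * tree_char i x)); last by apply/funext => x; exact: tree_funE.
apply: linear_set_sum; first by split; [exact: L2_0|move=> *; exact: L2_lin].
by move=> i; rewrite -cball0; exact: L2_ind_char.
Qed.

Lemma tree_fun_L1 : L1 mu tree_fun.
Proof.
rewrite (_ : tree_fun = fun x => \sum_i (p%:R^-1 * tree_coef i) *
  (cind (Gn p (-1)) x * tree_char i x)); last by apply/funext => x; exact: tree_funE.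
apply: L1_sum => i; apply: L1Z.
by rewrite -cball0; exact: L1_ind_char.
Qed.

Lemma pC_neq0 : p%:R != 0 :> R[i].
Proof. by rewrite pnatr_eq0 -lt0n prime_gt0. Qed.

(** Orthogonality of the characters of G_(-1), whose measure p cancels the factor
p^-1 of [tree_fun]. *)
Lemma fourier_tree_fun xi : fourier_L1 mu tree_fun xi =
  \sum_i tree_coef i * (`[< forall x, Gn p (-1) x -> xi x = tree_char i x >])%:R.
Proof.
rewrite /fourier_L1.
transitivity (cintegral mu (fun x => \sum_i (p%:R^-1 * tree_coef i) *
    (cind (Gn p (-1)) x * (tree_char i * xi^-1)%g x))).
  apply: eq_cintegral => x; rewrite tree_funE mulr_suml; apply: eq_bigr => i _.
  rewrite char_mulE char_invE -!mulrA; congr (_ * (_ * (_ * (_ * _)))).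
  by apply: (mulfI (char_neq0 xi x)); rewrite mul_charJ mulfV ?char_neq0.
have L i : L1 mu (fun x => cind (Gn p (-1)) x * (tree_char i * xi^-1)%g x).
  by rewrite -cball0; exact: L1_ind_char.
rewrite cintegral_sum; last by move=> i; exact: L1Z.
apply: eq_bigr => i _; rewrite cintegralZ// cintegral_char// [p%:R^-1 * _]mulrC -mulrA.
congr (_ * _).
case: asboolP => H; case: asboolP => H' /=; rewrite ?mulr0 ?mulr1//.
- by rewrite rmorph_nat mulVf ?pC_neq0.
- exfalso; apply: H' => x xG; have := H x xG.
  by rewrite char_mulE char_invE => /(canRL (mulfVK (char_neq0 xi x))); rewrite mul1r.
- exfalso; apply: H => x xG; rewrite char_mulE char_invE H' ?mulfV ?char_neq0//.
Qed.


Lemma sum_nat_shift (F : nat -> 'F_p) N c M : (N <= c + M)%N ->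
  (forall k, (k < c)%N -> F k = 0) -> (forall k, (N <= k)%N -> F k = 0) ->
  \sum_(0 <= k < N) F k = \sum_(0 <= j < M) F (c + j)%N.
Proof.
move=> NcM Fc FN.
have E1 : \sum_(0 <= k < c + M) F k = \sum_(0 <= k < N) F k.
  rewrite (big_cat_nat (n := N))//= -[RHS]addr0; congr (_ + _).
  by rewrite big_nat_cond big1// => k /andP[/andP[Nk _] _]; exact: FN.
rewrite -E1 (big_cat_nat (n := c)) ?leq_addr//= -[RHS]add0r; congr (_ + _).
  by rewrite big_nat_cond big1// => k /andP[/andP[_ kc] _]; exact: Fc.
rewrite -{1}[c]add0n big_addn addKn; apply: eq_bigr => j _; by rewrite addnC.
Qed.

(** On G_(-1), the character xi A^(-n) has the digits of xi shifted by n, those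
shifted below position -1 having no effect there. *)
Lemma finite_digitsP xi : finite_digits xi -> exists (d : nat -> 'F_p) (K : nat),
  (forall j, (K <= j)%N -> d j = 0) /\
  forall (n : nat) x, Gn p (-1) x ->
    xi (dilation (- n%:Z) x) = expFp (digit_sum K.+2 (fun j => d (n + j)%N) x).
Proof.
move=> [L [N [b [L1 xiE]]]].
pose a j := if (L <= j) && (j < L + N%:Z) then b j else 0.
pose K := absz (Num.max 0 (L + N%:Z + 1))%R.
exists (fun j => a (j%:Z - 1)), K; split.
  by move=> j Kj; rewrite /a ifF//; apply/negbTE; rewrite negb_and -!leNgt -!ltNge; lia.
move=> n x x1; rewrite xiE; last by apply/Gn_dilation; apply: Gn_le x1; lia.
congr expFp; pose F (k : nat) := a (L + k%:Z) * x (L + k%:Z - n%:Z).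
transitivity (\sum_(0 <= k < N) F k).
  rewrite /digit_dot big_mkord; apply: eq_bigr => k _; rewrite /F /a /= ifT//.
  by have := ltn_ord k; lia.
pose c := absz (n%:Z - 1 - L)%R.
rewrite (@sum_nat_shift F N c K.+2).
- apply: eq_bigr => j _; rewrite /F; congr (a _ * x _); lia.
- rewrite /c /K; lia.
- by move=> k kc; rewrite /F x1 ?mulr0//; lia.
- move=> k Nk; rewrite /F /a ifF ?mul0r//; apply/negbTE.
  by rewrite negb_and -!leNgt -!ltNge; lia.
Qed.

Variable m0 : X -> R[i].
Hypothesis m0P : is_mask p_pr lam m0.

(** Periodicity of m0 removes the digits at positive positions, and a character
trivial on G_(-1) absorbs those below -1. *)
Lemma mask_digits xi d K n : 
  (forall x, Gn p (-1) x ->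
    xi (dilation (- n%:Z) x) = expFp (digit_sum K.+2 (fun j => d (n + j)%N) x)) ->
  m0 (char_dilation xi (- n%:Z)) = lam (d n + p * d n.+1)%N.
Proof.
move=> xiE; have [m01 m02] := m0P.
pose rho := \big[*%g/1%g]_(1 <= k < K.+1)
  (rademacher R p_pr k%:Z ^+ (d (n + k.+1)%N : nat))%g.
pose z := (char_dilation xi (- n%:Z) * (rademacher R p_pr (-1) ^+ (d n : nat) *
  rademacher R p_pr 0 ^+ (d n.+1 : nat) * rho)^-1)%g.
have -> : char_dilation xi (- n%:Z) = (z * rademacher R p_pr (-1) ^+ (d n : nat) *
  rademacher R p_pr 0 ^+ (d n.+1 : nat) * rho)%g.
  apply: characterP => x; rewrite /z !char_mulE char_invE !char_mulE.
  rewrite -[LHS]mulr1 -!mulrA; congr (_ * _).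
  by rewrite mulVf// !mulf_neq0// char_neq0.
rewrite (m02 K (fun k => d (n + k.+1)%N)) m01//.
move=> x x1; rewrite /z char_mulE char_invE !char_mulE.
rewrite -[char_dilation _ _ x]/(xi (dilation (- n%:Z) x)) xiE// !(rademacherXE p_pr).
rewrite char_prodE; under [X in _ / (_ * X)]eq_bigr do rewrite (rademacherXE p_pr).
rewrite -(expFp_sum p_pr) -!(expFpD p_pr) (_ : digit_sum _ _ _ = d n * x (-1) + d n.+1 * x 0 +
  \sum_(1 <= k < K.+1) d (n + k.+1)%N * x k%:Z).
  by rewrite mulfV// expFp_neq0.
rewrite /digit_sum big_nat_recl// big_nat_recl// addn0 addr0 -addrA addn1.
rewrite (_ : -1 + 1%:Z = 0 :> int)//; congr (_ + (_ + _)).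
by rewrite big_add1/=; apply: eq_bigr => k _; congr (d _ * x _); lia.
Qed.

(** All factors with index n >= K are lam 0 = 1. *)
Lemma infinite_product_digits xi d K :
  (forall j, (K <= j)%N -> d j = 0) ->
  (forall (n : nat) x, Gn p (-1) x ->
    xi (dilation (- n%:Z) x) = expFp (digit_sum K.+2 (fun j => d (n + j)%N) x)) ->
  forall M, (K <= M)%N ->
  infinite_product m0 xi = \prod_(0 <= n < M) lam (d n + p * d n.+1)%N.
Proof.
move=> dK xiE M KM.
have E (N : nat) : (M <= N)%N -> \prod_(n < N) m0 (char_dilation xi (- n%:Z)) =
    \prod_(0 <= n < M) lam (d n + p * d n.+1)%N.
  move=> MN; transitivity (\prod_(0 <= n < N) lam (d n + p * d n.+1)%N).
    by rewrite big_mkord; apply: eq_bigr => n _; apply: mask_digits; exact: xiE.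
  rewrite (big_cat_nat (n := M))//= -[RHS]mulr1; congr (_ * _).
  rewrite big_nat_cond big1// => n /andP[/andP[Mn _] _].
  have Kn := leq_trans KM Mn.
  by rewrite !dK ?addn0 ?muln0 ?lam0// (leq_trans Kn).
apply: lim_near_cst; first exact: norm_hausdorff.
by exists M => // N /= MN; exact: E.
Qed.

(** If the digits of xi from position -1 on follow a path to the root, both sides
are the coefficient of its first vertex.  Otherwise some digit is not the parent
of the one before: the infinite product has a zero factor, and xi differs on
G_(-1) from every tree character. *)
Lemma infinite_product_tree xi : finite_digits xi ->
  infinite_product m0 xi = fourier_L1 mu tree_fun xi.
Proof.
move=> /finite_digitsP[d [K [dK xiE]]].
have P := infinite_product_digits dK xiE.
have xi0 x : Gn p (-1) x -> xi x = expFp (digit_sum K.+2 d x).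
  by move=> x1; rewrite -[x in LHS]dilation0; exact: (xiE 0%N).
have xi_digit j : xi (unit_vector (-1 + j%:Z) 1) = expFp (d j).
  rewrite xi0; last by apply: Gn_unit_vector; lia.
  have -> : digit_sum K.+2 d = digit_sum (maxn K.+2 j.+1) d.
    by apply/funext => x; rewrite [RHS](@digit_sum_stable K.+2)// ?leq_maxl// => k ?; apply: dK; lia.
  by rewrite digit_sum_unit// leq_max ltnSn orbT.
have tree_digit i j : tree_char i (unit_vector (-1 + j%:Z) 1) = expFp (iter j q i).
  rewrite tree_charE.
  have -> : digit_sum D (fun j => iter j q i) = digit_sum (maxn D j.+1) (fun j => iter j q i).
    by apply/funext => x; rewrite [RHS](@digit_sum_stable D)// ?leq_maxl// => k ?; exact: iter_q_ge.
  by rewrite digit_sum_unit// leq_max ltnSn orbT.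
have expFp_inj : injective (@expFp R p).
  move=> s t st; apply/eqP; rewrite -subr_eq0; apply/eqP.
  by apply: (@expFp_eq1 R p p_pr); rewrite (expFpD p_pr) (expFpN p_pr) st mul_expFpJ.
have eq_digits i : (forall x, Gn p (-1) x -> xi x = tree_char i x) ->
    forall j, d j = iter j q i.
  move=> E j; apply: expFp_inj; rewrite -xi_digit -tree_digit; apply: E.
  by apply: Gn_unit_vector; lia.
rewrite fourier_tree_fun.
have [dq|/existsNP[n /eqP dn]] := pselect (forall n, d n.+1 = q (d n)).
  have dE j : d j = iter j q (d 0%N) by elim: j => //= j <-; rewrite dq.
  rewrite (bigD1 (d 0%N))//= big1 ?addr0; last first.
    move=> i i0; case: asboolP => [/eq_digits/(_ 0%N)/= di|]; last by rewrite mulr0.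
    by rewrite di eqxx in i0.
  have -> : `[< forall x, Gn p (-1) x -> xi x = tree_char (d 0%N) x >].
    apply/asboolP => x x1; rewrite xi0// tree_charE; congr expFp.
    rewrite (_ : d = fun j => iter j q (d 0%N)); last exact/funext.
    rewrite -[LHS](@digit_sum_stable _ (maxn K.+2 D)) ?leq_maxl//; last first.
      by move=> j Kj; rewrite -dE dK//; lia.
    by rewrite (@digit_sum_stable D)// ?leq_maxr// => j; exact: iter_q_ge.
  rewrite mulr1 (P (maxn K D)) ?leq_maxl// /tree_coef.
  rewrite (big_cat_nat (n := D)) ?leq_maxr//= [X in _ * X]big_nat_cond [X in _ * X]big1 ?mulr1.
    by apply: eq_bigr => k _; rewrite (dE k.+1) (dE k).
  have dD j : (D <= j)%N -> d j = 0 by move=> Dj; rewrite dE iter_q_ge.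
  by move=> k /andP[/andP[Dk _] _]; rewrite (dD k)// (dD k.+1) ?leqW// muln0.
rewrite big1; last first.
  move=> i _; case: asboolP => [/eq_digits E|]; last by rewrite mulr0.
  by rewrite !E /= eqxx in dn.
have nK : (n < K)%N.
  by rewrite ltnNge; apply: contra dn => Kn; rewrite !dK ?q0//; exact: leqW.
by rewrite (P K)// big_mkord (bigD1 (Ordinal nK))//= lamN// mul0r.
Qed.

End generated_function.

(** * Spans of almost equal families *)

Section almost_equal.
Context {d : measure_display} {T : measurableType d} {R : realType}.
Variable mu : {measure set T -> \bar R}.
Implicit Types (f g u v : T -> R[i]).

Lemma sqdistC f g : sqdist mu f g = sqdist mu g f.
Proof. by apply: eq_sqL2 => x; rewrite -sqmodN opprB. Qed.

Lemma sqdist_triangle f g h : L2 mu f -> L2 mu g -> L2 mu h ->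
  (sqdist mu f h <= 2%:E * (sqdist mu f g + sqdist mu g h))%E.
Proof.
move=> Lf Lg Lh; have /L2P[mfg _] := L2B Lf Lg; have /L2P[mgh _] := L2B Lg Lh.
apply: le_trans (sqL2D_le mu mfg mgh).
by apply: le_sqL2 => x; rewrite addrA subrK.
Qed.

Lemma sqdist_eq0_lin (a : R[i]) f f' g g' : L2 mu f -> L2 mu f' -> L2 mu g -> L2 mu g' ->
  sqdist mu f f' = 0%E -> sqdist mu g g' = 0%E ->
  sqdist mu (fun x => a * f x + g x) (fun x => a * f' x + g' x) = 0%E.
Proof.
move=> Lf Lf' Lg Lg' ff' gg'; apply/eqP; rewrite eq_le sqL2_ge0 andbT.
have /L2P[mf _] := L2B Lf Lf'; have /L2P[mg _] := L2B Lg Lg'.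
have := sqL2D_le mu (cmeasZ a mf) mg; rewrite sqL2Z// -/(sqdist mu f f') -/(sqdist mu g g').
rewrite ff' gg' mule0 adde0 mule0; apply: le_trans.
by apply: le_sqL2 => x; rewrite mulrBr opprD addrACA.
Qed.

(** Changing each generator on a null set changes linear combinations on null sets
only. *)
Lemma closed_span_ext (I : Type) (A : set I) (u v : I -> T -> R[i]) :
  (forall i, A i -> [/\ L2 mu (u i), L2 mu (v i) & sqdist mu (u i) (v i) = 0%E]) ->
  closed_span mu [set u i | i in A] `<=` closed_span mu [set v i | i in A].
Proof.
move=> uv f /L2closureP[Lf fu]; apply/L2closureP; split => // e e0.
have lv := linear_span_linear [set v i | i in A].
have LL2 : linear_set (L2 mu) by split; [exact: L2_0|move=> *; exact: L2_lin].
have vL2 : linear_span [set v i | i in A] `<=` L2 mu.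
  by apply: linear_span_min => // _ [i /uv[_ Lv _] <-].
have e2 : 0 < e / 2 by rewrite divr_gt0.
have [g gu fg] := fu _ e2.
have [Lg [g' g'v gg']] : [set g | L2 mu g /\
    exists2 g', linear_span [set v i | i in A] g' & sqdist mu g g' = 0%E] g.
  apply: linear_span_min gu.
    split.
      split; first exact: L2_0.
      exists (fun=> 0); first by have [] := lv.
      by rewrite /sqdist /sqL2; under eq_integral do rewrite subrr sqmod0; rewrite integral0.
    move=> a f1 g1 [Lf1 [f1' vf1 ff1]] [Lg1 [g1' vg1 gg1]]; split; first exact: L2_lin.
    exists (fun x => a * f1' x + g1' x); first by have [_] := lv; apply.
    by apply: sqdist_eq0_lin => //; exact: vL2.
  move=> _ [i Ai <-]; have [Lu Lv uvi] := uv i Ai; split => //.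
  by exists (v i) => //; apply: sub_linear_span; exists i.
exists g' => //; apply: le_lt_trans (sqdist_triangle Lf Lg (vL2 _ g'v)) _.
rewrite gg' adde0; move: fg; have := sqL2_ge0 mu (fun x => f x - g x).
rewrite -/(sqdist mu f g); case: (sqdist mu f g) => [r| |]//= _.
by rewrite -EFinM !lte_fin; lra.
Qed.

Lemma L2inner_sqdist0l f f' g : L2 mu f -> L2 mu f' -> L2 mu g ->
  sqdist mu f f' = 0%E -> L2inner mu f g = L2inner mu f' g.
Proof.
move=> Lf Lf' Lg ff'; apply/eqP; rewrite -subr_eq0; apply/eqP/sqmod_eq0/eqP.
have Lff := L2B Lf Lf'.
rewrite eq_le sqmod_ge0 andbT; have := cauchy_schwarz Lff Lg.
rewrite -/(sqdist mu f f') ff' /= mul0r; apply: le_trans.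
have -> : (fun x => f x - f' x) = (fun x => (-1) * f' x + f x).
  by apply/funext => x; rewrite mulN1r addrC.
by rewrite L2inner_linl// mulN1r addrC.
Qed.

Lemma L2inner_sqdist0 f f' g g' : L2 mu f -> L2 mu f' -> L2 mu g -> L2 mu g' ->
  sqdist mu f f' = 0%E -> sqdist mu g g' = 0%E -> L2inner mu f g = L2inner mu f' g'.
Proof.
move=> Lf Lf' Lg Lg' ff' gg'; rewrite (L2inner_sqdist0l Lf Lf' Lg ff').
by rewrite (L2innerC Lg Lf') (L2inner_sqdist0l Lg Lg' Lf' gg') -(L2innerC Lg' Lf').
Qed.

End almost_equal.

(** * Wave packets *)

Section spaces.
Context {R : realType} {p : nat}.
Hypothesis p_pr : prime p.
Variable mu : {measure set (vilenkin p) -> \bar R}.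
Hypothesis mu_haar : is_haar_vilenkin mu.
Local Notation X := (character R p).
Variables (q : 'F_p -> 'F_p) (D : nat) (lam : nat -> R[i]).
Hypotheses (q0 : q 0 = 0) (qD : forall i, iter D q i = 0).
Hypothesis lam1 : forall i : 'F_p, `|lam (i + p * q i)%N| = 1.
Local Notation Tc := (@tree_char R p p_pr q D).
Local Notation psi := (@tree_fun R p p_pr q D lam).
Local Notation coef := (@tree_coef R p q D lam).
Implicit Types (x y g h : vilenkin p) (m n : int) (i j : 'F_p).

Lemma dilationE n x k : dilation n x k = x (k + n).
Proof. by []. Qed.

Lemma sqmod_tree_coef i : sqmod (coef i) = 1.
Proof.
rewrite /tree_coef; elim/big_ind : _ => [|u v|k _].
- by rewrite /sqmod /= expr1n expr0n addr0.
- by move=> u1 v1; rewrite sqmodM u1 v1 mulr1.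
- exact/sqmod_norm1/lam1.
Qed.

Lemma tree_char0 x : Tc 0 x = 1.
Proof.
rewrite tree_charE /digit_sum big1 ?expFp0// => k _.
by rewrite (iter_q0 q0) mul0r.
Qed.

(** The path from i to the root is i followed by the path from q i; this is the
source of the refinement equation. *)
Lemma tree_char_shift i x : Tc i (dilation (-1) x) = expFp (i * x (-2)) * Tc (q i) x.
Proof.
rewrite !tree_charE -(expFpD p_pr) -(@digit_sum_stable p D D.+1); last 2 first.
- by [].
- by move=> j; exact: (iter_q_ge q0 qD).
congr expFp; rewrite /digit_sum big_nat_recl//=; congr (_ + _).
apply: eq_bigr => k _; rewrite -iterS iterSr; congr (_ * x _); lia.
Qed.

Lemma tree_char_unit i t : (0 < D)%N -> Tc i (unit_vector (-1) t) = expFp (i * t).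
Proof.
move=> D0; rewrite tree_charE /digit_sum big_ltn//= big_nat_cond big1 ?addr0//.
move=> k /andP[/andP[k0 _] _]; rewrite (_ : _ == _ = false) ?mulr0//; lia.
Qed.

Lemma tree_char_coset_constant i : coset_constant (-1 + D%:Z) (Tc i).
Proof.
rewrite /tree_char; unlock.
exact: (coset_constant_comp _ (@digit_dot_coset_constant p _ _ _)).
Qed.

Definition packet g i x : R[i] := cind (cball (-1) g) x * Tc i x.

Definition packets n : set (vilenkin p -> R[i]) :=
  [set (fun x => packet gi.1 gi.2 (dilation n x)) | gi in setT].

Definition packet_space n := linear_span (packets n).

Lemma packet_in n g i : packet_space n (fun x => packet g i (dilation n x)).
Proof. by apply: sub_linear_span; exists (g, i). Qed.

Lemma packet_spaceZ n (c : R[i]) f : packet_space n f -> packet_space n (fun x => c * f x).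
Proof.
have [V0 Vl] := linear_span_linear (packets n) => Vf.
rewrite (_ : (fun _ => _) = (fun x => c * f x + 0)); first exact: Vl Vf V0.
by apply/funext => x; rewrite addr0.
Qed.

Lemma cind_eq (d : measure_display) (T : measurableType d) (A B : set T) (x y : T) :
  (A x <-> B y) -> cind A x = cind B y :> R[i].
Proof.
move=> AB; rewrite /cind !indicE; congr ((_ : bool)%:R%:C)%C.
by apply/idP/idP; rewrite !inE => /AB.
Qed.

Lemma cind_cball n g x : cind (Gn p n) (x - g) = cind (cball n g) x :> R[i].
Proof. exact: cind_eq. Qed.

Lemma tree_fun_translate x h : psi (x - h) =
  \sum_i (p%:R^-1 * coef i * (Tc i h)^*%C) * packet h i x.
Proof.
rewrite tree_funE; apply: eq_bigr => i _.
rewrite cind_cball charD charN /packet; ring.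
Qed.

Definition tree_fun_translates n : set (vilenkin p -> R[i]) :=
  [set (fun x => psi (dilation n x - h)) | h in H0 p].

Lemma tree_fun_translates_sub n : tree_fun_translates n `<=` packet_space n.
Proof.
move=> _ [h _ <-].
rewrite (_ : (fun _ => _) = fun x =>
  \sum_i (p%:R^-1 * coef i * (Tc i h)^*%C) * packet h i (dilation n x)).
  by apply: linear_set_sum; [exact: linear_span_linear|exact: packet_in].
by apply/funext => x; exact: tree_fun_translate.
Qed.

Fact trunc_subproof n x : (fun k : int => if k < n then x k else 0) \in vilenkin_pred p.
Proof.
have /vilenkin_predP[N xN] := valP x; apply/vilenkin_predP; exists N => k kN.
by rewrite xN// if_same.
Qed.

Definition trunc n x := Vilenkin (trunc_subproof n x).

Lemma Gn_trunc n x : Gn p n (x - trunc n x).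
Proof. by move=> k kn; rewrite coordB /= kn subrr. Qed.

Lemma D_gt0 : (0 < D)%N.
Proof.
rewrite lt0n; apply/eqP => D0; have := qD 1; rewrite D0 /= => /eqP.
by rewrite oner_eq0.
Qed.

(** Translating [tree_fun] by t at position -1 multiplies its term of index i by
the conjugate of expFp (i * t); averaging over t against expFp (i * t) isolates
that term. *)
Lemma packets_sub n : packets n `<=` linear_span (tree_fun_translates n).
Proof.
move=> _ [[g i] _ <-] /=.
(* elements of H_0 in the coset of g modulo G_(-1) *)
pose h0 := trunc (-1) g; pose ht (t : 'F_p) := h0 + unit_vector (-1) t.
have H0h t : H0 p (ht t).
  move=> k k0; rewrite coordD unit_vectorE /= ifF; last by lia.
  by rewrite ifF ?addr0//; lia.
have cg t : cball (-1) (ht t) = cball (-1) g.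
  apply: cball_eq; rewrite /ht addrAC; apply: GnD; last by apply: Gn_unit_vector.
  by rewrite -opprB; apply: GnN; exact: Gn_trunc.
rewrite (_ : (fun _ => _) = fun x => \sum_(t : 'F_p)
  ((coef i)^*%C * Tc i h0 * expFp (i * t)) * psi (dilation n x - ht t)).
  apply: linear_set_sum; first exact: linear_span_linear.
  by move=> t; apply: sub_linear_span; exists (ht t).
apply/funext => x; set y := dilation n x.
under eq_bigr => t _ do rewrite tree_fun_translate mulr_sumr.
have conjM (a b : R[i]) : (a * b)^*%C = a^*%C * b^*%C by exact: rmorphM.
rewrite exchange_big/= (bigD1 i)//= [X in _ + X]big1 ?addr0; last first.
  move=> j ji; rewrite (eq_bigr (fun t =>
    ((coef i)^*%C * Tc i h0 * (p%:R^-1 * coef j * (Tc j h0)^*%C) * packet g j y) *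
    expFp (t * (i - j)))).
    by rewrite -mulr_sumr (sum_expFp p_pr) subr_eq0 eq_sym (negbTE ji) mulr0.
  move=> t _; rewrite /packet cg /ht charD tree_char_unit ?D_gt0// conjM -(expFpN p_pr).
  by rewrite mulrBr (expFpD p_pr) [t * i]mulrC -[t * j]mulrC; ring.
rewrite (eq_bigr (fun t =>
  (coef i)^*%C * Tc i h0 * (p%:R^-1 * coef i * (Tc i h0)^*%C) * packet g i y)).
  rewrite sumr_const card_Fp// -[RHS]mulr_natl.
  transitivity ((coef i * (coef i)^*%C) * (Tc i h0 * (Tc i h0)^*%C) *
      (p%:R^-1 * p%:R) * packet g i y); last by ring.
  by rewrite mulJ_sqmod sqmod_tree_coef mul_charJ mulVf ?pC_neq0// !mul1r.
move=> t _; rewrite /packet cg /ht charD tree_char_unit ?D_gt0// conjM.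
rewrite -[in RHS](mulr1 ((coef i)^*%C)) -(mul_expFpJ (i * t)); ring.
Qed.

Lemma span_tree_fun_translates n : linear_span (tree_fun_translates n) = packet_space n.
Proof.
apply/seteqP; split; apply: linear_span_min; try exact: linear_span_linear.
- exact: tree_fun_translates_sub.
- exact: packets_sub.
Qed.

(** Seen at the finer scale, the ball of a packet is a ball of index -2, which is
the union of p balls of index -1.  On each of them the factor of [tree_char_shift]
is constant. *)
Lemma packet_spaceS n : packet_space n `<=` packet_space (n + 1).
Proof.
apply: linear_span_min; first exact: linear_span_linear.
move=> _ [[g i] _ <-] /=.
pose gt (t : 'F_p) := dilation 1 g + unit_vector (-2) t.
rewrite (_ : (fun _ => _) = fun x => \sum_(t : 'F_p)
  expFp (i * (gt t) (-2)) * packet (gt t) (q i) (dilation (n + 1) x)).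
  apply: linear_set_sum; first exact: linear_span_linear.
  by move=> t; exact: packet_in.
apply/funext => x; set z := dilation (n + 1) x.
have -> : dilation n x = dilation (-1) z.
  by rewrite /z -dilationD addrC addrK.
have [zg|zg] := pselect (cball (-1) g (dilation (-1) z)); last first.
  rewrite /packet ind_out// mul0r big1// => t _; rewrite ind_out ?mul0r ?mulr0// => zt.
  apply: zg => k k1; rewrite coordB dilationE.
  have := zt (k - 1). rewrite coordB /gt coordD dilationE unit_vectorE.
  rewrite [X in _ - (X + _)](_ : _ = g k); last by congr (g _); lia.
  rewrite ifF ?addr0; first by apply; lia.
  by lia.
pose t0 := z (-2) - g (-1).
rewrite (bigD1 t0)//= big1 ?addr0; last first.
  move=> t tt0; rewrite /packet ind_out ?mul0r ?mulr0// => zt.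
  have := zt (-2) isT; rewrite coordB coordD dilationE unit_vectorE eqxx => H.
  by case/eqP: tt0; apply/eqP; rewrite -subr_eq0 /t0 -oppr_eq0 opprB -addrA -opprD H.
have zt0 : cball (-1) (gt t0) z.
  move=> k k1; rewrite coordB coordD dilationE unit_vectorE; case: eqP => [->|k2].
    by rewrite /t0 (_ : -2 + 1 = -1 :> int)// [g _ + _]addrC subrK subrr.
  have := zg (k + 1); rewrite coordB dilationE addrK addr0; apply; lia.
rewrite /packet ind_id// ind_id// !mul1r tree_char_shift; congr (expFp (_ * _) * _).
rewrite -[RHS]/(g (-2 + 1) + (if -2 == -2 :> int then t0 else 0)) eqxx /t0.
by rewrite (_ : -2 + 1 = -1 :> int)// addrC subrK.
Qed.

Lemma packet_space_le m n : m <= n -> packet_space m `<=` packet_space n.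
Proof.
move=> mn; have -> : n = m + (absz (n - m))%:Z by lia.
elim: (absz _) => [|k IHk]; first by rewrite addr0.
by apply: subset_trans IHk _; rewrite intS addrCA addrC; exact: packet_spaceS.
Qed.

Lemma packet_space_L2 n : packet_space n `<=` L2 mu.
Proof.
apply: linear_span_min; first by split; [exact: L2_0|move=> *; exact: L2_lin].
move=> _ [[g i] _ <-] /=; apply: (@L2_dilation R p p_pr mu mu_haar n (packet g i)).
exact: L2_ind_char.
Qed.

(** A tree character has at most D nonzero digits, at positions below D - 1. *)
Lemma packet_space_coset_constant n f : packet_space n f -> coset_constant (n + D%:Z) f.
Proof.
have D0 := D_gt0; move: f; apply: linear_span_min.
  split; first by [].
  by move=> a f g lf lg x y xy; rewrite (lf x y xy) (lg x y xy).
move=> _ [[g i] _ <-] x y xy /=.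
have dxy : Gn p D%:Z (dilation n x - dilation n y).
  by rewrite -dilationB; apply/Gn_dilation; rewrite addrC.
rewrite /packet (@tree_char_coset_constant i _ _ (Gn_le _ dxy)); last by lia.
have D1 : -1 <= D%:Z by lia.
by rewrite /cind !indicE (coset_constant_cball g D1 dxy).
Qed.

(** The tree character of the root is 1. *)
Lemma ball_in_packet_space n g : packet_space (n + 1) (cind (cball n g)).
Proof.
rewrite (_ : cind _ = fun x => packet (dilation (n + 1) g) 0 (dilation (n + 1) x)).
  exact: packet_in.
apply/funext => x; rewrite /packet tree_char0 mulr1; apply: cind_eq.
have E : -1 + (n + 1) = n by lia.
rewrite /cball/= -dilationB; split => H; first by apply/Gn_dilation; rewrite E.
by move/Gn_dilation: H; rewrite E.
Qed.

Lemma packet_space_dilation n k f : packet_space n f ->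
  packet_space (n + k) (fun x => f (dilation k x)).
Proof.
move: f; apply: linear_span_min.
  have [V0 Vl] := linear_span_linear (packets (n + k)); split; first exact: V0.
  by move=> a f g; exact: Vl.
move=> _ [[g i] _ <-] /=.
rewrite (_ : (fun _ => _) = fun x => packet g i (dilation (n + k) x)); first exact: packet_in.
by apply/funext => x; rewrite dilationD.
Qed.

Lemma packet_space_translation f h : packet_space 0 f -> packet_space 0 (fun x => f (x - h)).
Proof.
move: f; apply: linear_span_min.
  have [V0 Vl] := linear_span_linear (packets 0); split; first exact: V0.
  by move=> a f g; exact: Vl.
move=> _ [[g i] _ <-] /=.
rewrite (_ : (fun _ => _) = fun x => (Tc i h)^*%C * packet (g + h) i (dilation 0 x)).
  by apply: packet_spaceZ; exact: packet_in.
apply/funext => x; rewrite !dilation0 /packet charD charN.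
rewrite (@cind_eq _ _ _ (cball (-1) (g + h)) _ x); first by ring.
by rewrite /cball/= opprD addrA addrAC.
Qed.

End spaces.

(** * The multiresolution analysis *)

Section mra.
Context {R : realType} {p : nat}.
Hypothesis p_pr : prime p.
Variable mu : {measure set (vilenkin p) -> \bar R}.
Hypothesis mu_haar : is_haar_vilenkin mu.
Local Notation X := (character R p).
Variables (q : 'F_p -> 'F_p) (D : nat) (lam : nat -> R[i]).
Hypotheses (q0 : q 0 = 0) (qD : forall i, iter D q i = 0).
Hypothesis lam1 : forall i : 'F_p, `|lam (i + p * q i)%N| = 1.
Local Notation Tc := (@tree_char R p p_pr q D).
Local Notation psi := (@tree_fun R p p_pr q D lam).
Local Notation coef := (@tree_coef R p q D lam).
Local Notation S := (@packet_space R p p_pr q D).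
Implicit Types (x y g h : vilenkin p) (m n : int) (i j : 'F_p).

Let psi_L2 : L2 mu psi := tree_fun_L2 p_pr mu_haar q D lam.

Lemma cintegral_ball_char n g (chi : X) :
  cintegral mu (fun x => cind (cball n g) x * chi x) =
  chi g * (if `[< annihilator R p n chi >] then (p%:R ^ (- n))%:C%C else 0).
Proof.
rewrite -(cintegral_char p_pr mu_haar) -cintegralZ; last first.
  by rewrite -cball0; exact: L1_ind_char.
rewrite -[LHS](cintegral_translation mu_haar (- g)); last exact: L1_ind_char.
apply: eq_cintegral => x; rewrite opprK charD.
rewrite (@cind_eq R _ _ (cball n g) (Gn p n) (x + g) x); first by ring.
by rewrite /cball/= addrK.
Qed.

(** Translates by h and h' have disjoint supports unless h - h' is in G_(-1), in
which case h - h' is t at position -1 and 0 elsewhere.  Then the distinct tree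
characters are orthogonal on the common support, and the inner product is
p^-1 times the sum of the conjugates of expFp (i * t) over i. *)
Lemma tree_fun_orthonormal h h' : H0 p h -> H0 p h' ->
  L2inner mu (fun x => psi (x - h)) (fun x => psi (x - h')) = (h == h')%:R.
Proof.
move=> hH hH'; rewrite /L2inner.
have [hh|hh] := pselect (Gn p (-1) (h - h')); last first.
  have -> : (h == h') = false.
    by apply/eqP => hE; apply: hh; rewrite hE subrr; exact: Gn0.
  rewrite (@eq_cintegral _ _ _ _ _ (fun=> 0)).
    by rewrite /cintegral !Rintegral_cst// !mul0r.
  move=> x; rewrite /tree_fun; have [xh|xh] := pselect (Gn p (-1) (x - h)); last first.
    by rewrite ind_out ?mul0r.
  rewrite [cind _ (x - h')]ind_out ?mul0r ?conjc0 ?mulr0// => xh'; apply: hh.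
  by rewrite -(subrKA x) addrC -[h - x]opprB; exact: GnB.
have D0 : (0 < D)%N by exact: D_gt0 qD.
pose t := (h - h') (-1).
have hE : h - h' = unit_vector (-1) t.
  apply: vilenkinP => k; rewrite unit_vectorE; case: eqP => [->//|k1].
  have [k0|k0] := ltP k (-1); first exact: hh.
  by rewrite coordB hH ?hH' ?subrr//; lia.
have -> : (h == h') = (t == 0).
  rewrite -subr_eq0; apply/eqP/eqP => [E|t0]; first by rewrite /t E.
  by rewrite hE t0; apply: vilenkinP => k; rewrite unit_vectorE if_same.
pose a i : R[i] := p%:R^-1 * coef i * (Tc i h)^*%C.
pose b i : R[i] := p%:R^-1 * (coef i)^*%C * Tc i h'.
have conjM (u v : R[i]) : (u * v)^*%C = u^*%C * v^*%C by exact: rmorphM.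
transitivity (cintegral mu (fun x => \sum_i \sum_j (a i * b j) *
    (cind (cball (-1) h) x * (Tc i * (Tc j)^-1)%g x))).
  apply: eq_cintegral => x; rewrite !tree_fun_translate mulr_suml; apply: eq_bigr => i _.
  have -> : (\sum_j p%:R^-1 * coef j * (Tc j h')^*%C * packet p_pr q D h' j x)^*%C =
      \sum_j (p%:R^-1 * coef j * (Tc j h')^*%C * packet p_pr q D h' j x)^*%C by exact: rmorph_sum.
  rewrite mulr_sumr; apply: eq_bigr => j _; rewrite !conjM conjcK conjc_inv conjc_nat.
  rewrite /packet -(cball_eq hh) char_mulE char_invE /a /b.
  have -> : (Tc j x)^*%C = (Tc j x)^-1.
    by apply: (mulfI (char_neq0 (Tc j) x)); rewrite mul_charJ mulfV ?char_neq0.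
  have [xh|xh] := pselect (cball (-1) h x); last by rewrite ind_out// !(mul0r, mulr0).
  by rewrite ind_id// conjc1 !mul1r; ring.
have L i j : L1 mu (fun x => (a i * b j) * (cind (cball (-1) h) x * (Tc i * (Tc j)^-1)%g x)).
  by apply: L1Z; exact: L1_ind_char.
rewrite cintegral_sum; last by move=> i; exact: L1_sum.
transitivity (\sum_i a i * b i * p%:R).
  apply: eq_bigr => i _; rewrite cintegral_sum//.
  have E j : cintegral mu (fun x => (a i * b j) *
        (cind (cball (-1) h) x * (Tc i * (Tc j)^-1)%g x)) =
      a i * b j * (if i == j then p%:R else 0).
    rewrite cintegralZ; last exact: L1_ind_char.
    rewrite cintegral_ball_char; congr (_ * _); have [<-|ij] := eqVneq i j.
      rewrite char_mulE char_invE mulfV ?char_neq0// mul1r.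
      case: asboolP => [_|H]; first by rewrite opprK expr1z rmorph_nat.
      by case: H => x _; rewrite char_mulE char_invE mulfV ?char_neq0.
    case: asboolP => H; last by rewrite mulr0.
    have := H (unit_vector (-1) 1) (Gn_unit_vector _ (lexx _)).
    rewrite char_mulE char_invE !tree_char_unit// !mulr1 => /(canRL (mulfVK (expFp_neq0 _))).
    rewrite mul1r => ep_ij; case/eqP: ij; apply/eqP; rewrite -subr_eq0; apply/eqP.
    by apply: (@expFp_eq1 R p p_pr); rewrite (expFpD p_pr) (expFpN p_pr) ep_ij mul_expFpJ.
  under eq_bigr do rewrite E.
  rewrite (bigD1 i)//= eqxx big1 ?addr0// => j ji.
  by rewrite eq_sym (negbTE ji) mulr0.
have pN := @pC_neq0 R p p_pr.
transitivity (\sum_(i : 'F_p) p%:R^-1 * expFp (i * - t) : R[i]).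
  apply: eq_bigr => i _; rewrite mulrN (expFpN p_pr).
  rewrite -(tree_char_unit p_pr q i t D0) -hE charD charN.
  rewrite conjM conjcK /a /b.
  transitivity ((coef i * (coef i)^*%C) * (p%:R^-1 * p%:R) * p%:R^-1 *
    ((Tc i h)^*%C * Tc i h')); first by ring.
  by rewrite mulJ_sqmod (sqmod_tree_coef D lam1)// mulVf// !mul1r.
rewrite -mulr_sumr (sum_expFp p_pr) oppr_eq0; case: eqP => _; last by rewrite mulr0.
by rewrite mulVf.
Qed.

Section phi.
Variable phi : vilenkin p -> R[i].
Hypotheses (phi_L2 : L2 mu phi) (phi_psi : sqdist mu phi psi = 0%E).

Lemma sqdist_translate n h :
  sqdist mu (fun x => phi (dilation n x - h)) (fun x => psi (dilation n x - h)) = 0%E.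
Proof.
have Lf := L2B phi_L2 psi_L2; have /L2P[mf _] := L2_translation mu_haar h Lf.
rewrite /sqdist -[LHS]/(sqL2 mu (fun x => (fun y => phi (y - h) - psi (y - h)) (dilation n x))).
rewrite (sqL2_dilation p_pr mu_haar)//.
have /L2P[mf0 _] := Lf.
by rewrite (sqL2_translation mu_haar h mf0) -/(sqdist mu phi psi) phi_psi mule0.
Qed.

Lemma L2_dilation_translation (f : vilenkin p -> R[i]) n h : L2 mu f ->
  L2 mu (fun x => f (dilation n x - h)).
Proof.
move=> Lf; apply: (@L2_dilation R p p_pr mu mu_haar n (fun y => f (y - h))).
exact: L2_translation.
Qed.

Lemma mra_spaceE n : mra_space mu phi n = L2closure mu (S n).
Proof.
have -> : L2closure mu (S n) = closed_span mu (tree_fun_translates p_pr q D lam n).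
  by rewrite /closed_span span_tree_fun_translates.
apply/seteqP; split; apply: closed_span_ext => h hH; split; try exact: L2_dilation_translation.
- exact: sqdist_translate.
- by rewrite sqdistC; exact: sqdist_translate.
Qed.

Lemma phi_orthonormal : orthonormal_system mu (H0 p) (translation phi).
Proof.
split=> [h _|h h' hH hH']; first exact: L2_translation.
have E0 (f : vilenkin p -> R[i]) g : translation f g = fun x => f (dilation 0 x - g).
  by apply/funext => x; rewrite dilation0.
have E g : sqdist mu (translation phi g) (translation psi g) = 0%E.
  by rewrite !E0; exact: sqdist_translate.
rewrite (L2inner_sqdist0 _ _ _ _ (E h) (E h')); first exact: tree_fun_orthonormal.
- exact: L2_translation.
- exact: L2_translation.
- exact: L2_translation.
- exact: L2_translation.
Qed.

Let S_L2 n : S n `<=` L2 mu := @packet_space_L2 R p p_pr mu mu_haar q D n.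

Lemma packet_closure_closed n : closed_subspace mu (L2closure mu (S n)).
Proof.
apply: closed_subspace_closure; first exact: S_L2.
exact: linear_span_linear.
Qed.

Lemma packet_closure_dilation n k f : L2closure mu (S n) f ->
  L2closure mu (S (n + k)) (fun x => f (dilation k x)).
Proof.
move=> /L2closureP[Lf fS]; apply/L2closureP; split.
  exact: (@L2_dilation R p p_pr mu mu_haar).
move=> e e0; have pk : 0 < p%:R ^ (- k) :> R by rewrite exprz_gt0// pR_gt0.
have [g gS fg] := fS (e / p%:R ^ (- k)) (divr_gt0 e0 pk).
exists (fun x => g (dilation k x)); first exact: packet_space_dilation.
have /L2P[mfg _] := L2B Lf (S_L2 gS).
rewrite /sqdist -[sqL2 _ _]/(sqL2 mu (fun x => (fun y => f y - g y) (dilation k x))).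
rewrite (sqL2_dilation p_pr mu_haar k mfg).
have : (sqdist mu f g < (e / p%:R ^ (- k))%:E)%E by [].
rewrite /sqdist; have := sqL2_ge0 mu (fun x => f x - g x).
case: (sqL2 _ _) => [r| |]//= _; rewrite -EFinM !lte_fin ltr_pdivlMr//.
by rewrite mulrC.
Qed.

Lemma packet_closure_translation f h : L2closure mu (S 0) f ->
  L2closure mu (S 0) (translation f h).
Proof.
move=> /L2closureP[Lf fS]; apply/L2closureP; split; first exact: L2_translation.
move=> e e0; have [g gS fg] := fS e e0.
exists (fun x => g (x - h)); first exact: packet_space_translation.
have /L2P[mfg _] := L2B Lf (S_L2 gS).
by rewrite /sqdist (sqL2_translation mu_haar h mfg).
Qed.

Lemma packet_union_linear : linear_set (\bigcup_n S n).
Proof.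
split.
  by exists 0; [by []|exact: (linear_span_linear (packets p_pr q D 0)).1].
move=> a f g [m _ fm] [n _ gn]; exists (Num.max m n) => //.
apply: (linear_span_linear (packets p_pr q D (Num.max m n))).2.
- by apply: packet_space_le fm => //; rewrite le_max lexx.
- by apply: packet_space_le gn => //; rewrite le_max lexx orbT.
Qed.

Lemma packet_union_dense : L2 mu `<=` L2closure mu (\bigcup_n S n).
Proof.
apply: (balls_total mu_haar).
  apply: closed_subspace_closure packet_union_linear.
  by move=> f [n _]; exact: S_L2.
move=> n g; apply: sub_L2closure; last by exists (n + 1) => //; exact: ball_in_packet_space.
by move=> f [k _]; exact: S_L2.
Qed.

(** The inner product is g h times the measure of the ball, and as g is constant on
the larger coset of G_k its norm bounds its value at h. *)
Lemma coset_constant_ball_inner (g : vilenkin p -> R[i]) (k : int) m h :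
  L2 mu g -> coset_constant k g -> k <= m ->
  sqmod (L2inner mu g (cind (cball m h))) <=
  fine (sqL2 mu g) * p%:R ^ k * (p%:R ^ (- m)) ^+ 2.
Proof.
move=> Lg gk km.
have mb := @cball_measurable p m h.
have -> : L2inner mu g (cind (cball m h)) = g h * (p%:R ^ (- m))%:C%C.
  transitivity (cintegral mu (fun x => g h * cind (cball m h) x)).
    apply: eq_cintegral => x; rewrite [X in _ * X](_ : _ = cind (cball m h) x).
      have [xh|xh] := pselect (cball m h x); last by rewrite ind_out ?mulr0.
      by rewrite ind_id// !mulr1; apply: gk; exact: Gn_le xh.
    by rewrite /cind conjc_real.
  rewrite cintegralZ; last by apply: L1_ind => //; exact: mu_cball_fin.
  by rewrite cintegral_ind// mu_cball.
rewrite sqmodM sqmod_real ler_wpM2r ?sqr_ge0//.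
have pk : 0 < p%:R ^ k :> R by rewrite exprz_gt0// pR_gt0.
rewrite -ler_pdivrMr// invr_expz.
have mbk := @cball_measurable p k h.
rewrite -lee_fin fineK ?L2_fin//.
have -> : (sqmod (g h) * p%:R ^ (- k))%:E = sqL2 mu (fun x => g h * cind (cball k h) x).
  by rewrite sqL2Z ?sqL2_ind//; [rewrite mu_cball|exact: cmeas_ind].
apply: le_sqL2 => x; have [xh|xh] := pselect (cball k h x).
  by rewrite ind_id// mulr1 (gk _ _ xh).
by rewrite ind_out// mulr0 sqmod0 sqmod_ge0.
Qed.

Lemma expz_small (e : R) m : 0 < e -> exists2 k : int, k <= m & p%:R ^ k < e.
Proof.
move=> e0; pose K := maxn (Num.bound e^-1) (absz m).
exists (- K%:Z); first by rewrite /K; lia.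
rewrite -invr_expz -exprnP invf_plt ?posrE ?exprn_gt0 ?pR_gt0//.
apply: lt_le_trans (archi_boundP _) _; first by rewrite invr_ge0 ltW.
rewrite -natrX ler_nat.
apply: (@leq_trans K); first by rewrite leq_maxl.
by apply/ltnW/ltn_expl/prime_gt1.
Qed.

(** For every k, f is a limit of functions constant on the cosets of G_k.  The
integrals of such functions over a fixed ball tend to 0 as k tends to -oo, so f
is orthogonal to the indicators of balls. *)
Lemma packet_intersection_trivial f : (forall n, L2closure mu (S n) f) -> sqL2 mu f = 0%E.
Proof.
move=> fS; have /L2closureP[Lf _] := fS 0.
apply: (L2_orthogonal_balls mu_haar Lf) => m h.
have Lb : L2 mu (cind (cball m h)) by exact: L2_ind_cball.
rewrite L2innerC// (_ : L2inner _ _ _ = 0) ?conjc0//.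
apply: sqmod_eq0; apply/eqP; rewrite eq_le sqmod_ge0 andbT.
apply/ler_addgt0Pr => e e0; rewrite add0r.
pose P : R := p%:R ^ (- m).
have P0 : 0 < P by rewrite exprz_gt0// pR_gt0.
pose F := fine (sqL2 mu f).
have F0 : 0 <= F by rewrite fine_ge0// sqL2_ge0.
(* e1 and k are chosen to make the terms C1 and C2 below at most e / 4 *)
pose e1 := Num.min 1 (e / 4 / P).
have e10 : 0 < e1 by rewrite lt_min ltr01 !divr_gt0.
have c0 : 0 < e / 8 / (F + 1) / P ^+ 2.
  by rewrite !divr_gt0 ?exprn_gt0// ltr_wpDl.
have [k km kc] := expz_small m c0.
have /L2closureP[_ /(_ _ e10)[g gS fg]] := fS (k - D%:Z).
have gk : coset_constant k g.
  have := packet_space_coset_constant qD gS; by rewrite subrK.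
have Lg := S_L2 gS; have Lfg := L2B Lf Lg.
have -> : L2inner mu f (cind (cball m h)) =
  L2inner mu (fun x => f x - g x) (cind (cball m h)) + L2inner mu g (cind (cball m h)).
  have := @L2inner_linl _ _ _ mu 1 _ _ _ Lfg Lg Lb; rewrite mul1r => <-.
  by congr (L2inner mu _ _); apply/funext => x; rewrite mul1r subrK.
apply: le_trans (sqmodD_le _ _) _.
have fgE : fine (sqdist mu f g) < e1 by rewrite -lte_fin fineK// L2_fin.
have C1 : sqmod (L2inner mu (fun x => f x - g x) (cind (cball m h))) <= e / 4.
  apply: le_trans (cauchy_schwarz Lfg Lb) _.
  rewrite sqL2_ind; last exact: cball_measurable.
  rewrite (mu_cball mu_haar) /= -/P -ler_pdivlMr//.
  apply: ltW; apply: lt_le_trans fgE _; by rewrite ge_min lexx orbT.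
have C2 : sqmod (L2inner mu g (cind (cball m h))) <= e / 4.
  apply: le_trans (coset_constant_ball_inner h Lg gk km) _; rewrite -/P.
  have G2 : fine (sqL2 mu g) <= 2 * (F + 1).
    have L0 := L2_0 mu.
    have := sqdist_triangle Lg Lf L0.
    have N0 u : sqdist mu u (fun=> 0) = sqL2 mu u by apply: eq_sqL2 => x; rewrite subr0.
    rewrite !N0 sqdistC -(fineK (L2_fin Lg)) -(fineK (L2_fin Lf)).
    rewrite -[sqdist _ _ _](fineK (L2_fin Lfg)).
    rewrite -EFinD -EFinM lee_fin => H; apply: le_trans H _.
    rewrite ler_pM2l// addrC lerD2l; apply: ltW; apply: lt_le_trans fgE _.
    by rewrite ge_min lexx.
  have G3 : p%:R ^ k * P ^+ 2 * (F + 1) <= e / 8.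
    rewrite -ler_pdivlMr ?ltr_wpDl// -ler_pdivlMr ?exprn_gt0//.
    exact: ltW.
  have G4 : 0 <= p%:R ^ k * P ^+ 2 by rewrite mulr_ge0 ?sqr_ge0// exprz_ge0.
  rewrite -mulrA; have := ler_wpM2r G4 G2; move: (_ ^+ 2) (_ ^ k) G3 {G4} => U W; lra.
lra.
Qed.

Theorem tree_fun_MRA : generates_orthogonal_MRA mu phi.
Proof.
split; first exact: phi_orthonormal.
have VE : mra_space mu phi = fun n => L2closure mu (S n).
  by apply/funext => n; exact: mra_spaceE.
have V0E : closed_span mu [set translation phi h | h in H0 p] = mra_space mu phi 0.
  suff -> : translation phi = (fun h x => phi (dilation 0 x - h)) by [].
  by apply/funext => h; apply/funext => x; rewrite dilation0.
split; first by move=> n; rewrite VE; exact: packet_closure_closed.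
split.
- move=> n; rewrite VE; apply: L2closure_subset.
  by apply: packet_spaceS.
- split.
    apply/seteqP; split=> [f []//|f Lf].
    apply: L2closure_subset (packet_union_dense Lf).
    by move=> g [n _ gS]; exists n => //; rewrite VE; apply: sub_L2closure => //; exact: S_L2.
  rewrite VE; apply/seteqP; split=> [f fV|f [Lf f0] n _].
    have fS n : L2closure mu (S n) f by exact: fV.
    have [Lf _] := fS 0; split => //.
    have /L2P[mf _] := Lf.
    by apply/(sqL2_eq0 mu mf); exact: packet_intersection_trivial.
  apply/L2closureP; split => // e e0.
  exists (fun=> 0); first exact: (linear_span_linear (packets p_pr q D n)).1.
  have /L2P[mf _] := Lf.
  have /(sqL2_eq0 mu mf) f0' := f0.
  have -> : sqdist mu f (fun=> 0) = sqL2 mu f by apply: eq_sqL2 => x; rewrite subr0.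
  by rewrite f0' lte_fin.
- move=> n f; rewrite VE; split; first exact: packet_closure_dilation.
  move=> /(packet_closure_dilation (-1)); rewrite addrK.
  rewrite (_ : (fun x => _) = f)//; apply/funext => x.
  by rewrite -dilationD addrN dilation0.
- by move=> f h; rewrite VE => fV _; exact: packet_closure_translation.
- split; first exact: phi_orthonormal.
  exact: V0E.
Qed.

End phi.
End mra.

Theorem theorem4p2 (R : realType) (p : nat) (p_pr : prime p) (p_ge3 : (3 <= p)%N)
    (mu : {measure set (vilenkin p) -> \bar R})
    (nu : {measure set (character R p) -> \bar R})
    (mu_haar : is_haar_vilenkin mu) (nu_haar : is_haar_character nu)
    (T : rel 'F_p) (T_tree : is_tree T) (phi : vilenkin p -> R[i])
    (phi_gen : refinable_generated_by p_pr mu nu T phi) :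
  generates_orthogonal_MRA mu phi.
Proof.
have [lam [m0 [[lam0 lam1 lamN] m0P phiF]]] := phi_gen.
have [q [D [q0 par qD]]] := @tree_parent_fun _ _ 0 T_tree.
have lam_edge (i : 'F_p) : `|lam (i + p * q i)%N| = 1.
  have [->|i0] := eqVneq i 0; first by rewrite q0 /= muln0 lam0 normr1.
  by apply: lam1; apply/par.
have lam_nonedge (i j : 'F_p) : j != q i -> lam (i + p * j)%N = 0.
  move=> jq; apply: lamN; first by move=> /par[_ /eqP]; rewrite (negbTE jq).
  by apply: contra jq => /eqP[-> ->]; rewrite q0.
apply: (tree_fun_MRA mu_haar q0 qD lam_edge); first by have [] := phiF.
apply: (fourier_unique p_pr mu_haar nu_haar phiF).
  by split; [exact: tree_fun_L1|exact: tree_fun_L2].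
move=> xi; exact: infinite_product_tree.
Qed.
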